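(* Let $n\ge 1$ and let $\Phi$ be the fermionic product channel on $n$ qubits with attenuation coefficients $0\le b_1,\ldots,b_{2n}\le 1$, i.e. the linear map on operators of $(\mathbb{C}^2)^{\otimes n}$ defined by $\Phi(I)=I$ and $\Phi(\hat c(\mathbf x))=\big(\prod_{p:\,x_p=1} b_p\big)\,\hat c(\mathbf x)$ for every $\mathbf x\in\{0,1\}^{2n}$. Denote by $b^{\downarrow}_j$ the $j$-th largest of the coefficients $b_1,\ldots,b_{2n}$. Then \[ C_1^g(\Phi)=n-H\!\left(\frac{1+ b^{\downarrow}_1}{2}\right)-\sum_{j=1}^{n-1} H\!\left(\frac{1+ b^{\downarrow}_{2j}\, b^{\downarrow}_{2j+1}}{2}\right), \] where $H(x)=-x\log_2 x-(1-x)\log_2(1-x)$. Moreover, $C_1(\Phi)=C_1^g(\Phi)$ if $n\le 2$.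
   Context: Majorana operators on $n$ qubits (Jordan–Wigner): $\hat c_{2j-1}=\sigma^z_1\otimes\cdots\otimes\sigma^z_{j-1}\otimes\sigma^x_j\otimes I\otimes\cdots\otimes I$ and $\hat c_{2j}=\sigma^z_1\otimes\cdots\otimes\sigma^z_{j-1}\otimes\sigma^y_j\otimes I\otimes\cdots\otimes I$, $j=1,\ldots,n$. For $\mathbf x=(x_1,\ldots,x_{2n})\in\{0,1\}^{2n}$, $\hat c(\mathbf x)=\hat c_1^{x_1}\hat c_2^{x_2}\cdots\hat c_{2n}^{x_{2n}}$. (The map $\Phi$ is a trace-preserving completely positive map.) For $\lambda=(\lambda_1,\ldots,\lambda_n)$ with $\lambda_j\in[-1,1]$, let $\rho_\lambda=2^{-n}\prod_{j=1}^n(I+\lambda_j\sigma^z_j)$. A state $\rho$ on $n$ qubits is called Gaussian if $\rho=U\rho_\lambda U^\dagger$ for some such $\lambda$ and $U=\exp(iH_2+iH_1)$, where $H_2$ is a Hermitian linear combination of the operators $\hat c_p\hat c_q$ and $H_1$ is a Hermitian linear combination of the operators $\hat c_p$. For an ensemble $\mathcal E=\{p_a,\rho_a\}$ (finite probability distribution $p_a$ over states $\rho_a$), the Holevo quantity is $\chi(\mathcal E)=S(\sum_a p_a\rho_a)-\sum_a p_a S(\rho_a)$, with $S(\rho)=-\mathrm{Tr}\,\rho\log_2\rho$ the von Neumann entropy. The one-shot capacity is $C_1(\Phi)=\sup_{\mathcal E}\chi(\mathcal E)$ over all ensembles of states $\rho_a$ in the image of $\Phi$ (i.e. $\rho_a=\Phi(\sigma_a)$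 for states $\sigma_a$). The Gaussian capacity is $C_1^g(\Phi)=\sup\chi(\mathcal E_g)$ over all ensembles $\mathcal E_g=\{p_a,\Phi(\sigma_a)\}$ with arbitrary probabilities $p_a$ and Gaussian input states $\sigma_a$. *)

(* Defs.v *)
From HB Require Import structures.
From mathcomp Require Import all_boot all_order all_algebra.
From mathcomp Require Import all_classical all_reals.
From mathcomp Require Import exp trigo.
From mathcomp Require Import complex.
Set Implicit Arguments. Unset Strict Implicit. Unset Printing Implicit Defensive.
Import Order.TTheory GRing.Theory Num.Theory.
Local Open Scope ring_scope.
Local Open Scope complex_scope.

Section Qubits.
Variable R : realType.
Local Notation C := (R[i]).
Variable n : nat.
Local Notation N := (2 ^ n)%N.
Local Notation Mat := 'M[C]_N.

Definition adjmx (A : Mat) : Mat := (map_mx (@conjc R) A)^T.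

(* bit of the computational-basis index i associated with qubit k
   (qubit 0 is the leftmost = most significant tensor factor) *)
Definition qbit (k : 'I_n) (i : 'I_N) : bool := odd (i %/ 2 ^ (n - k.+1)).

Definition pI (a b : bool) : C := if a == b then 1 else 0.
Definition pX (a b : bool) : C := if a != b then 1 else 0.
Definition pY (a b : bool) : C :=
  if a == b then 0 else if a then 'i else - 'i.
Definition pZ (a b : bool) : C := if a == b then (if a then -1 else 1) else 0.

(* tensor product P_0 (x) P_1 (x) ... (x) P_{n-1} of one-qubit matrices *)
Definition pauli_string (P : 'I_n -> bool -> bool -> C) : Mat :=
  \matrix_(i, j) \prod_(k < n) P k (qbit k i) (qbit k j).

(* Jordan-Wigner Majorana operators, 0-based: majorana p for p = 2j (resp. 2j+1)
   is the paper's c_{2j+1} (resp. c_{2j+2}) with j 0-based qubit index: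
   Z on qubits < j, X (resp. Y) on qubit j, I on qubits > j. *)
Definition majorana (p : 'I_(2 * n)) : Mat :=
  pauli_string (fun k => if (k < p./2)%N then pZ
                         else if k == p./2 :> nat then (if odd p then pY else pX)
                         else pI).

Definition mxprod m (A : 'I_m -> Mat) : Mat := \big[mulmx/1%:M]_(i < m) A i.

Definition majorana_mono (x : 'I_(2 * n) -> bool) : Mat :=
  mxprod (fun p => if x p then majorana p else 1%:M).

Definition sigmaz (j : 'I_n) : Mat :=
  pauli_string (fun k => if k == j then pZ else pI).

Definition hermitian (A : Mat) := adjmx A = A.
Definition unitary (U : Mat) := U *m adjmx U = 1%:M.

Definition psd (A : Mat) :=
  hermitian A /\ forall v : 'cV[C]_N, 0 <= ((map_mx (@conjc R) v)^T *m A *m v) 0 0.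

Definition density (A : Mat) := psd A /\ \tr A = 1.

Definition rdiag (d : 'I_N -> R) : Mat := diag_mx (\row_i (d i)%:C).

(* U = exp(i H) for Hermitian H, via a spectral decomposition of H *)
Definition is_expi (H U : Mat) :=
  exists (V : Mat) (d : 'I_N -> R), unitary V /\
    H = V *m rdiag d *m adjmx V /\
    U = V *m diag_mx (\row_i (cos (d i) +i* sin (d i))) *m adjmx V.

Definition rho_lambda (lam : 'I_n -> R) : Mat :=
  (2%:R ^- n)%:C *: mxprod (fun j => 1%:M + (lam j)%:C *: sigmaz j).

Definition gaussian (rho : Mat) :=
  exists (lam : 'I_n -> R) (h2 : 'I_(2 * n) -> 'I_(2 * n) -> C)
         (h1 : 'I_(2 * n) -> C) (U : Mat),
    (forall j, -1 <= lam j <= 1) /\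
    let H2 := \sum_(p < 2 * n) \sum_(q < 2 * n) h2 p q *: (majorana p *m majorana q) in
    let H1 := \sum_(p < 2 * n) h1 p *: majorana p in
    hermitian H2 /\ hermitian H1 /\ is_expi (H2 + H1) U /\
    rho = U *m rho_lambda lam *m adjmx U.

(* base-2 logarithm and binary entropy; with ln 0 = 0 so that 0 log 0 = 0 *)
Definition log2 (x : R) : R := ln x / ln 2.
Definition eta (x : R) : R := - (x * log2 x).
Definition binH (x : R) : R := eta x + eta (1 - x).

Definition spec_decomp (A : Mat) (Vd : Mat * 'rV[R]_N) :=
  unitary Vd.1 /\ A = Vd.1 *m rdiag (fun i => Vd.2 0 i) *m adjmx Vd.1.

Definition vN_entropy (A : Mat) : R :=
  let Vd := xget (0, 0) (spec_decomp A) in \sum_i eta (Vd.2 0 i).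

Definition holevo k (p : 'I_k -> R) (rho : 'I_k -> Mat) : R :=
  vN_entropy (\sum_(a < k) (p a)%:C *: rho a) - \sum_(a < k) p a * vN_entropy (rho a).

Definition prob_dist k (p : 'I_k -> R) := (forall a, 0 <= p a) /\ \sum_(a < k) p a = 1.

Definition C1 (Phi : Mat -> Mat) : R :=
  sup [set chi | exists k (p : 'I_k -> R) (sigma : 'I_k -> Mat),
         prob_dist p /\ (forall a, density (sigma a)) /\
         chi = holevo p (fun a => Phi (sigma a))].

Definition C1g (Phi : Mat -> Mat) : R :=
  sup [set chi | exists k (p : 'I_k -> R) (sigma : 'I_k -> Mat),
         prob_dist p /\ (forall a, gaussian (sigma a)) /\
         chi = holevo p (fun a => Phi (sigma a))].

Definition fermionic_product_channel (b : 'I_(2 * n) -> R) (Phi : {linear Mat -> Mat}) :=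
  Phi 1%:M = 1%:M /\
  forall x : 'I_(2 * n) -> bool,
    Phi (majorana_mono x) = (\prod_(p < 2 * n | x p) b p)%:C *: majorana_mono x.

End Qubits.

(* b_dec b j = j-th largest coefficient (0-based: b_dec b 0 = b^down_1) *)
Definition b_dec (R : realType) (m : nat) (b : 'I_m -> R) (j : nat) : R :=
  nth 0 (sort (fun x y : R => y <= x) [seq b p | p <- enum 'I_m]) j.

(* Main.v *)
(* Writing [P] for the parity, the [2n] Majorana operators and [P] give [2n + 1]
   anticommuting Hermitian involutions whose quadratic Hamiltonians include the linear
   and quadratic ones, so a Gaussian state is [2^-n prod_k (1 - i lam_k f_2k f_2k+1)]
   for an orthonormal frame [f] of [R^(2n+1)].  With [K] the antisymmetric real matrix of
   that expression, the channel sends the Gaussian state of covariance [K] to the one of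
   covariance [B K B], [B = diag (b_1, ..., b_2n, 1)]; if [+- i mu_k] are the eigenvalues
   of [B K B], its entropy is [sum_k H ((1 + mu_k) / 2)].

   For a product [T] of [k] of the commuting involutions [- i g_2j g_2j+1] of the output
   frame, [prod mu = tr (Phi rho T) = tr (rho (Phi T))].  On elements of degree [2k] the
   channel is the product of the [2k] largest entries of [B] times a convex combination of
   signed unitary conjugations, so every product of [k] of the [mu]s is at most the product
   of those [2k] entries.  Weak log-majorization then bounds the output entropy from below, and pairing
   consecutive entries of the sorted [B] attains the bound; averaging over the signs of
   [lam] gives an ensemble with maximally mixed mean.

   For [n <= 2] every pure state is Gaussian: the vectors [v] with [(sum v_p gam_p) psi = 0]
   form an isotropic space of dimension at least [n].  Concavity of the entropy does the
   rest. *)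

From Pilot Require Import Defs.
From HB Require Import structures.
From mathcomp Require Import all_boot all_order all_algebra.
From mathcomp Require Import all_classical all_reals.
From mathcomp Require Import exp trigo.
From mathcomp Require Import complex spectral ring lra zify.
Set Implicit Arguments. Unset Strict Implicit. Unset Printing Implicit Defensive.
Import Order.TTheory GRing.Theory Num.Theory.
Import Pilot.Defs.
Local Open Scope ring_scope.

(** * Jordan-Wigner operators *)

(** The output of the channel is never computed. Each attenuation is followed through a linear
    relation between commutators and anticommutators ([gauss_eq]) that has at most one solution of
    given trace, so the output is recognised from [B K B] alone, vanishing coefficients included.

    Exponentials and entropies are defined through some spectral decomposition. No series and no
    matching of eigenvalues is needed, because on a finite set every function is a polynomial:
    interpolation turns conjugation by [exp (i H)] into a polynomial in the commutator with [H],
    entropy into a function of the traces of powers, and the logarithm of an orthogonal matrix into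
    a polynomial in its Cayley transform.

    The Cayley transform excludes the eigenvalue -1, which a permutation, the natural optimal frame,
    may have. Signs on its rows remove it and do not affect how the channel acts in that frame.

    The signed conjugations come from comparing each entry of [B] with the [2k]-th largest one, [t]:
    the ratios [t / B] inside the top [2k] and [B / t] outside are at most 1, and in degree [2k] the
    powers of [t] cancel. *)

Section MatrixRing.
Variables (R : realType) (N : nat).
Local Notation C := (R[i]).
Implicit Types (A B : 'M[C]_N) (a : C).

Lemma mxZl a A B : (a *: A) * B = a *: (A * B).
Proof. by rewrite -mulmxE -scalemxAl. Qed.

Lemma mxZr a A B : A * (a *: B) = a *: (A * B).
Proof. by rewrite -mulmxE -scalemxAr. Qed.

Lemma mxtraceM A B : \tr (A * B) = \tr (B * A).
Proof. by rewrite -mulmxE mxtrace_mulC. Qed.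

Lemma mxtrace_eqN0 A : \tr A = - \tr A -> \tr A = 0.
Proof. by move/esym/eqP; rewrite eqNr => /eqP. Qed.

Lemma mxtrace_sum (I : Type) (r : seq I) (Q : pred I) (F : I -> 'M[C]_N) :
  \tr (\sum_(i <- r | Q i) F i) = \sum_(i <- r | Q i) \tr (F i).
Proof. exact: raddf_sum. Qed.

End MatrixRing.

Section JordanWigner.
Variables (R : realType) (n : nat).
Local Notation C := (R[i]).
Local Notation N := (2 ^ n)%N.
Local Notation Mat := 'M[C]_N.
Implicit Types (P Q : 'I_n -> bool -> bool -> C) (p q : 'I_(2 * n)).

Lemma adjmxM (A B : Mat) : adjmx (A * B) = adjmx B * adjmx A.
Proof. by rewrite /adjmx -!mulmxE map_mxM trmx_mul. Qed.

Lemma adjmxD (A B : Mat) : adjmx (A + B) = adjmx A + adjmx B.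
Proof. by rewrite /adjmx map_mxD linearD. Qed.

Lemma adjmxZ (a : C) (A : Mat) : adjmx (a *: A) = a^* *: adjmx A.
Proof. by rewrite /adjmx map_mxZ linearZ. Qed.

Lemma adjmxK (A : Mat) : adjmx (adjmx A) = A.
Proof. by apply/matrixP=> i j; rewrite !mxE conjcK. Qed.

Lemma adjmx1 : adjmx (1 : Mat) = 1.
Proof. by rewrite /adjmx map_mx1 trmx1. Qed.

Lemma adjmx_sum (I : Type) (r : seq I) (Q : pred I) (F : I -> Mat) :
  adjmx (\sum_(i <- r | Q i) F i) = \sum_(i <- r | Q i) adjmx (F i).
Proof.
by apply: (big_morph (@adjmx R n) adjmxD); apply/matrixP=> i j; rewrite !mxE conjc0.
Qed.

Lemma bits_inj k i j : (i < 2 ^ k)%N -> (j < 2 ^ k)%N ->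
  (forall l, (l < k)%N -> odd (i %/ 2 ^ l) = odd (j %/ 2 ^ l)) -> i = j.
Proof.
elim: k i j => [|k IH] i j; first by rewrite expn0; case: i => //; case: j.
move=> hi hj h.
have h0 : odd i = odd j by have := h 0%N isT; rewrite expn0 !divn1.
have h1 : (i %/ 2)%N = (j %/ 2)%N.
  apply: IH.
  - by rewrite ltn_divLR // -expnSr.
  - by rewrite ltn_divLR // -expnSr.
  - by move=> l lk; rewrite -!divnMA -!expnS h.
by rewrite (divn_eq i 2) (divn_eq j 2) h1 !modn2 h0.
Qed.

Lemma qbit_inj (i j : 'I_N) : (forall k, qbit k i = qbit k j) -> i = j.
Proof.
move=> h; apply: val_inj; apply: (@bits_inj n) => [| |l ln]; [exact: ltn_ord|exact: ltn_ord|].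
have hk : (n - l.+1 < n)%N by lia.
have := h (Ordinal hk); rewrite /qbit /=.
by have -> : (n - (n - l.+1).+1 = l)%N by lia.
Qed.

Definition bits (i : 'I_N) : {ffun 'I_n -> bool} := [ffun k => qbit k i].

Lemma bits_bij : bijective bits.
Proof.
apply: inj_card_bij; last by rewrite card_ffun card_bool !card_ord.
by move=> i j /ffunP h; apply: qbit_inj => k; have := h k; rewrite !ffunE.
Qed.

(** A basis index is its string of bits, so the sum factorises over qubits; this makes the product
    of tensor strings local. *)
Lemma sum_prod_qbit (F : 'I_n -> bool -> C) :
  \sum_(i < N) \prod_(k < n) F k (qbit k i) = \prod_(k < n) \sum_(b : bool) F k b.
Proof.
rewrite bigA_distr_bigA /= (reindex bits) /=; last exact: onW_bij bits_bij.
by apply: eq_bigr => i _; apply: eq_bigr => k _; rewrite ffunE.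
Qed.

Lemma pYE (a b : bool) : pY R a b = if a == b then 0 else if a then 'i else - 'i.
Proof. by []. Qed.

Definition loc_mul (f g : bool -> bool -> C) (a b : bool) : C :=
  f a true * g true b + f a false * g false b.

Lemma pauli_stringM P Q :
  pauli_string P * pauli_string Q = pauli_string (fun k => loc_mul (P k) (Q k)).
Proof.
apply/matrixP=> i j; rewrite -mulmxE !mxE.
under eq_bigr do rewrite !mxE -big_split /=.
rewrite (sum_prod_qbit (fun k c => P k (qbit k i) c * Q k c (qbit k j))).
by apply: eq_bigr => k _; rewrite big_bool.
Qed.

Lemma eq_pauli_string P Q : (forall k a b, P k a b = Q k a b) ->
  pauli_string P = pauli_string Q.
Proof. by move=> h; apply/matrixP=> i j; rewrite !mxE; apply: eq_bigr. Qed.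

(** Phases are compared qubit by qubit: commutation relations of strings follow with [s] equal to 1
    except at the one qubit where the local matrices differ by a phase. *)
Lemma pauli_stringZ P Q (s : 'I_n -> C) :
  (forall k a b, P k a b = s k * Q k a b) ->
  pauli_string P = (\prod_k s k) *: pauli_string Q.
Proof.
by move=> h; apply/matrixP=> i j; rewrite !mxE -big_split; apply: eq_bigr.
Qed.

Lemma pauli_string1 : pauli_string (fun _ : 'I_n => @pI R) = 1.
Proof.
apply/matrixP=> i j; rewrite -[(1 : Mat)]/(1%:M : Mat) !mxE /pI.
have [->|ij] := eqVneq i j; first by rewrite big1 // => k _; rewrite eqxx.
have [k hk] : exists k, qbit k i != qbit k j.
  apply/existsP; apply: contraNT ij; rewrite negb_exists => /forallP h.
  by apply/eqP; apply: qbit_inj => k; apply/eqP; have := h k; rewrite negbK.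
by rewrite (bigD1 k) //= (negbTE hk) mul0r.
Qed.

Lemma adj_pauli_string P : (forall k a b, (P k b a)^* = P k a b) ->
  adjmx (pauli_string P) = pauli_string P.
Proof.
move=> h; apply/matrixP=> i j; rewrite !mxE rmorph_prod.
by apply: eq_bigr => k _; apply: h.
Qed.

Definition jwloc (p : 'I_(2 * n)) (k : 'I_n) : bool -> bool -> C :=
  if (k < p./2)%N then @pZ R
  else if k == p./2 :> nat then (if odd p then @pY R else @pX R) else @pI R.

Lemma majoranaE p : majorana R p = pauli_string (jwloc p). Proof. by []. Qed.

Definition parity : Mat := pauli_string (fun _ => @pZ R).

Lemma ord_half (p : 'I_(2 * n)) : (p./2 < n)%N.
Proof. by have := ltn_ord p; lia. Qed.

Lemma prod_sign_at (l : nat) : (l < n)%N ->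
  \prod_(k < n) (if k == l :> nat then -1 else 1 : C) = -1.
Proof.
move=> ln; rewrite (bigD1 (Ordinal ln)) //= eqxx big1 ?mulr1 // => k hk.
by case: eqP => // e; case/eqP: hk; apply: val_inj.
Qed.

Lemma majorana_herm p : adjmx (majorana R p) = majorana R p.
Proof.
apply: adj_pauli_string => k a b.
case: ifP => _; last case: ifP => _.
- by case: a b => [] []; apply/eqP; rewrite /pZ eq_complex /= ?(oppr0, opprK, eqxx).
- by case: (odd p); case: a b => [] []; apply/eqP; rewrite /pX ?pYE eq_complex /= ?(oppr0, opprK, eqxx).
- by case: a b => [] []; apply/eqP; rewrite /pI eq_complex /= ?(oppr0, opprK, eqxx).
Qed.

Lemma parity_herm : adjmx parity = parity.
Proof.
apply: adj_pauli_string => k a b.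
by case: a b => [] []; apply/eqP; rewrite /pZ eq_complex /= ?(oppr0, opprK, eqxx).
Qed.

Lemma mulCii : ('i * 'i : C) = -1. Proof. by rewrite -expr2 sqrCi. Qed.

Lemma parity_sq : parity * parity = 1.
Proof.
rewrite pauli_stringM -pauli_string1; apply: eq_pauli_string => k a b.
by case: a b => [] []; rewrite /loc_mul /pZ /pI /=; ring.
Qed.

Lemma majorana_sq p : majorana R p * majorana R p = 1.
Proof.
rewrite pauli_stringM -pauli_string1; apply: eq_pauli_string => k a b.
case: ifP => _; last case: ifP => _.
- by case: a b => [] []; rewrite /loc_mul /pZ /pI /=; ring.
- by case: (odd p); case: a b => [] []; rewrite /loc_mul /pX /pI ?pYE /= ?(mulrN, mulNr) ?mulCii; ring.
- by case: a b => [] []; rewrite /loc_mul /pI /=; ring.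
Qed.

Lemma parity_majorana p : parity * majorana R p = - (majorana R p * parity).
Proof.
rewrite !pauli_stringM -scaleN1r -(prod_sign_at (ord_half p)).
apply: pauli_stringZ => k a b.
case: ltngtP => _.
- by case: a b => [] []; rewrite /loc_mul /pZ /pI /=; ring.
- by case: a b => [] []; rewrite /loc_mul /pZ /pI /=; ring.
- by case: (odd p); case: a b => [] []; rewrite /loc_mul /pX /pZ ?pYE /=; ring.
Qed.

(** The local factors anticommute only at qubit [p./2]: before it both are [Z], after it [p] has the
    identity. At that qubit [X] or [Y] meets [Z], or, if the qubits coincide, [X] meets [Y] because
    [p] and [q] then differ in parity. *)
Lemma majorana_anti_le p q : p != q -> (p./2 <= q./2)%N ->
  majorana R p * majorana R q = - (majorana R q * majorana R p).
Proof.
move=> pq le_pq; rewrite !pauli_stringM -scaleN1r -(prod_sign_at (ord_half p)).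
apply: pauli_stringZ => k a b.
have [kp|kp|kp] := ltngtP k p./2.
- have -> : (k < q./2)%N by apply: leq_trans le_pq.
  by case: a b => [] []; rewrite /loc_mul /pZ /=; ring.
- case: ifP => _; last case: ifP => _.
  + by case: a b => [] []; rewrite /loc_mul /pZ /pI /=; ring.
  + by case: (odd q); case: a b => [] []; rewrite /loc_mul /pX /pI ?pYE /=; ring.
  + by case: a b => [] []; rewrite /loc_mul /pI /=; ring.
- case: (ltnP k q./2) => kq.
    by case: (odd p); case: a b => [] []; rewrite /loc_mul /pX /pZ ?pYE /=; ring.
  have kq' : k = q./2 :> nat by lia.
  rewrite kq' eqxx.
  have : odd p != odd q.
    apply: contra pq => /eqP oe; apply/eqP/val_inj => /=.
    by rewrite -(odd_double_half p) -(odd_double_half q) oe -kp kq'.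
  by case: (odd p); case: (odd q) => // _; case: a b => [] []; rewrite /loc_mul /pX ?pYE /=; ring.
Qed.

Lemma majorana_anti p q : p != q ->
  majorana R p * majorana R q = - (majorana R q * majorana R p).
Proof.
move=> pq; case: (leqP p./2 q./2) => [|/ltnW] h; first exact: majorana_anti_le.
by rewrite [in RHS](majorana_anti_le _ h) ?opprK // eq_sym.
Qed.

Definition ev (j : 'I_n) : 'I_(2 * n) := Ordinal (ltac:(have := ltn_ord j; lia) : (2 * j < 2 * n)%N).
Definition od (j : 'I_n) : 'I_(2 * n) := Ordinal (ltac:(have := ltn_ord j; lia) : ((2 * j).+1 < 2 * n)%N).

(** The [Z] strings cancel and [X Y = i Z] remains at qubit [j], which makes [rho_lambda] a product
    over pairs of generators. *)
Lemma majorana_pair j : majorana R (ev j) * majorana R (od j) = 'i *: sigmaz R j.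
Proof.
have ri : \prod_(k < n) (if k == j then 'i else 1 : C) = 'i.
  by rewrite (bigD1 j) //= eqxx big1 ?mulr1 // => k /negbTE ->.
rewrite !pauli_stringM -ri; apply: pauli_stringZ => k a b /=.
have -> : (uphalf (2 * j) = j) by lia.
have -> : ((2 * j)./2 = j) by lia.
have -> : odd (2 * j) = false by lia.
have [kj|kj|kj] := ltngtP k j.
- rewrite (_ : (k == j) = false); last by apply/negbTE; rewrite -val_eqE /=; lia.
  by case: a b => [] []; rewrite /loc_mul /pZ /pI /=; ring.
- rewrite (_ : (k == j) = false); last by apply/negbTE; rewrite -val_eqE /=; lia.
  by case: a b => [] []; rewrite /loc_mul /pI /=; ring.
- rewrite (_ : (k == j) = true); last by apply/eqP/val_inj.
  by case: a b => [] []; rewrite /loc_mul /pX /pZ /= ?pYE /=; ring.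
Qed.

End JordanWigner.

(** * The Clifford generators and the monomial basis *)

Section Clifford.
Variables (R : realType) (n : nat).
Local Notation C := (R[i]).
Local Notation N := (2 ^ n)%N.
Local Notation Mat := 'M[C]_N.
Local Notation m := (2 * n).+1.
Local Notation "x %:C" := (real_complex R x).
Implicit Types (p : 'I_m) (q : 'I_(2 * n)) (x y : {ffun 'I_(2 * n) -> bool}) (X Y : Mat).

(* Besides the parity [P], the operators [i P c_p] form an anticommuting family
   of [2n + 1] Hermitian involutions with [gam p * gam q = c_p c_q] and
   [gam p * gam ord_max = - i c_p]: linear and quadratic Hamiltonians in the [c_p]
   all become quadratic in [gam], so they generate SO(2n + 1). *)
Definition wid (q : 'I_(2 * n)) : 'I_m := lift ord_max q.

Definition gam p : Mat :=
  if unlift ord_max p is Some q then 'i *: (parity R n * majorana R q) else parity R n.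

Lemma gam_wid q : gam (wid q) = 'i *: (parity R n * majorana R q).
Proof. by rewrite /gam liftK. Qed.

Lemma gam_max : gam ord_max = parity R n.
Proof. by rewrite /gam unlift_none. Qed.

Lemma majorana_parity q : majorana R q * parity R n = - (parity R n * majorana R q).
Proof. by rewrite parity_majorana opprK. Qed.

Lemma gam_wid2 q q' : gam (wid q) * gam (wid q') = majorana R q * majorana R q'.
Proof.
rewrite !gam_wid mxZl mxZr scalerA mulCii scaleN1r -mulrA [majorana R q * _]mulrA.
by rewrite majorana_parity mulNr mulrN opprK !mulrA parity_sq mul1r.
Qed.

Lemma gam_wid_max q : gam (wid q) * gam ord_max = (- 'i) *: majorana R q.
Proof.
by rewrite gam_wid gam_max mxZl -mulrA majorana_parity mulrN mulrA parity_sq mul1r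
  scalerN scaleNr.
Qed.

Lemma gam_max_wid q : gam ord_max * gam (wid q) = 'i *: majorana R q.
Proof. by rewrite gam_wid gam_max mxZr mulrA parity_sq mul1r. Qed.

Lemma gam_sq p : gam p * gam p = 1.
Proof.
case: (unliftP ord_max p) => [q ->|->]; last by rewrite gam_max parity_sq.
by rewrite gam_wid2 majorana_sq.
Qed.

Lemma gam_anti (p q : 'I_m) : p != q -> gam p * gam q = - (gam q * gam p).
Proof.
case: (unliftP ord_max p) => [p' ->|->]; case: (unliftP ord_max q) => [q' ->|->].
- rewrite !gam_wid2 => h; apply: majorana_anti.
  by apply: contraNneq h => ->.
- by rewrite gam_wid_max gam_max_wid scaleNr.
- by rewrite gam_wid_max gam_max_wid scaleNr opprK.
- by rewrite eqxx.
Qed.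

Lemma gam_herm p : adjmx (gam p) = gam p.
Proof.
case: (unliftP ord_max p) => [q ->|->]; last by rewrite gam_max parity_herm.
rewrite gam_wid adjmxZ adjmxM parity_herm majorana_herm majorana_parity conjCi.
by rewrite scaleNr scalerN opprK.
Qed.

Lemma gam_clifford (p q : 'I_m) : gam p * gam q + gam q * gam p = (2 * (p == q)%:R)%:M.
Proof.
have [->|pq] := eqVneq p q; last by rewrite (gam_anti pq) addNr mulr0 raddf0.
by rewrite gam_sq mulr1 -[1]/(1%:M : Mat) -raddfD.
Qed.

Lemma sign_prod_comm (k : nat) (A : Mat) (F : 'I_k -> Mat) (s : 'I_k -> bool) :
  (forall i, A * F i = (-1) ^+ s i *: (F i * A)) ->
  A * \prod_i F i = (-1) ^+ (\big[addb/false]_i s i) *: ((\prod_i F i) * A).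
Proof.
move=> h; elim: k F s h => [|k IH] F s h; first by rewrite !big_ord0 scale1r mulr1 mul1r.
rewrite !big_ord_recl mulrA h mxZl -!mulrA (IH _ _ (fun i => h (lift ord0 i))) mxZr scalerA.
by rewrite -signr_addb.
Qed.

Definition mono x : Mat := majorana_mono R x.

Lemma monoE x : mono x = \prod_q (if x q then majorana R q else 1).
Proof. by []. Qed.

(* Adding the parity bit makes [ext x] an even subset of the [2n + 1] indices:
   up to a phase [mono x] is the product of the [gam p] with [ext x p]. *)
Definition ext x p : bool :=
  if unlift ord_max p is Some q then x q else \big[addb/false]_q x q.

(** [i P c_q] anticommutes with [c_q] and, two signs cancelling, commutes with every other Majorana
    operator; [P] anticommutes with all of them and so sees the parity of [x]. *)
Lemma gam_mono p x : gam p * mono x = (-1) ^+ ext x p *: (mono x * gam p).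
Proof.
rewrite monoE /ext; case: (unliftP ord_max p) => [q ->|->]; last first.
  apply: sign_prod_comm => q; case: (x q); last by rewrite scale1r mulr1 mul1r.
  by rewrite gam_max parity_majorana scaleN1r.
have -> : x q = \big[addb/false]_i (x i && (i == q)).
  rewrite (bigD1 q) //= eqxx andbT big1 ?addbF // => i /negbTE ->.
  by rewrite andbF.
apply: sign_prod_comm => i; case: (x i) => /=; last by rewrite scale1r mulr1 mul1r.
rewrite -/(wid q) gam_wid mxZl mxZr scalerA mulrC -scalerA; congr (_ *: _).
rewrite -mulrA; have [->|iq] := eqVneq i q.
  by rewrite expr1 scaleN1r [in RHS]mulrA majorana_parity mulNr opprK mulrA.
rewrite expr0 scale1r majorana_anti 1?eq_sym // mulrN [in RHS]mulrA majorana_parity mulNr.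
by rewrite mulrA.
Qed.

Lemma conj_mono p x : gam p * mono x * gam p = (-1) ^+ ext x p *: mono x.
Proof. by rewrite gam_mono mxZl -mulrA gam_sq mulr1. Qed.

Lemma mono_unitary x : mono x * adjmx (mono x) = 1.
Proof.
rewrite monoE.
elim/big_ind: _ => [|A B hA hB|q _]; first by rewrite adjmx1 mulr1.
  by rewrite adjmxM -mulrA [B * _]mulrA hB mul1r.
by case: (x q); rewrite ?adjmx1 ?mulr1 // majorana_herm majorana_sq.
Qed.

Lemma unitary_comm (A B : Mat) : A * B = 1 -> B * A = 1.
Proof. by rewrite -!mulmxE; apply: mulmx1C. Qed.

(** At an index where [x] and [y] differ, the generator commutes with one monomial and anticommutes
    with the other, so conjugating by it turns the trace into its negative. *)
Lemma mono_orth x y : \tr (mono x * adjmx (mono y)) = if x == y then N%:R else 0.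
Proof.
have [->|/eqP xy] := eqVneq x y; first by rewrite mono_unitary mxtrace1.
have [q hq] : exists q, x q != y q.
  apply/existsP; apply: contra_notT xy => /existsPn h; apply/ffunP => q.
  by apply/eqP; have := h q; rewrite negbK.
have adjY : gam (wid q) * adjmx (mono y) = (-1) ^+ y q *: (adjmx (mono y) * gam (wid q)).
  have h := gam_mono (wid q) y; rewrite /ext liftK in h.
  have := congr1 (@adjmx R n) h; rewrite adjmxZ !adjmxM gam_herm => ->.
  rewrite scalerA rmorphXn rmorphN1 -expr2 sqrr_sign scale1r //.
apply: mxtrace_eqN0.
have {1}-> : mono x * adjmx (mono y) =
   gam (wid q) * (gam (wid q) * (mono x * adjmx (mono y))).
  by rewrite mulrA gam_sq mul1r.
rewrite mxtraceM mulrA gam_mono /ext liftK !mxZl -(mulrA (mono x)) adjY mxZr mxZl scalerA.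
rewrite -!mulrA gam_sq mulr1 linearZ /= -signr_addb.
by move: hq; case: (x q); case: (y q) => // _; rewrite mulN1r.
Qed.

Lemma N_neq0 : (N%:R : C) != 0.
Proof. by rewrite pnatr_eq0 -lt0n expn_gt0. Qed.

(** Orthogonality makes the matrix [G] of vectorised monomials row free; there are [4 ^ n = N * N]
    of them, so [G] is also row full. *)
Lemma mono_span X : exists a : {ffun 'I_(2 * n) -> bool} -> C, X = \sum_x a x *: mono x.
Proof.
pose k := #|{: {ffun 'I_(2 * n) -> bool}}|.
pose G : 'M[C]_(k, N * N) := \matrix_(i, j) mxvec (mono (enum_val i)) 0 j.
have dot (A B : Mat) : \sum_j mxvec A 0 j * (mxvec B 0 j)^* = \tr (A * adjmx B).
  have -> : \tr (A * adjmx B) = \sum_i \sum_j A i j * (B i j)^*.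
    by apply: eq_bigr => i _; rewrite -mulmxE mxE; apply: eq_bigr => j _; rewrite !mxE.
  rewrite pair_bigA (reindex _ (curry_mxvec_bij N N)) /=.
  by apply: eq_bigr => -[i j] _; rewrite !mxvecE.
have fr : row_free G.
  apply/row_freeP; exists (N%:R^-1 *: (map_mx (@conjc R) G)^T).
  rewrite -scalemxAr; apply/matrixP => i j; rewrite !mxE.
  under eq_bigr do rewrite !mxE.
  rewrite dot mono_orth (inj_eq enum_val_inj); case: eqVneq => _; last by rewrite mulr0.
  by rewrite mulVf // N_neq0.
have kE : k = (N * N)%N by rewrite /k card_ffun card_bool card_ord mulnC expnM [RHS]mulnn.
have fu : row_full G by rewrite /row_full (eqP fr : \rank G = k) kE.
have /submxP[v hv] := submx_full (mxvec X) fu.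
exists (fun x => v 0 (enum_rank x)).
rewrite -[X]mxvecK hv; apply: (can_inj mxvecK); rewrite vec_mxK.
apply/rowP => j; rewrite !mxE.
rewrite linear_sum summxE [RHS](reindex _ (onW_bij _ (@enum_val_bij _))) /=.
by apply: eq_bigr => i _; rewrite linearZ !mxE enum_valK.
Qed.

Lemma mono_lin_ext (f g : {linear Mat -> Mat}) :
  (forall x, f (mono x) = g (mono x)) -> forall X, f X = g X.
Proof.
move=> h X; have [a ->] := mono_span X; rewrite !linear_sum.
by apply: eq_bigr => x _; rewrite !linearZ h.
Qed.

Lemma mono_trace_eq0 X : (forall x, \tr (X * mono x) = 0) -> X = 0.
Proof.
move=> h; have h' Y : \tr (X * Y) = 0.
  have [a ->] := mono_span Y; rewrite mulr_sumr mxtrace_sum big1 // => x _.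
  by rewrite mxZr mxtraceZ h mulr0.
apply/matrixP => i j; rewrite [RHS]mxE -(h' (delta_mx j i)) /mxtrace (bigD1 i) //=.
rewrite big1 ?addr0 => [|k ki]; rewrite -mulmxE !mxE.
  rewrite (bigD1 j) //= !mxE !eqxx mulr1 big1 ?addr0 // => k kj.
  by rewrite !mxE (negbTE kj) mulr0.
by rewrite big1 // => l _; rewrite !mxE (negbTE ki) andbF mulr0.
Qed.

Lemma mono_coef_eq0 (a : {ffun 'I_(2 * n) -> bool} -> C) :
  \sum_x a x *: mono x = 0 -> forall x, a x = 0.
Proof.
move=> h x; have /eqP := congr1 (fun Y => \tr (Y * adjmx (mono x))) h.
rewrite mul0r raddf0 mulr_suml mxtrace_sum (bigD1 x) //= big1 ?addr0 => [|y yx].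
  by rewrite mxZl mxtraceZ mono_orth eqxx mulf_eq0 (negbTE N_neq0) orbF => /eqP.
by rewrite mxZl mxtraceZ mono_orth (negbTE yx) mulr0.
Qed.

(** With [u = (1 + b) / 2] and [v = (1 - b) / 2] this damps by [b] the monomials whose extended set
    contains [p] and fixes the others. General [u] and [v], possibly negative, serve the signed
    mixtures of [degree_contract]. *)
Definition attenuate p (u v : R) X : Mat := u%:C *: X + v%:C *: (gam p * X * gam p).

Lemma attenuate_linear p u v : linear (attenuate p u v).
Proof.
move=> a X Y; rewrite /attenuate mulrDr mulrDl mxZr mxZl !scalerDr !scalerA.
by rewrite addrACA [u%:C * a]mulrC [v%:C * a]mulrC -!scalerA -scalerDr.
Qed.

HB.instance Definition _ p u v := GRing.isLinear.Build C Mat Mat _ (attenuate p u v) (attenuate_linear p u v).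

Lemma attenuate_mono p u v x : attenuate p u v (mono x) = (if ext x p then u - v else u + v)%:C *: mono x.
Proof.
rewrite /attenuate conj_mono scalerA -scalerDl; case: (ext x p).
  by rewrite expr1 mulrN1 rmorphB.
by rewrite expr0 mulr1 rmorphD.
Qed.

Lemma attenuate_trace p u v X Y : \tr (X * attenuate p u v Y) = \tr (attenuate p u v X * Y).
Proof.
rewrite /attenuate mulrDr mulrDl !mxZr !mxZl !mxtraceD !mxtraceZ; congr (_ + _ * _).
by rewrite mulrA mxtraceM !mulrA.
Qed.

Fixpoint chan (s : seq 'I_m) (u v : 'I_m -> R) X : Mat :=
  if s is p :: s' then attenuate p (u p) (v p) (chan s' u v X) else X.

Lemma chan_linear s u v : linear (chan s u v).
Proof. by elim: s => [|p s IH] a X Y //=; rewrite IH linearP. Qed.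

HB.instance Definition _ s u v := GRing.isLinear.Build C Mat Mat _ (chan s u v) (chan_linear s u v).

Lemma chan_mono s u v x :
  chan s u v (mono x) = (\prod_(p <- s) (if ext x p then u p - v p else u p + v p))%:C *: mono x.
Proof.
elim: s => [|p s IH] /=; first by rewrite big_nil scale1r.
by rewrite IH linearZ /= attenuate_mono scalerA big_cons mulrC rmorphM.
Qed.

Lemma chan_trace s u v X Y : \tr (X * chan s u v Y) = \tr (chan (rev s) u v X * Y).
Proof.
elim: s X => [|p s IH] X //=; rewrite attenuate_trace IH; congr (\tr (_ * _)).
rewrite rev_cons -cats1; elim: (rev s) => [|q r IHr] //=; by rewrite IHr.
Qed.

(** The value 1 at [ord_max] leaves the parity generator undamped, so the factor of a monomial is
    the product over [x] even when [ext x] contains [ord_max]. *)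
Definition bcoef (b : 'I_(2 * n) -> R) p : R := if unlift ord_max p is Some q then b q else 1.

Lemma channelE (b : 'I_(2 * n) -> R) (Phi : {linear Mat -> Mat}) :
  fermionic_product_channel b Phi ->
  forall X, Phi X = chan (enum 'I_m) (fun p => (1 + bcoef b p) / 2) (fun p => (1 - bcoef b p) / 2) X.
Proof.
case=> _ h; apply: mono_lin_ext => x; rewrite /= chan_mono [Phi _]h; congr (_%:C *: _).
rewrite big_enum (bigD1_ord ord_max) //= /bcoef /ext unlift_none.
rewrite (_ : (if _ then _ else _) = 1) ?mul1r; last by case: ifP => _; lra.
rewrite big_mkcond; apply: eq_bigr => q _; rewrite liftK.
by case: ifP => _; lra.
Qed.

End Clifford.

(** * Orthonormal frames and frame states *)

Section FrameState.
Variables (R : realType) (n : nat).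
Local Notation C := (R[i]).
Local Notation N := (2 ^ n)%N.
Local Notation Mat := 'M[C]_N.
Local Notation m := (2 * n).+1.
Local Notation "x %:C" := (real_complex R x).
Implicit Types (p q : 'I_m) (k l : 'I_n) (X Y : Mat).

Definition pe k : 'I_m := wid (ev k).
Definition po k : 'I_m := wid (od k).

Lemma val_pe k : pe k = (2 * k)%N :> nat.
Proof. by rewrite /= /bump leqNgt; have := ltn_ord k; case: ltnP => /=; lia. Qed.

Lemma val_po k : po k = (2 * k).+1 :> nat.
Proof. by rewrite /= /bump leqNgt; have := ltn_ord k; case: ltnP => /=; lia. Qed.

Variant pair_spec p : Prop :=
| PairE k of p = pe k | PairO k of p = po k | PairL of p = ord_max.

Lemma pairP p : pair_spec p.
Proof.
have hp := ltn_ord p.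
have [e|ne] := eqVneq (p : nat) (2 * n)%N; first by apply: PairL; apply: val_inj.
have hk : (p./2 < n)%N by lia.
have [o|o] := boolP (odd p); [apply: (@PairO _ (Ordinal hk))|apply: (@PairE _ (Ordinal hk))];
  by apply: val_inj; rewrite [RHS]val_po || rewrite [RHS]val_pe; rewrite /=; lia.
Qed.

Lemma pe_eq k l : (pe k == pe l) = (k == l).
Proof. by rewrite -!(inj_eq (@ord_inj _)) !val_pe eqn_pmul2l. Qed.
Lemma po_eq k l : (po k == po l) = (k == l).
Proof. by rewrite -!(inj_eq (@ord_inj _)) !val_po eqSS eqn_pmul2l. Qed.
Lemma pe_po k l : (pe k == po l) = false.
Proof. by apply/negbTE; rewrite -(inj_eq (@ord_inj _)) val_po val_pe; lia. Qed.
Lemma po_pe k l : (po k == pe l) = false.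
Proof. by rewrite eq_sym pe_po. Qed.
Lemma pe_max k : (pe k == ord_max) = false.
Proof. by apply/negbTE; rewrite -(inj_eq (@ord_inj _)) val_pe /=; have := ltn_ord k; lia. Qed.
Lemma po_max k : (po k == ord_max) = false.
Proof. by apply/negbTE; rewrite -(inj_eq (@ord_inj _)) val_po /=; have := ltn_ord k; lia. Qed.
Definition pairE := (pe_eq, po_eq, pe_po, po_pe, pe_max, po_max).

Section Frame.
Variable f : 'I_m -> Mat.
Hypothesis f_clif : forall p q, f p * f q + f q * f p = (2 * (p == q)%:R)%:M.
Hypothesis f_herm : forall p, adjmx (f p) = f p.

Lemma frame_sq p : f p * f p = 1.
Proof.
have := f_clif p p; rewrite eqxx mulr1 => h.
have h2 : (2%:R : C) *: (f p * f p) = 2%:R *: (1 : Mat).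
  by rewrite scaler_nat mulr2n h; apply/esym/scalemx1.
have /(congr1 (fun Z => 2%:R^-1 *: Z)) := h2.
by rewrite !scalerA mulVf ?pnatr_eq0 // !scale1r.
Qed.

Lemma frame_anti p q : p != q -> f p * f q = - (f q * f p).
Proof.
move=> pq; apply/eqP; rewrite -addr_eq0 f_clif (negbTE pq) mulr0.
by apply/eqP; apply: raddf0.
Qed.

(** [locked] keeps the pair from being unfolded in larger products; [ftE] opens it. *)
Definition ft k : Mat := locked ((- 'i) *: (f (pe k) * f (po k))).

Lemma ftE k : ft k = (- 'i) *: (f (pe k) * f (po k)).
Proof. by rewrite /ft -lock. Qed.

Lemma pe_ft k : f (pe k) * ft k = (- 'i) *: f (po k).
Proof. by rewrite ftE mxZr mulrA frame_sq mul1r. Qed.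

Lemma po_ft k : f (po k) * ft k = 'i *: f (pe k).
Proof.
rewrite ftE mxZr frame_anti ?pairE // mulrN mulrA frame_sq mul1r.
by rewrite scaleNr scalerN opprK.
Qed.

Lemma ft_pe k : ft k * f (pe k) = 'i *: f (po k).
Proof.
rewrite ftE mxZl -mulrA frame_anti ?pairE // mulrN mulrA frame_sq mul1r.
by rewrite scaleNr scalerN opprK.
Qed.

Lemma ft_po k : ft k * f (po k) = (- 'i) *: f (pe k).
Proof. by rewrite ftE mxZl -mulrA frame_sq mulr1. Qed.

Lemma ft_comm k p : p != pe k -> p != po k -> ft k * f p = f p * ft k.
Proof.
move=> h1 h2; rewrite ftE mxZl mxZr; congr (_ *: _).
rewrite -mulrA (frame_anti (p := po k) (q := p)) 1?eq_sym // mulrN [in LHS]mulrA.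
by rewrite (frame_anti (p := pe k) (q := p)) 1?eq_sym // mulNr opprK mulrA.
Qed.

Lemma ft_sq k : ft k * ft k = 1.
Proof.
rewrite {1}ftE mxZl -mulrA po_ft mxZr scalerA frame_sq mulNr mulCii opprK scale1r //.
Qed.

Lemma ft_herm k : adjmx (ft k) = ft k.
Proof.
rewrite ftE adjmxZ adjmxM !f_herm frame_anti ?pairE // rmorphN /= conjCi opprK.
by rewrite scalerN scaleNr.
Qed.

Lemma ft_ft k l : ft k * ft l = ft l * ft k.
Proof.
have [->//|kl] := eqVneq k l.
have kl' : l != k by rewrite eq_sym.
rewrite (ftE l) (mxZr _ (ft k)) (mxZl _ _ (ft k)); congr (_ *: _).
by rewrite mulrA ft_comm ?pairE // -mulrA ft_comm ?pairE // mulrA.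
Qed.

(** Elements of the commutative algebra of the [ft k] that factor over pairs. Frame states, their
    powers and square roots, and products of involutions all have this shape. *)
Definition fq (s : seq 'I_n) (a b : 'I_n -> C) : Mat :=
  \prod_(k <- s) (a k *: (1 : Mat) + b k *: ft k).

Lemma fq_cons k s a b : fq (k :: s) a b = (a k *: (1 : Mat) + b k *: ft k) * fq s a b.
Proof. by rewrite /fq big_cons. Qed.

Lemma comm_fq (A : Mat) s a b : (forall k, k \in s -> A * ft k = ft k * A) ->
  A * fq s a b = fq s a b * A.
Proof.
rewrite /fq; elim: s => [|k s IH] h; first by rewrite big_nil mulr1 mul1r.
rewrite big_cons mulrA mulrDr !mxZr mulr1 h ?mem_head //.
have -> : a k *: A + b k *: (ft k * A) = (a k *: (1 : Mat) + b k *: ft k) * A.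
  by rewrite mulrDl !mxZl mul1r.
by rewrite -!mulrA IH // => l ls; apply: h; rewrite in_cons ls orbT.
Qed.

Lemma fqM s a b a' b' :
  fq s a b * fq s a' b' =
  fq s (fun k => a k * a' k + b k * b' k) (fun k => a k * b' k + b k * a' k).
Proof.
rewrite /fq; elim: s => [|k s IH]; first by rewrite !big_nil mulr1.
rewrite !big_cons -mulrA [X in _ * X]mulrA -/(fq s a b).
have -> : fq s a b * (a' k *: (1 : Mat) + b' k *: ft k) = (a' k *: (1 : Mat) + b' k *: ft k) * fq s a b.
  by apply/esym/comm_fq => l _; rewrite mulrDl mulrDr !mxZl !mxZr mulr1 mul1r ft_ft.
rewrite -[_ * fq _ _ _ * _]mulrA IH mulrA; congr (_ * _).
rewrite mulrDl !mulrDr !mxZl !mxZr !scalerA !mulr1 !mul1r ft_sq !scalerDl.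
by rewrite [X in _ + X = _]addrC addrACA.
Qed.

(** Any term containing [ft k] is traceless: [f (pe k)] anticommutes with [ft k] and commutes with
    the factors of the other pairs. *)
Lemma fq_trace s a b : uniq s -> \tr (fq s a b) = N%:R * \prod_(k <- s) a k.
Proof.
rewrite /fq; elim: s => [_|k s IH] /=; first by rewrite !big_nil mulr1 mxtrace1.
move=> /andP[ks us]; rewrite !big_cons mulrDl !mxZl mul1r mxtraceD !mxtraceZ IH //.
suff -> : \tr (ft k * fq s a b) = 0 by rewrite mulr0 addr0 mulrCA.
apply: mxtrace_eqN0.
have cq : f (pe k) * fq s a b = fq s a b * f (pe k).
  apply: comm_fq => l ls; rewrite ft_comm ?pairE //.
  by apply: contraNneq ks => ->.
rewrite -{1}[ft k]mul1r -(frame_sq (pe k)) -!mulrA mxtraceM -!mulrA -cq.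
rewrite mulrA pe_ft [X in _ = - \tr X](_ : _ = ft k * (f (pe k) * f (pe k)) * fq s a b);
  last by rewrite frame_sq mulr1.
by rewrite [ft k * _]mulrA ft_pe !mxZl scaleNr raddfN /= -mulrA.
Qed.

Definition comm X Y := X * Y - Y * X.
Definition acomm X Y := X * Y + Y * X.

Lemma fq_free s b p : (forall k, k \in s -> (p != pe k) && (p != po k)) ->
  comm (f p) (fq s (fun=> 1) b) = 0.
Proof.
move=> h; rewrite /comm comm_fq ?subrr // => k /h/andP[h1 h2].
by rewrite ft_comm.
Qed.

Lemma commMr A X Y : A * Y = Y * A -> comm A (X * Y) = comm A X * Y.
Proof. by move=> h; rewrite /comm mulrBl -!mulrA -h. Qed.
Lemma acommMr A X Y : A * Y = Y * A -> acomm A (X * Y) = acomm A X * Y.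
Proof. by move=> h; rewrite /acomm mulrDl -!mulrA -h. Qed.
Lemma commMl A X Y : A * X = X * A -> comm A (X * Y) = X * comm A Y.
Proof. by move=> h; rewrite /comm mulrBr !mulrA h. Qed.
Lemma acommMl A X Y : A * X = X * A -> acomm A (X * Y) = X * acomm A Y.
Proof. by move=> h; rewrite /acomm mulrDr !mulrA h. Qed.

(** Only the factor [1 + b T] of pair [k] matters: [[f_2k, T] = - 2 i f_2k+1], while
    [{f_2k+1, 1 + b T} = 2 f_2k+1] because [T] anticommutes with [f_2k+1]. This is the covariance
    equation in the state's own frame. *)
Lemma fq_pair s b k : uniq s -> k \in s ->
  comm (f (pe k)) (fq s (fun=> 1) b) = (- 'i * b k) *: acomm (f (po k)) (fq s (fun=> 1) b) /\
  comm (f (po k)) (fq s (fun=> 1) b) = ('i * b k) *: acomm (f (pe k)) (fq s (fun=> 1) b).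
Proof.
elim: s => [//|l s IH] /= /andP[ls us].
rewrite !fq_cons scale1r in_cons; have [-> _|kl ks] := eqVneq k l; last first.
  have [h1 h2] := IH us ks.
  have c1 : f (pe k) * (1 + b l *: ft l) = (1 + b l *: ft l) * f (pe k).
    by rewrite mulrDr mulrDl mxZr mxZl mulr1 mul1r ft_comm ?pairE.
  have c2 : f (po k) * (1 + b l *: ft l) = (1 + b l *: ft l) * f (po k).
    by rewrite mulrDr mulrDl mxZr mxZl mulr1 mul1r ft_comm ?pairE.
  by rewrite !commMl // !acommMl // h1 h2 !mxZr.
have c1 : f (pe l) * fq s (fun=> 1) b = fq s (fun=> 1) b * f (pe l).
  apply: comm_fq => j js; rewrite ft_comm ?pairE //.
  by apply: contraNneq ls => ->.
have c2 : f (po l) * fq s (fun=> 1) b = fq s (fun=> 1) b * f (po l).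
  apply: comm_fq => j js; rewrite ft_comm ?pairE //.
  by apply: contraNneq ls => ->.
rewrite !commMr // !acommMr // -!mxZl; split; congr (_ * _).
  rewrite /comm /acomm !mulrDr !mulrDl !mxZr !mxZl mulr1 mul1r pe_ft ft_pe po_ft ft_po.
  rewrite !scalerA opprD addrACA subrr add0r addrACA -scalerDl mulrN addrN scale0r addr0.
  rewrite mulr1 mul1r -scalerBl scalerDr -scalerDl; congr (_ *: _); ring.
rewrite /comm /acomm !mulrDr !mulrDl !mxZr !mxZl mulr1 mul1r pe_ft ft_pe po_ft ft_po.
rewrite !scalerA opprD addrACA subrr add0r addrACA -scalerDl mulrN addNr scale0r addr0.
rewrite mulr1 mul1r -scalerBl scalerDr -scalerDl; congr (_ *: _); ring.
Qed.

End Frame.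

End FrameState.

(** * The covariance equation *)

Section GaussianEquation.
Variables (R : realType) (n : nat).
Local Notation C := (R[i]).
Local Notation N := (2 ^ n)%N.
Local Notation Mat := 'M[C]_N.
Local Notation m := (2 * n).+1.
Local Notation "x %:C" := (real_complex R x).
Local Notation gam := (@gam R n).
Implicit Types (p q r : 'I_m) (k l : 'I_n) (X Y : Mat) (F G K : 'M[R]_m).

Definition clc (v : 'rV[C]_m) : Mat := \sum_p v 0 p *: gam p.

Definition frm F p : Mat := \sum_q (F p q)%:C *: gam q.

Lemma clc_row F p : clc (row p (map_mx (real_complex R) F)) = frm F p.
Proof. by apply: eq_bigr => q _; rewrite !mxE. Qed.

Lemma clc_acomm u v : clc u * clc v + clc v * clc u = (2 * (u *m v^T) 0 0)%:M.
Proof.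
have -> : clc v * clc u = \sum_r \sum_s (u 0 r * v 0 s) *: (gam s * gam r).
  rewrite /clc mulr_suml exchange_big; apply: eq_bigr => r _; rewrite mulr_sumr.
  by apply: eq_bigr => s _; rewrite mxZl mxZr scalerA mulrC.
have -> : clc u * clc v = \sum_r \sum_s (u 0 r * v 0 s) *: (gam r * gam s).
  rewrite /clc mulr_suml; apply: eq_bigr => r _; rewrite mulr_sumr.
  by apply: eq_bigr => s _; rewrite mxZl mxZr scalerA.
rewrite -big_split /=.
under eq_bigr => r _.
  rewrite -big_split /= (bigD1 r) //= -scalerDr gam_clifford eqxx big1 ?addr0 => [|s sr].
    over.
  by rewrite -scalerDr gam_clifford eq_sym (negbTE sr) mulr0 scale_scalar_mx mulr0 raddf0.
under eq_bigr do rewrite scale_scalar_mx.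
rewrite -raddf_sum /=; congr _%:M.
by rewrite -mulr_suml mulr1 mulrC mxE; congr (_ * _); apply: eq_bigr => r _; rewrite mxE.
Qed.

Lemma frm_acomm F p q :
  frm F p * frm F q + frm F q * frm F p = (2 * ((F *m F^T) p q)%:C)%:M.
Proof.
rewrite -!clc_row clc_acomm; congr (2 * _)%:M.
by rewrite !mxE rmorph_sum; apply: eq_bigr => r _; rewrite !mxE rmorphM.
Qed.

Lemma frm_clif F : F *m F^T = 1%:M ->
  forall p q, frm F p * frm F q + frm F q * frm F p = (2 * (p == q)%:R)%:M.
Proof. by move=> hF p q; rewrite frm_acomm hF mxE rmorph_nat. Qed.

Lemma conj_real (x : R) : (x%:C)^* = x%:C.
Proof. by apply/eqP; rewrite eq_complex /= oppr0 !eqxx. Qed.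

Lemma frm_herm F p : adjmx (frm F p) = frm F p.
Proof.
rewrite /frm adjmx_sum; apply: eq_bigr => q _.
by rewrite adjmxZ gam_herm conj_real.
Qed.

Lemma sumZ_mulmx F G p (Z : 'I_m -> Mat) :
  \sum_q (F p q)%:C *: (\sum_r (G q r)%:C *: Z r) = \sum_r ((F *m G) p r)%:C *: Z r.
Proof.
under eq_bigr do rewrite scaler_sumr.
rewrite exchange_big /=; apply: eq_bigr => r _.
rewrite mxE rmorph_sum scaler_suml; apply: eq_bigr => s _.
by rewrite scalerA rmorphM.
Qed.

Lemma frmM F G p : frm (F *m G) p = \sum_q (F p q)%:C *: frm G q.
Proof.
by rewrite /frm sumZ_mulmx.
Qed.

Lemma frm1 p : frm 1%:M p = gam p.
Proof.
rewrite /frm (bigD1 p) //= big1 ?addr0; first by rewrite mxE eqxx scale1r.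
by move=> q qp; rewrite mxE eq_sym (negbTE qp) scale0r.
Qed.

Definition frame_state F (lam : 'I_n -> R) : Mat :=
  (2%:R ^- n)%:C *: fq (frm F) (enum 'I_n) (fun=> 1) (fun k => (lam k)%:C).

(** Covariance of a frame state in its own frame: one antisymmetric block per pair and zero on the
    unpaired direction. *)
Definition lamx (lam : 'I_n -> R) : 'M[R]_m :=
  \sum_k lam k *: (delta_mx (pe k) (po k) - delta_mx (po k) (pe k)).

(* The covariance equation [[gam_p, X] = - i sum_q K_pq {gam_q, X}] is linear in [X]
   and characterises the Gaussian state of covariance [K] up to normalisation. *)
Definition gauss_eq K X := forall p,
  comm (gam p) X = (- 'i) *: \sum_q (K p q)%:C *: acomm (gam q) X.

Lemma commE_sum (I : finType) (a : I -> C) (A : I -> Mat) X :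
  comm (\sum_i a i *: A i) X = \sum_i a i *: comm (A i) X.
Proof.
rewrite /comm mulr_suml mulr_sumr -sumrB; apply: eq_bigr => i _.
by rewrite mxZl mxZr scalerBr.
Qed.

Lemma acommE_sum (I : finType) (a : I -> C) (A : I -> Mat) X :
  acomm (\sum_i a i *: A i) X = \sum_i a i *: acomm (A i) X.
Proof.
rewrite /acomm mulr_suml mulr_sumr -big_split; apply: eq_bigr => i _.
by rewrite mxZl mxZr scalerDr.
Qed.

Lemma comm_scale (a : C) X Y : comm X (a *: Y) = a *: comm X Y.
Proof. by rewrite /comm mxZl mxZr scalerBr. Qed.

Lemma acomm_scale (a : C) X Y : acomm X (a *: Y) = a *: acomm X Y.
Proof. by rewrite /acomm mxZl mxZr scalerDr. Qed.

Lemma lamxE lam p q : lamx lam p q =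
  \sum_k lam k * ((p == pe k)%:R * (q == po k)%:R - (p == po k)%:R * (q == pe k)%:R).
Proof.
by rewrite summxE; apply: eq_bigr => k _; rewrite !mxE -!natrM !mulnb.
Qed.

Lemma lamx_pe lam k q : lamx lam (pe k) q = if q == po k then lam k else 0.
Proof.
rewrite lamxE (bigD1 k) //= big1 ?addr0 => [|l lk].
  by rewrite !pairE eqxx mul1r mul0r subr0; case: eqP; rewrite ?mulr1 ?mulr0.
by rewrite !pairE (eq_sym k) (negbTE lk) !mul0r subrr mulr0.
Qed.

Lemma lamx_po lam k q : lamx lam (po k) q = if q == pe k then - lam k else 0.
Proof.
rewrite lamxE (bigD1 k) //= big1 ?addr0 => [|l lk].
  by rewrite !pairE eqxx mul1r mul0r sub0r; case: eqP; rewrite ?mulrN1 ?mulr0 ?oppr0 ?mulr0.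
by rewrite !pairE (eq_sym k) (negbTE lk) !mul0r subrr mulr0.
Qed.

Lemma lamx_max lam q : lamx lam ord_max q = 0.
Proof.
rewrite lamxE big1 // => k _.
by rewrite ![ord_max == _]eq_sym !pairE !mul0r subrr mulr0.
Qed.

Lemma frame_state_frame_eq F lam p : F *m F^T = 1%:M ->
  comm (frm F p) (frame_state F lam) =
  (- 'i) *: \sum_q (lamx lam p q)%:C *: acomm (frm F q) (frame_state F lam).
Proof.
move=> /frm_clif hF; rewrite /frame_state comm_scale.
under eq_bigr do rewrite acomm_scale scalerA mulrC -scalerA.
rewrite -scaler_sumr scalerA mulrC -scalerA; congr (_ *: _).
have hk k : k \in enum 'I_n by rewrite mem_enum.
have hs (g : 'I_m -> C) r (A : 'I_m -> Mat) : (forall q, q != r -> g q = 0) ->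
    \sum_q g q *: A q = g r *: A r.
  by move=> h; rewrite (bigD1 r) //= big1 ?addr0 // => q qr; rewrite h ?scale0r.
case: (pairP p) => [k ->|k ->|->].
- have [-> _] := fq_pair hF (fun k => (lam k)%:C) (enum_uniq _) (hk k).
  rewrite (hs _ (po k)) => [|q qk]; last by rewrite lamx_pe (negbTE qk).
  by rewrite lamx_pe eqxx scalerA.
- have [_ ->] := fq_pair hF (fun k => (lam k)%:C) (enum_uniq _) (hk k).
  rewrite (hs _ (pe k)) => [|q qk]; last by rewrite lamx_po (negbTE qk).
  by rewrite lamx_po eqxx scalerA rmorphN mulrNN.
- rewrite (hs _ ord_max) => [|q _]; last by rewrite lamx_max.
  rewrite lamx_max scale0r scaler0 fq_free // => k _.
  by rewrite ![ord_max == _]eq_sym !pairE.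
Qed.

Lemma inv2X : (2%:R ^- n)%:C * N%:R = 1 :> C.
Proof.
have -> : (N%:R : C) = (2%:R ^+ n)%:C by rewrite natrX rmorphXn rmorph_nat.
by rewrite -rmorphM mulVf ?rmorph1 // expf_neq0 // pnatr_eq0.
Qed.

Lemma frame_state_trace F lam : F *m F^T = 1%:M -> \tr (frame_state F lam) = 1.
Proof.
move=> /frm_clif hF; rewrite /frame_state mxtraceZ fq_trace ?enum_uniq // big1 // mulr1.
by rewrite inv2X.
Qed.

(** The equation is covariant under rotations: each [gam p] is expanded in the frame through
    [F^T F = 1]. *)
Lemma frame_state_gauss_eq F lam : F *m F^T = 1%:M -> gauss_eq (F^T *m lamx lam *m F) (frame_state F lam).
Proof.
move=> hF p; have hF' : F^T *m F = 1%:M by apply: mulmx1C.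
set X := frame_state F lam.
rewrite -[gam p]frm1 -hF' frmM commE_sum.
under eq_bigr => q _ do rewrite frame_state_frame_eq // scalerA mulrC -scalerA.
under [in RHS]eq_bigr => q _ do rewrite -[gam q]frm1 -hF' frmM acommE_sum.
by rewrite -scaler_sumr !sumZ_mulmx -(mulmxA _ F) hF mulmx1.
Qed.

(** The twisted map [att'], with a minus sign before the conjugation, intertwines both sides: the
    commutator of the attenuated [X] is [att'] of the old one times the factor of [p], and the
    anticommutator times that factor is [att'] of the old one. Keeping the factor on the
    anticommutator side avoids dividing by [b]. *)
Lemma attenuate_gauss_eq K r (b : R) X : gauss_eq K X ->
  gauss_eq (\matrix_(p, q) ((if p == r then b else 1) * K p q * (if q == r then b else 1)))
      (attenuate r ((1 + b) / 2) ((1 - b) / 2) X).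
Proof.
pose u := (1 + b) / 2; pose v := (1 - b) / 2.
pose att' Y : Mat := u%:C *: Y - v%:C *: (gam r * Y * gam r).
have hr (Y Z : Mat) p : p != r -> gam p * (gam r * Y * gam r) = - (gam r * (gam p * Y) * gam r).
  by move=> pr; rewrite !mulrA (gam_anti R pr) !mulNr.
have hr' (Y Z : Mat) p : p != r -> gam r * Y * gam r * gam p = - (gam r * (Y * gam p) * gam r).
  by move=> pr; rewrite -!mulrA [gam r * gam p](gam_anti R) 1?eq_sym // !mulrN.
have uv1 : u%:C + v%:C = 1 by rewrite -rmorphD (_ : u + v = 1) ?rmorph1 // /u /v; lra.
have uvb : u%:C - v%:C = b%:C by rewrite -rmorphB (_ : u - v = b) // /u /v; lra.
have c1 p : comm (gam p) (attenuate r u v X) = (if p == r then b else 1)%:C *: att' (comm (gam p) X).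
  rewrite /attenuate /comm /att'; have [->|pr] := eqVneq p r.
    have e1 : gam r * (gam r * X - X * gam r) * gam r = - (gam r * X - X * gam r).
      by rewrite mulrBr mulrBl !mulrA gam_sq mul1r -!mulrA gam_sq mulr1 opprB.
    have e2 : gam r * (gam r * X * gam r) - gam r * X * gam r * gam r = - (gam r * X - X * gam r).
      by rewrite !mulrA gam_sq mul1r -!mulrA gam_sq mulr1 opprB.
    rewrite e1 scalerN opprK -scalerDl uv1 scale1r mulrDr mulrDl !mxZl !mxZr.
    by rewrite opprD addrACA -!scalerBr e2 scalerN -scalerBl uvb.
  rewrite scale1r mulrDr mulrDl !mxZl !mxZr hr // hr' // opprD addrACA -scalerBr.
  by rewrite !scalerN -opprD -scalerBr mulrBr mulrBl.
have c2 p : (if p == r then b else 1)%:C *: acomm (gam p) (attenuate r u v X) = att' (acomm (gam p) X).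
  rewrite /attenuate /acomm /att'; have [->|pr] := eqVneq p r.
    have e1 : gam r * (gam r * X + X * gam r) * gam r = gam r * X + X * gam r.
      by rewrite mulrDr mulrDl !mulrA gam_sq mul1r -!mulrA gam_sq mulr1 addrC.
    have e2 : gam r * (gam r * X * gam r) + gam r * X * gam r * gam r = gam r * X + X * gam r.
      by rewrite !mulrA gam_sq mul1r -!mulrA gam_sq mulr1 addrC.
    rewrite e1 -scalerBl uvb mulrDr mulrDl !mxZl !mxZr.
    by rewrite addrACA -!scalerDr e2 -scalerDl uv1 scale1r.
  rewrite scale1r mulrDr mulrDl !mxZl !mxZr hr // hr' // addrACA -scalerDr.
  by rewrite !scalerN -opprD -scalerDr mulrDr mulrDl.
have attZ (a : C) Y : att' (a *: Y) = a *: att' Y.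
  by rewrite /att' mxZr mxZl scalerBr !scalerA ![a * _]mulrC.
have attS (Y : 'I_m -> Mat) : att' (\sum_q Y q) = \sum_q att' (Y q).
  by rewrite /att' mulr_sumr mulr_suml !scaler_sumr -sumrB.
move=> h p; rewrite -/u -/v c1 h attZ attS scalerA mulrC -scalerA; congr (_ *: _).
rewrite scaler_sumr; apply: eq_bigr => q _; rewrite attZ -c2 !scalerA mxE.
by congr (_ *: _); rewrite !rmorphM.
Qed.

Lemma chan_gauss_eq s K (b : 'I_m -> R) X : uniq s -> gauss_eq K X ->
  gauss_eq (\matrix_(p, q) ((if p \in s then b p else 1) * K p q * (if q \in s then b q else 1)))
      (chan s (fun p => (1 + b p) / 2) (fun p => (1 - b p) / 2) X).
Proof.
elim: s => [_|r s IH] /=.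
  move=> h p; rewrite [LHS]h; congr (_ *: _); apply: eq_bigr => q _.
  by rewrite mxE mulr1 mul1r.
move=> /andP[rs us] h p; rewrite (attenuate_gauss_eq _ _ (IH us h)); congr (_ *: _).
apply: eq_bigr => q _; rewrite !mxE !in_cons; congr (_%:C *: _).
by have [->|pr] := eqVneq p r; have [->|qr] := eqVneq q r;
   rewrite ?(negbTE rs) /= ?(mulr1, mul1r) ?mulrA ?(mulr1, mul1r).
Qed.

Lemma chan_tr s (b : 'I_m -> R) X :
  \tr (chan s (fun p => (1 + b p) / 2) (fun p => (1 - b p) / 2) X) = \tr X.
Proof.
elim: s => //= p s IH; rewrite mxtraceD !mxtraceZ [\tr (_ * gam p)]mxtraceM mulrA gam_sq mul1r.
rewrite IH -mulrDl -rmorphD (_ : (1 + b p) / 2 + (1 - b p) / 2 = 1) ?rmorph1 ?mul1r //; lra.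
Qed.

Definition word (s : seq 'I_m) : Mat := \prod_(p <- s) gam p.

Lemma word_cons p s : word (p :: s) = gam p * word s.
Proof. by rewrite /word big_cons. Qed.

Lemma word_cat s t : word (s ++ t) = word s * word t.
Proof. by rewrite /word big_cat. Qed.

Lemma word_rcons s p : word (rcons s p) = word s * gam p.
Proof. by rewrite /word -cats1 big_cat big_seq1. Qed.

(* Moving [gam q] through a word costs only words shorter by two. *)
Lemma word_contract X (k : nat) q (pre s : seq 'I_m) :
  (forall t, size t = k -> \tr (X * word t) = 0) -> (size pre + size s = k.+1)%N ->
  \tr (X * (word pre * (word s * gam q))) =
  (-1) ^+ size s * \tr (X * (word pre * (gam q * word s))).
Proof.
move=> h; elim: s pre => [|p s IH] pre hs.
  by rewrite /word big_nil mulr1 expr0 !mul1r.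
have := IH (rcons pre p); rewrite size_rcons addSnnS => /(_ hs).
rewrite word_rcons => e.
rewrite !word_cons exprS.
have -> : \tr (X * (word pre * (gam p * word s * gam q))) =
          \tr (X * (word pre * gam p * (word s * gam q))) by rewrite !mulrA.
rewrite e mulN1r mulNr -mulrN; congr (_ * _).
have h0 : \tr (X * (word pre * word s)) = 0.
  by rewrite -word_cat h // size_cat; move: hs => /=; lia.
apply/eqP; rewrite -addr_eq0 -mxtraceD; apply/eqP.
have -> : X * (word pre * gam p * (gam q * word s)) + X * (word pre * (gam q * (gam p * word s)))
   = (2 * (p == q)%:R) *: (X * (word pre * word s)).
  rewrite -mulrDr -[word pre * gam p * _]mulrA -mulrDr.
  have -> : gam p * (gam q * word s) + gam q * (gam p * word s) = (2 * (p == q)%:R) *: word s.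
    by rewrite !mulrA -mulrDl gam_clifford -mulmxE mul_scalar_mx.
  by rewrite !mxZr.
by rewrite mxtraceZ h0 mulr0.
Qed.

(** For an even word [gam p * word s], the tail [s] has odd length, so moving a generator through it
    changes the sign, shorter words being traceless against [X]. The anticommutators on the right of
    the equation then contribute nothing, while the commutator gives twice the wanted trace up to
    sign. *)
Lemma gauss_eq_word0 K X : gauss_eq K X -> \tr X = 0 ->
  forall (k : nat) s, size s = k.*2 -> \tr (X * word s) = 0.
Proof.
move=> hK h0; elim=> [|k IH] [|p s] //=; first by rewrite /word big_nil mulr1.
case=> hs; rewrite word_cons.
have hc q : \tr (X * (word s * gam q)) = - \tr (X * (gam q * word s)).
  have := @word_contract X k.*2 q [::] s IH; rewrite /word big_nil !mul1r.
  by move=> ->; rewrite ?hs //= exprS -signr_odd odd_double expr0 mulr1 mulN1r.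
have := congr1 (fun Z => \tr (Z * word s)) (hK p).
rewrite mxZl mulr_suml mxtraceZ mxtrace_sum big1 ?mulr0 => [|q _].
  rewrite /comm mulrBl raddfB /= -!mulrA [\tr (gam p * (X * _))]mxtraceM -mulrA hc -opprD => /eqP.
  by rewrite oppr_eq0 -mulr2n mulrn_eq0 /= => /eqP.
by rewrite mxZl mxtraceZ /acomm mulrDl mxtraceD -mulrA mxtraceM -!mulrA hc addNr mulr0.
Qed.

(** Even words suffice because [c_q = - i gam ord_max gam (wid q)]. *)
Lemma mono_word x : exists c s, ~~ odd (size s) /\ mono R x = c *: word s.
Proof.
rewrite monoE; elim/big_ind: _ => [|A B [c [s [hs ->]]] [d [t [ht ->]]]|q _].
- by exists 1, [::]; rewrite /word big_nil scale1r.
- exists (c * d), (s ++ t); rewrite size_cat oddD (negbTE hs) (negbTE ht).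
  by rewrite word_cat mxZl mxZr scalerA.
- case: (x q); last by exists 1, [::]; rewrite /word big_nil scale1r.
  exists (- 'i), [:: ord_max; wid q]; rewrite /word big_cons big_seq1 gam_max_wid scalerA.
  by rewrite mulNr mulCii opprK scale1r.
Qed.

Lemma gauss_eq_unique K X Y : gauss_eq K X -> gauss_eq K Y -> \tr X = \tr Y -> X = Y.
Proof.
move=> hX hY ht; apply/eqP; rewrite -subr_eq0; apply/eqP.
have hZ : gauss_eq K (X - Y).
  move=> p; have -> : comm (gam p) (X - Y) = comm (gam p) X - comm (gam p) Y.
    by rewrite /comm mulrBr mulrBl !opprB addrACA [RHS]addrACA; congr (_ + _); apply: addrC.
  rewrite hX hY -scalerBr -sumrB; congr (_ *: _); apply: eq_bigr => q _.
  rewrite -scalerBr; congr (_ *: _).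
  by rewrite /acomm mulrBr mulrBl opprD addrACA.
have h0 : \tr (X - Y) = 0 by rewrite raddfB /= ht subrr.
apply: mono_trace_eq0 => x; have [c [s [hs ->]]] := mono_word x.
rewrite mxZr mxtraceZ (gauss_eq_word0 hZ h0 (k := (size s)./2)) ?mulr0 //.
by rewrite -[LHS]odd_double_half (negbTE hs).
Qed.

Definition bcoef_mx (b : 'I_(2 * n) -> R) : 'M[R]_m := diag_mx (\row_p bcoef b p).

(** Both sides solve the covariance equation for the damped matrix and both have trace 1. *)
Lemma channel_frame_state b (Phi : {linear Mat -> Mat}) F G lam mu :
  fermionic_product_channel b Phi ->
  F *m F^T = 1%:M -> G *m G^T = 1%:M ->
  bcoef_mx b *m (F^T *m lamx lam *m F) *m bcoef_mx b = G^T *m lamx mu *m G ->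
  Phi (frame_state F lam) = frame_state G mu.
Proof.
move=> hPhi hF hG hK; rewrite (channelE hPhi).
have h1 := chan_gauss_eq (bcoef b) (enum_uniq 'I_m) (frame_state_gauss_eq lam hF).
have h2 := frame_state_gauss_eq mu hG.
have h3 := chan_tr (enum 'I_m) (bcoef b) (frame_state F lam).
refine (gauss_eq_unique _ h2 _); last first.
  exact (etrans h3 (etrans (frame_state_trace lam hF) (esym (frame_state_trace mu hG)))).
move=> p; rewrite (h1 p) -hK; congr (_ *: _).
move: (F^T *m _ *m F) => K; apply: eq_bigr => q _; congr (_%:C *: _).
by rewrite /bcoef_mx mul_mx_diag mul_diag_mx !mxE !mem_enum.
Qed.

End GaussianEquation.

(** * Entropy *)

Section Spectral.
Variable R : realType.
Local Notation C := (R[i]).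
Local Notation "x %:C" := (real_complex R x).

Lemma herm_spectral k (A : 'M[C]_k) : (map_mx (@conjc R) A)^T = A ->
  exists (V : 'M[C]_k) (d : 'I_k -> R), V *m (map_mx (@conjc R) V)^T = 1%:M /\
    A = V *m diag_mx (\row_i (d i)%:C) *m (map_mx (@conjc R) V)^T.
Proof.
move=> hA.
have hh : A \is hermsymmx.
  by apply/is_hermitianmxP; rewrite expr0 scale1r -map_trmx; apply: esym.
have /orthomx_spectralP e := hermitian_normalmx hh.
have dr := hermitian_spectral_diag_real hh.
have uP := spectral_unitarymx A; set P := spectralmx A in e uP.
have eP : invmx P = (map_mx (@conjc R) P)^T by rewrite invmx_unitary // -map_trmx.
exists (invmx P), (fun i => complex.Re (spectral_diag A 0 i)).
have eP' : (map_mx (@conjc R) (invmx P))^T = P.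
  by rewrite eP; apply/matrixP => i j; rewrite !mxE conjcK.
rewrite eP'; split; first by rewrite mulVmx // unitarymx_unit.
rewrite {1}e; congr (_ *m diag_mx _ *m _); apply/rowP => i; rewrite !mxE RRe_real //.
by have /mxOverP := dr.
Qed.

Lemma poly_interp (F : fieldType) (s : seq F) (f : F -> F) :
  exists p : {poly F}, forall x, x \in s -> p.[x] = f x.
Proof.
elim: s => [|a s [p hp]]; first by exists 0.
have [as_|as_] := boolP (a \in s).
  by exists p => x; rewrite in_cons => /orP[/eqP ->|]; apply: hp.
pose g : {poly F} := \prod_(y <- s) ('X - y%:P).
have ga : g.[a] != 0 by rewrite -/(root _ _) root_prod_XsubC.
exists (p + ((f a - p.[a]) / g.[a]) *: g) => x.
rewrite in_cons !hornerE => /orP[/eqP ->|xs]; first by rewrite divfK // subrKC.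
suff -> : g.[x] = 0 by rewrite mulr0 addr0 hp.
by apply/eqP; rewrite -/(root _ _) root_prod_XsubC.
Qed.

(** Finitely many values are involved, so [f] agrees with a polynomial on all of them. Eigenvalues
    are thus compared without matching multiplicities. *)
Lemma moments_eq (I J : finType) (d : I -> R) (w : J -> R) :
  (forall k : nat, \sum_i d i ^+ k = \sum_j w j ^+ k) ->
  forall f : R -> R, \sum_i f (d i) = \sum_j f (w j).
Proof.
move=> h f; have [p hp] := poly_interp (codom d ++ codom w) f.
have -> : \sum_i f (d i) = \sum_i p.[d i].
  by apply: eq_bigr => i _; rewrite hp // mem_cat codom_f.
have -> : \sum_j f (w j) = \sum_j p.[w j].
  by apply: eq_bigr => i _; rewrite hp // mem_cat codom_f orbT.
under eq_bigr do rewrite horner_coef.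
under [RHS]eq_bigr do rewrite horner_coef.
rewrite exchange_big [RHS]exchange_big /=; apply: eq_bigr => k _.
by rewrite -!mulr_sumr h.
Qed.

End Spectral.

(** * Scalar entropy inequalities *)

Section Eta.
Variable R : realType.

Lemma eta0 : eta (0 : R) = 0. Proof. by rewrite /eta mul0r oppr0. Qed.
Lemma ln2_gt0 : 0 < ln (2 : R). Proof. by rewrite ln_gt0 // ltr1n. Qed.

Lemma ln_le_sub1 (x : R) : 0 < x -> ln x <= x - 1.
Proof. by move=> x0; have := @le_ln1Dx R (x - 1); rewrite addrCA subrr addr0; apply; lra. Qed.

(** The tangent bound [ln t <= t - 1] at [t = y / x]; at [x = 0] it rests on [eta 0 = 0]. *)
Lemma eta_gibbs (x y : R) : 0 <= x -> 0 < y ->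
  eta x <= x * - log2 y + (y - x) / ln 2.
Proof.
rewrite le_eqVlt => /orP[/eqP <- y0|x0 y0].
  by rewrite eta0 mul0r add0r subr0 divr_ge0 // ltW // ln2_gt0.
rewrite /eta /log2 -subr_ge0.
have -> : x * - (ln y / ln 2) + (y - x) / ln 2 - - (x * (ln x / ln 2)) =
  (y - x - x * (ln y - ln x)) / ln 2 by field; rewrite lt0r_neq0 // ln2_gt0.
apply: divr_ge0; last exact/ltW/ln2_gt0.
have := ln_le_sub1 (divr_gt0 y0 x0); rewrite ln_div // => h.
have := ler_wpM2l (ltW x0) h; rewrite mulrBr mulrBr mulrCA divff ?mulr1; last by rewrite lt0r_neq0.
by lra.
Qed.

(** The Gibbs bound with [y] the mean, averaged. If the mean is 0, every weight or its value
    vanishes. *)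
Lemma eta_jensen (I : finType) (w x : I -> R) :
  (forall i, 0 <= w i) -> (forall i, 0 <= x i) -> \sum_i w i = 1 ->
  \sum_i w i * eta (x i) <= eta (\sum_i w i * x i).
Proof.
move=> w0 x0 w1; set a := \sum_i w i * x i.
have a0 : 0 <= a by apply: sumr_ge0 => i _; apply: mulr_ge0.
move: a0; rewrite le_eqVlt => /orP[/eqP a0|a0].
  rewrite -a0 eta0 big1 // => i _.
  have /eqP := esym a0; rewrite psumr_eq0 => [|j _]; last exact: mulr_ge0.
  move=> /allP /(_ i); rewrite mem_index_enum => /(_ isT) /=.
  by rewrite mulf_eq0 => /orP[/eqP ->|/eqP ->]; rewrite ?mul0r // eta0 mulr0.
have : \sum_i w i * eta (x i) <= \sum_i w i * (x i * - log2 a + (a - x i) / ln 2).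
  by apply: ler_sum => i _; apply: ler_wpM2l => //; apply: eta_gibbs.
move=> /le_trans; apply; rewrite le_eqVlt; apply/orP; left; apply/eqP.
under eq_bigr do rewrite mulrDr !mulrA mulrBr.
rewrite big_split /= -!mulr_suml sumrB -/a -mulr_suml w1 mul1r subrr mul0r addr0.
by rewrite /eta mulrN.
Qed.

Lemma log2_prod (I : finType) (y : I -> R) : (forall i, 0 < y i) ->
  log2 (\prod_i y i) = \sum_i log2 (y i).
Proof.
move=> y0; rewrite /log2 -mulr_suml; congr (_ / _).
suff [] : ln (\prod_i y i) = \sum_i ln (y i) /\ 0 < \prod_i y i by [].
apply: (big_rec2 (fun a b => ln a = b /\ 0 < a)); first by rewrite ln1.
by move=> i a b _ [<- b0]; rewrite lnM ?posrE //; split=> //; apply: mulr_gt0.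
Qed.

(** The product rule [eta (x y) = eta x * y + x * eta y], which survives zero factors since
    [eta 0 = 0]; it makes the entropy of a product distribution additive. *)
Lemma eta_prod (I : finType) (y : I -> R) : (forall i, 0 <= y i) ->
  eta (\prod_i y i) = \sum_j \prod_i (if i == j then eta (y i) else y i).
Proof.
move=> y0; have [/forallP h|] := boolP [forall i, 0 < y i].
  rewrite /eta log2_prod // mulr_sumr -sumrN; apply: eq_bigr => j _.
  rewrite (bigD1 j) //= [RHS](bigD1 j) //= eqxx.
  rewrite [X in _ = _ * X](eq_bigr y) => [|i /negbTE -> //].
  by rewrite mulrAC mulNr.
move=> /forallPn[j0]; rewrite -leNgt => yi0.
have yi : y j0 = 0 by apply/eqP; rewrite eq_le yi0 y0.
rewrite (bigD1 j0) //= yi mul0r eta0 big1 // => j _.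
rewrite (bigD1 j0) //= yi eta0; case: ifP => _; by rewrite mul0r.
Qed.

End Eta.

Section Entropy.
Variables (R : realType) (n : nat).
Local Notation C := (R[i]).
Local Notation N := (2 ^ n)%N.
Local Notation Mat := 'M[C]_N.
Local Notation "x %:C" := (real_complex R x).
Implicit Types (A B X : Mat) (V U : Mat).

Lemma unitaryE V : unitary V -> adjmx V * V = 1.
Proof. by move=> h; apply: unitary_comm; rewrite -mulmxE. Qed.

Lemma hermitian_spec A : hermitian A -> exists Vd, spec_decomp A Vd.
Proof.
move=> /herm_spectral [V [d [hV hA]]]; exists (V, \row_i d i); split => //=.
by rewrite [LHS]hA /rdiag; congr (_ *m diag_mx _ *m _); apply/rowP => i; rewrite !mxE.
Qed.

Lemma spec_power A Vd k : spec_decomp A Vd ->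
  A ^+ k = Vd.1 * rdiag (fun i => Vd.2 0 i ^+ k) * adjmx Vd.1.
Proof.
case=> hV hA; elim: k => [|k IH].
  rewrite expr0 (_ : rdiag _ = 1) ?mulr1; first exact/esym.
  by apply/matrixP => i j; rewrite -[1]/(1%:M : Mat) !mxE expr0 rmorph1.
rewrite exprSr IH {1}hA -!mulmxE !mulmxA -(mulmxA _ (adjmx Vd.1) Vd.1).
rewrite [adjmx Vd.1 *m Vd.1](unitaryE hV) mulmx1; congr (_ *m _).
rewrite -mulmxA mulmx_diag; congr (_ *m diag_mx _); apply/rowP => i.
by rewrite !mxE exprSr rmorphM.
Qed.

Lemma spec_moment A Vd k : spec_decomp A Vd -> \tr (A ^+ k) = (\sum_i Vd.2 0 i ^+ k)%:C.
Proof.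
move=> h; rewrite (spec_power k h) mxtraceM mulrA unitaryE ?mul1r; last by case: h.
rewrite /mxtrace rmorph_sum; apply: eq_bigr => i _.
by rewrite !mxE eqxx mulr1n.
Qed.

Lemma real_complex_inj : injective (real_complex R).
Proof. by move=> x y []. Qed.

(** [vN_entropy] selects a spectral decomposition by choice; the moments show that the value does
    not depend on which one. *)
Lemma entropy_moments (J : finType) (w : J -> R) A : hermitian A ->
  (forall k : nat, \tr (A ^+ k) = (\sum_j w j ^+ k)%:C) ->
  vN_entropy A = \sum_j eta (w j).
Proof.
move=> /hermitian_spec hA hw; rewrite /vN_entropy.
have := @xgetPex _ (0, 0) (spec_decomp A) hA.
set Vd := xget _ _ => h; apply: moments_eq => k; apply: real_complex_inj.
by rewrite -(spec_moment k h).
Qed.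

Lemma entropy_spec A Vd : spec_decomp A Vd -> vN_entropy A = \sum_i eta (Vd.2 0 i).
Proof.
move=> h; apply: entropy_moments; last by move=> k; apply: spec_moment.
case: h => _ ->; rewrite /hermitian !mulmxE !adjmxM adjmxK mulrA; congr (_ * _ * _).
apply/matrixP => i j; rewrite !mxE eq_sym; case: eqP => [->|_].
  by rewrite mulr1n conjc_real.
by rewrite mulr0n conjc0.
Qed.

Definition qf (v : 'cV[C]_N) A : C := ((map_mx (@conjc R) v)^T *m A *m v) 0 0.

Lemma spec_qf A Vd i : spec_decomp A Vd -> (Vd.2 0 i)%:C = qf (col i Vd.1) A.
Proof.
case=> hV hA; rewrite /qf hA.
have e1 : (map_mx (@conjc R) (col i Vd.1))^T = row i (adjmx Vd.1).
  by apply/rowP => j; rewrite !mxE.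
have e2 : (adjmx Vd.1) *m Vd.1 = 1%:M by exact: unitaryE.
rewrite e1 -row_mul colE mulmxA -row_mul !mulmxA e2 mul1mx -mulmxA e2 mulmx1.
by rewrite -colE !mxE eqxx mulr1n.
Qed.

Lemma spec_ge0 A Vd : spec_decomp A Vd -> psd A -> forall i, 0 <= Vd.2 0 i.
Proof.
move=> h [_ hp] i; have := hp (col i Vd.1); rewrite -/(qf _ _) -spec_qf //.
by rewrite ler0c.
Qed.

Lemma spec_trace A Vd : spec_decomp A Vd -> \tr A = (\sum_i Vd.2 0 i)%:C.
Proof.
move=> h; have := spec_moment 1 h; rewrite expr1 => ->.
by congr (_%:C); apply: eq_bigr => i _; rewrite expr1.
Qed.

Lemma log2_pow k : log2 (2%:R ^+ k : R) = k%:R.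
Proof.
by rewrite /log2 lnXn ?ltr0n // -[_ *+ _]mulr_natl mulfK //; apply/lt0r_neq0/ln2_gt0.
Qed.

Lemma log2_powV k : log2 (2%:R ^- k : R) = - k%:R.
Proof. by rewrite -(log2_pow k) /log2 lnV ?mulNr // posrE exprn_gt0 ?ltr0n. Qed.

(** The Gibbs bound against the uniform weight [2 ^- n]. *)
Lemma entropy_le A : density A -> vN_entropy A <= n%:R.
Proof.
case=> hp ht; have [Vd h] := hermitian_spec hp.1; rewrite (entropy_spec h).
have d0 := spec_ge0 h hp.
have d1 : \sum_i Vd.2 0 i = 1 by apply: real_complex_inj; rewrite -(spec_trace h).
have y0 : 0 < (2%:R ^- n : R) by rewrite invr_gt0 exprn_gt0.
apply: (@le_trans _ _ (\sum_i (Vd.2 0 i * n%:R + (2%:R ^- n - Vd.2 0 i) / ln 2))).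
  apply: ler_sum => i _; have := eta_gibbs (d0 i) y0.
  by rewrite log2_powV opprK.
rewrite big_split /= -!mulr_suml sumrB d1 mul1r sumr_const card_ord -[_ ^- _ *+ _]mulr_natl natrX.
by rewrite divff ?subrr ?mul0r ?addr0 // expf_neq0 // pnatr_eq0.
Qed.

Lemma entropy_mixed : vN_entropy ((2%:R ^- n)%:C *: (1 : Mat)) = n%:R.
Proof.
rewrite (@entropy_spec _ (1, \row_i 2%:R ^- n)); last first.
  split=> /=; first by rewrite /unitary adjmx1 mulmx1.
  rewrite adjmx1 mulmx1 mul1mx; apply/matrixP => i j.
  by rewrite -[(1 : Mat)]/(1%:M : Mat) !mxE; case: eqP => _; rewrite ?mulr1 ?mulr0.
under eq_bigr do rewrite /= mxE /eta log2_powV mulrN opprK.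
rewrite sumr_const card_ord -[(_ * _) *+ _]mulr_natl natrX mulrA divff ?mul1r //.
by rewrite expf_neq0 // pnatr_eq0.
Qed.

End Entropy.

(** * Positive matrices and concavity of the entropy *)

Section Concavity.
Variables (R : realType) (n : nat).
Local Notation C := (R[i]).
Local Notation N := (2 ^ n)%N.
Local Notation Mat := 'M[C]_N.
Local Notation "x %:C" := (real_complex R x).
Implicit Types (A B X : Mat) (v : 'cV[C]_N).

Lemma qfD v A B : qf v (A + B) = qf v A + qf v B.
Proof. by rewrite /qf mulmxDr mulmxDl mxE. Qed.

Lemma qfZ v (a : C) A : qf v (a *: A) = a * qf v A.
Proof. by rewrite /qf -scalemxAr -scalemxAl mxE. Qed.

Lemma qf_conj v A X : qf v (X * A * adjmx X) = qf (adjmx X *m v) A.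
Proof.
have e : (map_mx (@conjc R) (adjmx X *m v))^T = (map_mx (@conjc R) v)^T *m X.
  rewrite map_mxM trmx_mul; congr (_ *m _).
  by apply/matrixP => i j; rewrite !mxE; apply: conjcK.
by rewrite /qf e -!mulmxE !mulmxA.
Qed.

Lemma psd_conj A X : psd A -> psd (X * A * adjmx X).
Proof.
move=> [hA pA]; split; first by rewrite /hermitian !adjmxM adjmxK hA mulrA.
by move=> v; rewrite -/(qf _ _) qf_conj; apply: pA.
Qed.

Lemma psdD A B : psd A -> psd B -> psd (A + B).
Proof.
move=> [hA pA] [hB pB]; split; first by rewrite /hermitian adjmxD hA hB.
by move=> v; rewrite -/(qf _ _) qfD addr_ge0 // ; [apply: pA|apply: pB].
Qed.

Lemma psdZ (a : R) A : 0 <= a -> psd A -> psd (a%:C *: A).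
Proof.
move=> a0 [hA pA]; split; first by rewrite /hermitian adjmxZ conj_real hA.
by move=> v; rewrite -/(qf _ _) qfZ mulr_ge0 ?ler0c //; apply: pA.
Qed.

Lemma psd1 : psd (1 : Mat).
Proof.
split; first exact: adjmx1.
move=> v; rewrite mulmx1 !mxE; apply: sumr_ge0 => i _; rewrite !mxE.
by rewrite mulrC; apply: mul_conjC_ge0.
Qed.

Lemma psd_sqr X : psd (X * adjmx X).
Proof. by rewrite -[X in X * _]mulr1; apply/psd_conj/psd1. Qed.

Lemma psd_sum k (p : 'I_k -> R) (A : 'I_k -> Mat) :
  (forall a, 0 <= p a) -> (forall a, psd (A a)) -> psd (\sum_a (p a)%:C *: A a).
Proof.
move=> p0 hA; elim/big_ind: _ => [|B D hB hD|a _]; [|exact: psdD|exact: psdZ].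
by rewrite -(scale0r (1 : Mat)) -[0]/(0%:C); apply: psdZ psd1.
Qed.

Lemma psd_trace_ge0 A : psd A -> 0 <= \tr A.
Proof.
move=> h; have [Vd hs] := hermitian_spec h.1; rewrite (spec_trace hs) ler0c.
by apply: sumr_ge0 => i _; apply: spec_ge0 hs h i.
Qed.

Definition nsq (z : C) : R := complex.Re z ^+ 2 + complex.Im z ^+ 2.

Lemma nsqE z : (nsq z)%:C = z^* * z.
Proof.
case: z => a b; rewrite /nsq; apply/eqP; rewrite eq_complex /=; apply/andP; split; apply/eqP; ring.
Qed.

Lemma nsq_ge0 z : 0 <= nsq z. Proof. by rewrite addr_ge0 // sqr_ge0. Qed.

Lemma nsq_unitary_col X j : adjmx X * X = 1 -> \sum_k nsq (X k j) = 1.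
Proof.
move=> /(congr1 (fun Z : Mat => Z j j)); rewrite -mulmxE -[(1 : Mat)]/(1%:M : Mat) !mxE eqxx => h.
apply: real_complex_inj; rewrite rmorph_sum rmorph1 -[RHS]h.
by apply: eq_bigr => k _; rewrite /= nsqE !mxE.
Qed.

Lemma nsq_unitary_row X k : X * adjmx X = 1 -> \sum_j nsq (X k j) = 1.
Proof.
move=> /(congr1 (fun Z : Mat => Z k k)); rewrite -mulmxE -[(1 : Mat)]/(1%:M : Mat) !mxE eqxx => h.
apply: real_complex_inj; rewrite rmorph_sum rmorph1 -[RHS]h.
by apply: eq_bigr => j _; rewrite /= nsqE !mxE mulrC.
Qed.

Lemma qf_col_spec A Vd V j : spec_decomp A Vd ->
  qf (col j V) A = (\sum_k nsq ((adjmx Vd.1 * V) k j) * Vd.2 0 k)%:C.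
Proof.
case=> hV ->; rewrite mulmxE qf_conj -mulmxE colE mulmxA -colE.
rewrite /qf /rdiag mul_mx_diag mxE rmorph_sum; apply: eq_bigr => k _.
by rewrite rmorphM /= nsqE !mxE [RHS]mulrAC.
Qed.

(** Each eigenvalue of the mixture is an average of the eigenvalues of the [A a], with weights [p a]
    times a squared overlap of eigenvectors. For fixed [j] the weights sum to 1, so Jensen applies;
    summed over [j] they give back [p a]. *)
Lemma entropy_concave k (p : 'I_k -> R) (A : 'I_k -> Mat) :
  prob_dist p -> (forall a, psd (A a)) ->
  \sum_a p a * vN_entropy (A a) <= vN_entropy (\sum_a (p a)%:C *: A a).
Proof.
move=> [p0 p1] hA; have [W hW] := choice (fun a => hermitian_spec (hA a).1).
have [Vd hV] := hermitian_spec (psd_sum p0 hA).1.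
rewrite (entropy_spec hV).
under eq_bigr => a _ do rewrite (entropy_spec (hW a)).
pose w a j l := nsq ((adjmx (W a).1 * Vd.1) l j).
have uX a : adjmx (adjmx (W a).1 * Vd.1) * (adjmx (W a).1 * Vd.1) = 1.
  rewrite adjmxM adjmxK -mulrA [_ * (adjmx _ * _)]mulrA.
  have -> : (W a).1 * adjmx (W a).1 = 1 by case: (hW a).
  by rewrite mul1r unitaryE //; case: hV.
have dE j : Vd.2 0 j = \sum_(z : 'I_k * 'I_N) (p z.1 * w z.1 j z.2) * (W z.1).2 0 z.2.
  apply: real_complex_inj; rewrite (spec_qf j hV).
  rewrite -(pair_bigA _ (fun a l => (p a * w a j l) * (W a).2 0 l)) /= rmorph_sum.
  rewrite (big_morph (qf _) (qfD _) (_ : qf _ 0 = 0)); last by rewrite /qf mulmx0 mul0mx mxE.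
  apply: eq_bigr => a _; rewrite qfZ (qf_col_spec _ _ (hW a)) -rmorphM mulr_sumr.
  by congr (_%:C); apply: eq_bigr => l _; rewrite mulrA.
apply: (@le_trans _ _ (\sum_j \sum_(z : 'I_k * 'I_N) (p z.1 * w z.1 j z.2) * eta ((W z.1).2 0 z.2))).
  rewrite exchange_big /= -(pair_bigA _ (fun a l => \sum_j (p a * w a j l) * eta ((W a).2 0 l))) /=.
  rewrite le_eqVlt; apply/orP; left; apply/eqP; apply: eq_bigr => a _.
  rewrite mulr_sumr; apply: eq_bigr => l _.
  rewrite -mulr_suml -mulr_sumr nsq_unitary_row ?mulr1 //.
  exact: unitary_comm.
apply: ler_sum => j _; rewrite dE; apply: eta_jensen => [[a l]|[a l]|] /=.
- by rewrite mulr_ge0 // nsq_ge0.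
- exact: spec_ge0 (hW a) (hA a) l.
- rewrite -(pair_bigA _ (fun a l => p a * w a j l)) /= -p1; apply: eq_bigr => a _.
  by rewrite -mulr_sumr nsq_unitary_col ?mulr1.
Qed.

End Concavity.

(** * Spectrum, entropy and positivity of frame states *)

Section FrameEntropy.
Variables (R : realType) (n : nat).
Local Notation C := (R[i]).
Local Notation N := (2 ^ n)%N.
Local Notation Mat := 'M[C]_N.
Local Notation m := (2 * n).+1.
Local Notation "x %:C" := (real_complex R x).
Variable (F : 'M[R]_m).
Hypothesis hF : F *m F^T = 1%:M.
Implicit Types (a b lam : 'I_n -> R).

Let clif := frm_clif hF.

Lemma fq_herm s a b :
  adjmx (fq (frm F) s (fun k => (a k)%:C) (fun k => (b k)%:C)) =
  fq (frm F) s (fun k => (a k)%:C) (fun k => (b k)%:C).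
Proof.
elim: s => [|k s IH]; first by rewrite /fq big_nil adjmx1.
rewrite fq_cons adjmxM IH adjmxD !adjmxZ adjmx1 !conj_real (ft_herm clif (frm_herm F)).
apply/esym/comm_fq => l _.
by rewrite mulrDl mulrDr !mxZl !mxZr mul1r mulr1 (ft_ft clif).
Qed.

Lemma frame_state_herm lam : hermitian (frame_state F lam).
Proof.
rewrite /hermitian /frame_state adjmxZ conj_real; congr (_ *: _).
have := fq_herm (enum 'I_n) (fun=> 1) lam.
by rewrite (_ : (fun=> 1%:C) = fun=> 1) //; apply: funext => k; rewrite rmorph1.
Qed.

(** [1 + b T] has eigenvalues [1 + b] and [1 - b]; the new coefficients are half the sum and half
    the difference of their powers. *)
Lemma fq_power s b k :
  fq (frm F) s (fun=> 1) (fun j => (b j)%:C) ^+ k =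
  fq (frm F) s (fun j => (((1 + b j) ^+ k + (1 - b j) ^+ k) / 2)%:C)
               (fun j => (((1 + b j) ^+ k - (1 - b j) ^+ k) / 2)%:C).
Proof.
elim: k => [|k IH].
  rewrite expr0 /fq big1 // => j _; rewrite !expr0 subrr mul0r scale0r addr0.
  by rewrite (_ : (1 + 1) / 2 = 1 :> R) ?rmorph1 ?scale1r //; field.
rewrite exprS IH (fqM clif); congr (fq _ _ _ _); apply: funext => j.
  by rewrite -[1]/(1%:C) -!rmorphM -rmorphD; congr (_%:C); rewrite !exprS; field.
by rewrite -[1]/(1%:C) -!rmorphM -rmorphD; congr (_%:C); rewrite !exprS; field.
Qed.

(** One factor of an eigenvalue: the spectrum of a frame state is a product distribution on sign
    patterns, [true] standing for the minus sign. *)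
Definition sgw lam (j : 'I_n) (e : bool) : R := (1 + (if e then - lam j else lam j)) / 2.

Lemma frame_state_moment lam k :
  \tr (frame_state F lam ^+ k) = (\sum_(s : {ffun 'I_n -> bool}) (\prod_j sgw lam j (s j)) ^+ k)%:C.
Proof.
have -> : frame_state F lam ^+ k =
   (2%:R ^- n ^+ k)%:C *: (fq (frm F) (enum 'I_n) (fun=> 1) (fun j => (lam j)%:C)) ^+ k.
  rewrite /frame_state; elim: k => [|k IH]; first by rewrite !expr0 scale1r.
  by rewrite !exprS IH mxZl mxZr scalerA rmorphM.
rewrite fq_power mxtraceZ (fq_trace clif) ?enum_uniq // big_enum /=.
under [in RHS]eq_bigr do rewrite -prodrXl.
rewrite -(bigA_distr_bigA (fun j e => sgw lam j e ^+ k)) /=.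
rewrite -(rmorph_nat (real_complex R)) -rmorph_prod -!rmorphM; congr (_%:C).
have -> : \prod_(j < n) \sum_(e : bool) sgw lam j e ^+ k =
          \prod_(j < n) (2%:R * (2%:R ^- k) * (((1 + lam j) ^+ k + (1 - lam j) ^+ k) / 2)).
  apply: eq_bigr => j _; rewrite big_bool /sgw !expr_div_n /=; field.
  by rewrite expf_neq0 // pnatr_eq0.
rewrite [RHS]big_split /= prodr_const card_ord exprMn natrX mulrA; congr (_ * _).
by rewrite mulrC -!exprVn -!exprM mulnC.
Qed.

Lemma sgw_ge0 lam j e : -1 <= lam j <= 1 -> 0 <= sgw lam j e.
Proof. by move=> /andP[h1 h2]; rewrite /sgw; case: e; lra. Qed.

(** The product rule for [eta] isolates one pair at a time; the two weights of every other pair sum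
    to 1. *)
Lemma frame_state_entropy lam : (forall j, -1 <= lam j <= 1) ->
  vN_entropy (frame_state F lam) = \sum_j binH ((1 + lam j) / 2).
Proof.
move=> hl; rewrite (entropy_moments (frame_state_herm lam) (frame_state_moment lam)).
have E (s : {ffun 'I_n -> bool}) := eta_prod (fun j => sgw_ge0 (s j) (hl j)).
under eq_bigr do rewrite E.
rewrite exchange_big /=; apply: eq_bigr => j _.
rewrite -(bigA_distr_bigA (fun i e => if i == j then eta (sgw lam i e) else sgw lam i e)) /=.
rewrite (bigD1 j) //= eqxx [X in _ * X]big1 ?mulr1 => [|i /negbTE ->].
  rewrite big_bool /= /binH /sgw [LHS]addrC; congr (_ + eta _); lra.
by rewrite big_bool /sgw /=; lra.
Qed.

(* [1 + lam T = (c + s T)^2] with [c^2 + s^2 = 1] and [2 c s = lam]. *)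
Lemma frame_state_psd lam : (forall j, -1 <= lam j <= 1) -> psd (frame_state F lam).
Proof.
move=> hl; apply: psdZ; first by rewrite invr_ge0 exprn_ge0 // ler0n.
pose c j := (Num.sqrt (1 + lam j) + Num.sqrt (1 - lam j)) / 2.
pose s j := (Num.sqrt (1 + lam j) - Num.sqrt (1 - lam j)) / 2.
have hs j : Num.sqrt (1 + lam j) ^+ 2 = 1 + lam j /\ Num.sqrt (1 - lam j) ^+ 2 = 1 - lam j.
  by have /andP[h1 h2] := hl j; split; rewrite sqr_sqrtr //; lra.
have -> : fq (frm F) (enum 'I_n) (fun=> 1) (fun j => (lam j)%:C) =
   fq (frm F) (enum 'I_n) (fun j => (c j)%:C) (fun j => (s j)%:C) *
   adjmx (fq (frm F) (enum 'I_n) (fun j => (c j)%:C) (fun j => (s j)%:C)).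
  rewrite fq_herm (fqM clif); congr (fq _ _ _ _); apply: funext => j.
    rewrite -[1]/(1%:C) -!rmorphM -rmorphD; congr (_%:C).
    have [e1 e2] := hs j; rewrite /c /s.
    rewrite (_ : _ + _ = (Num.sqrt (1 + lam j) ^+ 2 + Num.sqrt (1 - lam j) ^+ 2) / 2); last by field.
    by rewrite e1 e2; field.
  rewrite -!rmorphM -rmorphD; congr (_%:C).
  have [e1 e2] := hs j; rewrite /c /s.
  rewrite (_ : _ + _ = (Num.sqrt (1 + lam j) ^+ 2 - Num.sqrt (1 - lam j) ^+ 2) / 2); last by field.
  by rewrite e1 e2; field.
exact: psd_sqr.
Qed.

Lemma frame_state_density lam : (forall j, -1 <= lam j <= 1) -> density (frame_state F lam).
Proof. by move=> hl; split; [apply: frame_state_psd|apply: frame_state_trace]. Qed.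

End FrameEntropy.

(** * Weak log-majorization *)

Section Weyl.
Variable R : realType.
Implicit Types (x y : R) (s t : seq R).

Definition biasH x : R := binH ((1 + x) / 2).

Lemma biasHN x : biasH (- x) = biasH x.
Proof. by rewrite /biasH /binH addrC; congr (eta _ + eta _); field. Qed.

Lemma log2_half : log2 (2^-1 : R) = -1.
Proof. by have := @log2_powV R 1; rewrite expr1. Qed.

Lemma biasH_le1 x : -1 <= x <= 1 -> biasH x <= 1.
Proof.
move=> /andP[h1 h2]; rewrite /biasH /binH.
have a0 : 0 <= (1 + x) / 2 by lra.
have b0 : 0 <= 1 - (1 + x) / 2 by lra.
have c0 : (0 : R) < 2^-1 by rewrite invr_gt0.
have := lerD (eta_gibbs a0 c0) (eta_gibbs b0 c0); rewrite log2_half opprK !mulr1.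
move=> /le_trans; apply; rewrite le_eqVlt; apply/orP; left; apply/eqP.
by rewrite addrACA -mulrDl (_ : _ + (2^-1 - _) = 0) ?mul0r; lra.
Qed.

Lemma biasH0 : biasH 0 = 1.
Proof.
rewrite /biasH /binH /eta addr0 (_ : 1 - 1 / 2 = 2^-1 :> R); last by field.
by rewrite div1r log2_half; field.
Qed.

(** Minus the derivative of [biasH] in the variable [ln x]. Its monotonicity is the concavity of
    [biasH] in that variable, which is what log-majorization calls for. *)
Definition slope x : R := x * ((log2 ((1 + x) / 2) - log2 ((1 - x) / 2)) / 2).

Lemma log2_le x y : 0 < x -> x <= y -> log2 x <= log2 y.
Proof.
move=> x0 xy; rewrite /log2 ler_pM2r ?invr_gt0 ?ln2_gt0 //.
by rewrite ler_ln // posrE // (lt_le_trans x0).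
Qed.

Lemma slope_mono x y : 0 <= x -> x <= y -> y < 1 -> 0 <= slope x <= slope y.
Proof.
move=> x0 xy y1; rewrite /slope.
have h1 : log2 ((1 - x) / 2) <= log2 ((1 + x) / 2) by apply: log2_le; lra.
have h2 : log2 ((1 + x) / 2) <= log2 ((1 + y) / 2) by apply: log2_le; lra.
have h3 : log2 ((1 - y) / 2) <= log2 ((1 - x) / 2) by apply: log2_le; lra.
apply/andP; split; first by apply: mulr_ge0 => //; lra.
by apply: ler_pM => //; lra.
Qed.

(* Gibbs' inequality gives the tangent bound at [x], then [ln t <= t - 1]. *)
Lemma biasH_slope x y : 0 < x < 1 -> 0 < y <= 1 ->
  biasH y <= biasH x - slope x * (ln y - ln x).
Proof.
move=> /andP[x0 x1] /andP[y0 y1].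
have a0 : 0 <= (1 + y) / 2 by lra.
have b0 : 0 <= 1 - (1 + y) / 2 by lra.
have c0 : 0 < (1 + x) / 2 by lra.
have d0 : 0 < 1 - (1 + x) / 2 by lra.
have g := lerD (eta_gibbs a0 c0) (eta_gibbs b0 d0).
apply: (le_trans g).
have d1 : 1 - (1 + x) / 2 = (1 - x) / 2 by field.
rewrite /biasH /binH /eta /slope !d1.
set A := log2 ((1 + x) / 2); set B := log2 ((1 - x) / 2).
have AB : 0 <= (A - B) / 2 by have : B <= A by [apply: log2_le; lra]; lra.
have hl : x * (ln y - ln x) <= y - x.
  have := ln_le_sub1 (divr_gt0 y0 x0); rewrite ln_div // => h.
  have := ler_wpM2l (ltW x0) h; rewrite !mulrBr [x * (y / x)]mulrCA divff; last by lra.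
  by lra.
have := ler_wpM2l AB hl.
rewrite addrACA -mulrDl (_ : _ + ((1 - x) / 2 - _) = 0) ?mul0r; last by field.
move=> h; nra.
Qed.

(* Abel summation: [ln Q - ln P] is the slack accumulated over the entries already
   processed, and the slopes decrease along [s]. *)
Lemma weak_log_majorization_aux s t (P Q c : R) : size s = size t ->
  sorted (fun x y => y <= x) s -> all (fun x => 0 <= x < 1) s -> all (fun y => 0 <= y <= 1) t ->
  0 < P -> P <= Q -> 0 <= c -> (forall x, x \in s -> slope x <= c) ->
  (forall k, (k <= size s)%N ->
     P * \prod_(x <- take k s) x <= Q * \prod_(y <- take k t) y) ->
  \sum_(y <- t) biasH y <= \sum_(x <- s) biasH x + c * (ln Q - ln P).
Proof.
elim: s t P Q c => [|x s IH] [|y t] P Q c //=.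
  move=> _ _ _ _ P0 PQ c0 _ _; rewrite !big_nil add0r mulr_ge0 // subr_ge0.
  by rewrite ler_ln // posrE // (lt_le_trans P0).
move=> [hs] so /andP[/andP[x0 x1] s01] /andP[/andP[y0 y1] t01] P0 PQ c0 hc hp.
have Q0 : 0 < Q by apply: lt_le_trans PQ.
have PQl : 0 <= ln Q - ln P by rewrite subr_ge0 ler_ln.
have gs : all (fun z => z <= x) s.
  by apply: order_path_min so => a b d /= h1 h2; apply: le_trans h2 h1.
(* If the head of the decreasing list is 0, all of it is 0, and each entry contributes the maximal
   value [biasH 0 = 1]. *)
move: x0; rewrite le_eqVlt => /orP[/eqP x0|x0].
  have -> : \sum_(z <- x :: s) biasH z = (size (x :: s))%:R.
    rewrite -sum1_size natr_sum; apply: eq_big_seq => z; rewrite in_cons -x0 => /orP[/eqP ->|zs].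
      by rewrite biasH0.
    rewrite (_ : z = 0) ?biasH0 //; apply/eqP; rewrite eq_le; have := allP gs _ zs.
    by rewrite -x0 => ->; have /andP[-> _] := allP s01 _ zs.
  apply: (@le_trans _ _ (size (x :: s))%:R); last by rewrite lerDl mulr_ge0.
  rewrite /= hs -[(size t).+1]/(size (y :: t)) -sum1_size natr_sum big_seq [leRHS]big_seq.
  apply: ler_sum => z; rewrite in_cons => /orP[/eqP ->|zt]; apply: biasH_le1; first lra.
  by have /andP[] := allP t01 _ zt; lra.
have hk1 := hp 1%N isT; rewrite /= !take0 !big_seq1 in hk1.
have y0' : 0 < y by rewrite -(pmulr_rgt0 _ Q0); apply: lt_le_trans hk1; apply: mulr_gt0.
have hx := slope_mono (ltW x0) (lexx x) x1.
have := IH t (P * x) (Q * y) (slope x) hs (path_sorted so) s01 t01 (mulr_gt0 P0 x0) hk1.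
have /andP[sx0 _] := hx; move=> /(_ sx0) h.
have {h} h : \sum_(y <- t) biasH y <= \sum_(x <- s) biasH x + slope x * (ln (Q * y) - ln (P * x)).
  apply: h => [z zs|k ks].
    have zx := allP gs _ zs; have /andP[z0 _] := allP s01 _ zs.
    by have /andP[] := slope_mono z0 zx x1.
  by have := hp k.+1 ks; rewrite /= !big_cons !mulrA.
rewrite !big_cons !lnM ?posrE // in h *.
have hy : biasH y <= biasH x - slope x * (ln y - ln x) by apply: biasH_slope; rewrite ?x0 ?x1 ?y0' ?y1.
have hcx : slope x <= c by apply: hc; rewrite mem_head.
have hc2 := ler_wpM2r PQl hcx.
move: h hy hc2; rewrite !mulrBr !mulrDr; lra.
Qed.

(** The true slope is infinite at 1, so leading entries equal to 1 are peeled off first; the prefix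
    inequality forces the matching [y] to be 1 as well. The rest starts with [P = Q = 1], that is,
    without slack. *)
Lemma weak_log_majorization_seq s t : size s = size t ->
  sorted (fun x y => y <= x) s -> all (fun x => 0 <= x <= 1) s -> all (fun y => 0 <= y <= 1) t ->
  (forall k, (k <= size s)%N -> \prod_(x <- take k s) x <= \prod_(y <- take k t) y) ->
  \sum_(y <- t) biasH y <= \sum_(x <- s) biasH x.
Proof.
elim: s t => [|x s IH] [|y t] //=.
move=> [hs] so /andP[x01 s01] /andP[y01 t01] hp.
have gs : all (fun z => z <= x) s.
  by apply: order_path_min so => a b d /= h1 h2; apply: le_trans h2 h1.
have /andP[x0 x1] := x01; have /andP[y0 y1] := y01.
move: x1; rewrite le_eqVlt => /orP[/eqP x1|x1].
  have hk1 := hp 1%N isT; rewrite /= !take0 !big_seq1 in hk1.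
  have ey : y = 1 by apply/eqP; rewrite eq_le y1 -x1.
  rewrite !big_cons ey x1 lerD2l; apply: IH => // [|k ks]; first exact: path_sorted so.
  by have := hp k.+1 ks; rewrite /= !big_cons ey x1 !mul1r.
have /andP[sx0 _] := slope_mono x0 (lexx x) x1.
have s1 z : z \in s -> 0 <= z < 1.
  by move=> zs; have /andP[-> _] := allP s01 _ zs; apply: le_lt_trans x1; apply: (allP gs).
have := @weak_log_majorization_aux (x :: s) (y :: t) 1 1 (slope x); rewrite subrr mulr0 addr0; apply => //=.
- by rewrite hs.
- by rewrite x0 x1; apply/allP.
- by rewrite y01.
- move=> z; rewrite in_cons => /orP[/eqP -> //|zs].
  have /andP[z0 _] := s1 _ zs; have zx := allP gs _ zs.
  by have /andP[] := slope_mono z0 zx x1.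
- by move=> k ks; rewrite !mul1r; apply: hp.
Qed.

(** [biasH] is even, so [|mu|] may be sorted; the hypothesis on the sets of largest entries gives
    the prefix inequalities. *)
Lemma weak_log_majorization n (mu nu : 'I_n -> R) :
  (forall j, 0 <= nu j <= 1) -> (forall j, -1 <= mu j <= 1) ->
  (forall J : {set 'I_n}, `|\prod_(j in J) mu j| <= \prod_(i < n | (i < #|J|)%N) nu i) ->
  \sum_j biasH (nu j) <= \sum_j biasH (mu j).
Proof.
move=> nu01 mu01 hJ.
have -> : \sum_j biasH (mu j) = \sum_j biasH `|mu j|.
  by apply: eq_bigr => j _; case: ger0P => // _; rewrite biasHN.
pose r := fun i j : 'I_n => `|mu j| <= `|mu i|.
pose o := sort r (enum 'I_n).
have po : perm_eq o (enum 'I_n) by apply/permPl/perm_sort.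
have uo : uniq o by rewrite (perm_uniq po) enum_uniq.
have so : size o = n by rewrite (perm_size po) size_enum_ord.
have rt : total r by move=> i j; rewrite /r; apply: le_total.
have rtr : transitive r by move=> i j k h1 h2; apply: le_trans h2 h1.
have -> : \sum_j biasH `|mu j| = \sum_(x <- [seq `|mu j| | j <- o]) biasH x.
  by rewrite big_map (perm_big _ po) big_enum.
have -> : \sum_j biasH (nu j) = \sum_(y <- [seq nu j | j <- enum 'I_n]) biasH y.
  by rewrite big_map big_enum.
apply: weak_log_majorization_seq.
- by rewrite [LHS]size_map [RHS]size_map so size_enum_ord.
- by rewrite sorted_map; apply: sort_sorted.
- apply/allP => x /mapP[j _ ->]; rewrite normr_ge0 ler_norml; exact: mu01.
- by apply/allP => x /mapP[j _ ->].
move=> k; rewrite size_map so -!map_take !big_map => kn.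
pose J := [set j in take k o].
have cJ : #|J| = k.
  by rewrite cardsE; move/card_uniqP: (take_uniq k uo) => ->; rewrite size_take so; case: ltngtP kn.
have := hJ J; rewrite normr_prod cJ.
have -> : \prod_(j in J) `|mu j| = \prod_(j <- take k o) `|mu j|.
  rewrite [RHS]big_uniq ?take_uniq //=; apply: eq_bigl => j; by rewrite inE.
move=> /le_trans; apply; rewrite le_eqVlt; apply/orP; left; apply/eqP.
have ue : uniq (take k (enum 'I_n)) by apply: take_uniq; apply: enum_uniq.
rewrite -enumT [RHS](big_uniq _ ue); apply: eq_bigl => j /=.
by rewrite in_take ?mem_enum // index_enum_ord.
Qed.

End Weyl.

(** * Normal form of real antisymmetric matrices *)

Section Completion.
Variables (R : realType) (m : nat).

Lemma orth_extend r (A : 'M[R]_(r, m)) : A *m A^T = 1%:M -> (r < m)%N ->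
  exists u : 'rV[R]_m, u *m u^T = 1%:M /\ u *m A^T = 0.
Proof.
move=> hA rm.
have rk : (\rank (kermx A^T) > 0)%N.
  by rewrite mxrank_ker subn_gt0 (leq_ltn_trans _ rm) // rank_leq_col.
have [i hi] : exists i, row i (kermx A^T) != 0.
  apply/existsP; apply: contraTT rk => /existsPn h.
  rewrite -eqn0Ngt mxrank_eq0; apply/eqP/row_matrixP => i.
  by rewrite row0; apply/eqP; have := h i; rewrite negbK.
set v := row i _ in hi.
have vA : v *m A^T = 0 by rewrite -row_mul mulmx_ker row0.
have vvE : (v *m v^T) 0 0 = \sum_k v 0 k ^+ 2.
  by rewrite mxE; apply: eq_bigr => k _; rewrite [v^T _ _]mxE expr2.
have vv : 0 < (v *m v^T) 0 0.
  rewrite vvE lt0r sumr_ge0 ?andbT => [|k _]; last exact: sqr_ge0.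
  apply: contraNneq hi => h0; apply/eqP/rowP => k; rewrite [RHS]mxE; apply/eqP.
  move/eqP: h0; rewrite psumr_eq0 => [|l _]; last exact: sqr_ge0.
  by move=> /allP /(_ k); rewrite mem_index_enum => /(_ isT) /=; rewrite sqrf_eq0.
exists ((Num.sqrt ((v *m v^T) 0 0))^-1 *: v); split; last by rewrite -scalemxAl vA scaler0.
apply/matrixP => a b; rewrite !ord1 linearZ /= -scalemxAl -scalemxAr scalerA !mxE eqxx.
move: vv; rewrite mxE => vv; rewrite -invfM -expr2 sqr_sqrtr ?ltW // mulVf //.
exact: lt0r_neq0.
Qed.

Lemma orth_complete d r (A : 'M[R]_(r, m)) : A *m A^T = 1%:M -> (r + d = m)%N ->
  exists B : 'M[R]_m, B *m B^T = 1%:M /\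
    forall (i : 'I_r) (j : 'I_m), i = j :> nat -> row j B = row i A.
Proof.
elim: d r A => [|d IH] r A hA.
  rewrite addn0 => e; subst m; exists A; split=> // i j ij.
  by congr (row _ A); apply: val_inj.
move=> e; have rm : (r < m)%N by lia.
have [u [uu uA]] := orth_extend hA rm.
have hA' : col_mx A u *m (col_mx A u)^T = 1%:M.
  rewrite tr_col_mx mul_col_row hA uu uA (_ : A *m u^T = 0) ?scalar_mx_block //.
  by rewrite -[LHS]trmxK trmx_mul trmxK uA trmx0.
have [B [hB rB]] := IH (r + 1)%N (col_mx A u) hA' ltac:(lia).
exists B; split=> // i j ij; rewrite (rB (lshift 1 i) j ij).
exact: rowKu.
Qed.

Lemma Re_sum (I : finType) (z : I -> R[i]) :
  complex.Re (\sum_i z i) = \sum_i complex.Re (z i).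
Proof. by apply: (big_morph (@complex.Re R)) => // -[a b] [c d]. Qed.

Lemma Im_sum (I : finType) (z : I -> R[i]) :
  complex.Im (\sum_i z i) = \sum_i complex.Im (z i).
Proof. by apply: (big_morph (@complex.Im R)) => // -[a b] [c d]. Qed.

Lemma double_S_lt (a b : nat) : (a < b)%N -> ((2 * a).+1 < 2 * b)%N.
Proof. lia. Qed.

(** Together, unitarity and isotropy say that all real and imaginary parts of the rows are mutually
    orthogonal with squared norm one half. Scaled by the square root of 2 they are [2 s] orthonormal
    real rows, completed to a basis. *)
Lemma isotropic_frame s (W : 'M[R[i]]_(s, m)) :
  W *m (map_mx (@conjc R) W)^T = 1%:M -> W *m W^T = 0 ->
  (2 * s <= m)%N /\ exists G : 'M[R]_m, G *m G^T = 1%:M /\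
    forall (i : 'I_s) (p : 'I_m) k,
      (p = (2 * i)%N :> nat -> G p k = Num.sqrt 2 * complex.Re (W i k)) /\
      (p = (2 * i).+1 :> nat -> G p k = Num.sqrt 2 * complex.Im (W i k)).
Proof.
move=> hU hB; pose x (i : 'I_s) k := complex.Re (W i k); pose y (i : 'I_s) k := complex.Im (W i k).
have hUe i j : \sum_k W i k * (W j k)^* = (i == j)%:R.
  have := congr1 (fun Z : 'M_s => Z i j) hU; rewrite !mxE => <-.
  by apply: eq_bigr => k _; rewrite !mxE.
have hBe i j : \sum_k W i k * W j k = 0.
  have := congr1 (fun Z : 'M_s => Z i j) hB; rewrite !mxE => h; rewrite -[RHS]h.
  by apply: eq_bigr => k _; rewrite !mxE.
have d1 i j : \sum_k x i k * x j k + \sum_k y i k * y j k = (i == j)%:R.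
  have := congr1 (@complex.Re R) (hUe i j); rewrite Re_sum (_ : complex.Re (_%:R) = (i == j)%:R); last by case: (i == j).
  move=> <-; rewrite -big_split; apply: eq_bigr => k _ /=; rewrite /x /y.
  by case: (W i k) (W j k) => a b [a' b'] /=; ring.
have d2 i j : \sum_k y i k * x j k - \sum_k x i k * y j k = 0.
  rewrite -sumrB; have := congr1 (@complex.Im R) (hUe i j).
  rewrite Im_sum (_ : complex.Im (_%:R) = 0); last by case: (i == j).
  move=> h; rewrite -[RHS]h; apply: eq_bigr => k _ /=; rewrite /x /y.
  by case: (W i k) (W j k) => a b [a' b'] /=; ring.
have d3 i j : \sum_k x i k * x j k - \sum_k y i k * y j k = 0.
  rewrite -sumrB; have := congr1 (@complex.Re R) (hBe i j); rewrite Re_sum /= => h; rewrite -[RHS]h.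
  by apply: eq_bigr => k _ /=; rewrite /x /y; case: (W i k) (W j k) => a b [a' b'] /=; ring.
have d4 i j : \sum_k y i k * x j k + \sum_k x i k * y j k = 0.
  rewrite -big_split; have := congr1 (@complex.Im R) (hBe i j); rewrite Im_sum /= => h; rewrite -[RHS]h.
  by apply: eq_bigr => k _ /=; rewrite /x /y; case: (W i k) (W j k) => a b [a' b'] /=; ring.
pose jx (i : 'I_(2 * s)) : 'I_s := Ordinal (ltac:(have := ltn_ord i; lia) : (i./2 < s)%N).
pose A : 'M[R]_(2 * s, m) := \matrix_(i, k) (Num.sqrt 2 * (if odd i then y (jx i) k else x (jx i) k)).
have s2 : Num.sqrt (2 : R) * Num.sqrt 2 = 2 by rewrite -expr2 sqr_sqrtr.
have sumsc (f g : 'I_m -> R) : \sum_k (Num.sqrt 2 * f k) * (Num.sqrt 2 * g k) = 2 * \sum_k f k * g k.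
  by rewrite mulr_sumr; apply: eq_bigr => k _; rewrite mulrACA s2.
have hA : A *m A^T = 1%:M.
  apply/matrixP => i i'; rewrite !mxE; under eq_bigr do rewrite !mxE.
  have e1 := d1 (jx i) (jx i'); have e2 := d2 (jx i) (jx i').
  have e3 := d3 (jx i) (jx i'); have e4 := d4 (jx i) (jx i').
  rewrite -val_eqE /= in e1.
  have -> : (i == i') = (odd i == odd i') && (i./2 == i'./2).
    rewrite -val_eqE /=; apply/eqP/andP => [-> //|[/eqP o /eqP h]].
    by rewrite -[LHS]odd_double_half -[RHS]odd_double_half o h.
  by case: (odd i); case: (odd i') => /=; rewrite sumsc; lra.
have le2 : (2 * s <= m)%N := mulmx1_min hA; split=> //.
have [G [hG rG]] := orth_complete hA (subnKC le2).
exists G; split=> // i p k; split=> e.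
  have hi : (2 * i < 2 * s)%N by rewrite ltn_pmul2l.
  have := rG (Ordinal hi) p (esym e) => /(congr1 (fun Z : 'rV_m => Z 0 k)).
  rewrite [LHS]mxE [RHS]mxE => ->; rewrite mxE /= oddM /=; congr (_ * x _ k).
  by apply: val_inj; rewrite /= mul2n doubleK.
have hi : ((2 * i).+1 < 2 * s)%N by apply: double_S_lt.
have := rG (Ordinal hi) p (esym e) => /(congr1 (fun Z : 'rV_m => Z 0 k)).
rewrite [LHS]mxE [RHS]mxE => ->; rewrite mxE /= oddM /=; congr (_ * y _ k).
by apply: val_inj; rewrite /= mul2n /= uphalf_double.
Qed.

End Completion.

Section AntisymNormalForm.
Variables (R : realType) (n : nat).
Local Notation C := (R[i]).
Local Notation m := (2 * n).+1.
Local Notation "x %:C" := (real_complex R x).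
Local Notation re := (@complex.Re R).
Local Notation im := (@complex.Im R).
Implicit Types (K G : 'M[R]_m).

Lemma double_leS (a b : nat) : (2 * a <= (2 * b).+1)%N -> (2 * a <= 2 * b)%N.
Proof. lia. Qed.

(** [i K] is Hermitian, and its eigenvectors of positive eigenvalue span an isotropic space.
    [isotropic_frame] turns them into real planes on which [K] acts by one block each; [K] vanishes
    on the remaining rows. *)
Lemma antisym_normal K : K^T = - K ->
  exists (G : 'M[R]_m) (mu : 'I_n -> R), G *m G^T = 1%:M /\ K = G^T *m lamx mu *m G.
Proof.
move=> hK; have Kij i j : K j i = - K i j by have := congr1 (fun Z : 'M_m => Z i j) hK; rewrite !mxE.
pose H : 'M[C]_m := \matrix_(i, j) ('i * (K i j)%:C).
have biasH : (map_mx (@conjc R) H)^T = H.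
  apply/matrixP => i j; rewrite !mxE Kij; apply/eqP; rewrite eq_complex /=.
  by apply/andP; split; apply/eqP; ring.
have [V [d [hV eH]]] := herm_spectral biasH.
(* [w l] is a left eigenvector of [H], the conjugate of column [l] of [V]. *)
pose w l k : C := (V k l)^*.
have hW : (map_mx (@conjc R) V)^T *m V = 1%:M by apply: mulmx1C.
have worth l j : \sum_k w l k * (w j k)^* = (l == j)%:R.
  have := congr1 (fun Z : 'M_m => Z l j) hW; rewrite !mxE => <-.
  by apply: eq_bigr => k _; rewrite !mxE /w; congr (_ * _); apply: conjcK.
have weig l k : \sum_j w l j * H j k = (d l)%:C * w l k.
  have h : (map_mx (@conjc R) V)^T *m H = diag_mx (\row_i (d i)%:C) *m (map_mx (@conjc R) V)^T.
    by rewrite eH !mulmxA hW mul1mx.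
  have := congr1 (fun Z : 'M_m => Z l k) h; rewrite mul_diag_mx !mxE => <-.
  by apply: eq_bigr => j _; rewrite !mxE.
pose x l k := re (w l k); pose y l k := im (w l k).
have xK l k : \sum_j x l j * K j k = d l * y l k.
  have := congr1 im (weig l k); rewrite Im_sum (_ : im (_ * _) = d l * y l k); last first.
    by rewrite /y; case: (w l k) => a b /=; ring.
  move=> <-; apply: eq_bigr => j _; rewrite /x mxE; case: (w l j) => a b /=; ring.
have yK l k : \sum_j y l j * K j k = - (d l * x l k).
  have := congr1 re (weig l k); rewrite Re_sum (_ : re (_ * _) = d l * x l k); last first.
    by rewrite /x; case: (w l k) => a b /=; ring.
  move=> <-; rewrite -sumrN; apply: eq_bigr => j _; rewrite /y mxE; case: (w l j) => a b /=; ring.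
have d1 l j : \sum_k (x l k * x j k) + \sum_k (y l k * y j k) = (l == j)%:R.
  have := congr1 re (worth l j); rewrite Re_sum (_ : re (_%:R) = (l == j)%:R); last by case: (l == j).
  move=> <-; rewrite -big_split; apply: eq_bigr => k _ /=; rewrite /x /y.
  by case: (w l k) (w j k) => a b [a' b'] /=; ring.
have d2 l j : \sum_k (y l k * x j k) = \sum_k (x l k * y j k).
  apply/eqP; rewrite -subr_eq0 -sumrB; apply/eqP.
  have := congr1 im (worth l j); rewrite Im_sum (_ : im (_%:R) = 0); last by case: (l == j).
  move=> h; rewrite -[RHS]h; apply: eq_bigr => k _ /=; rewrite /x /y.
  by case: (w l k) (w j k) => a b [a' b'] /=; ring.
(* The conjugate of [w j] has eigenvalue [- d j], which differs from [d l], so the two are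
   orthogonal: moving [K] across the sums shows that [d l + d j] times the bilinear product is 0. *)
have bil l j : 0 < d l -> 0 < d j ->
    (\sum_k x l k * x j k = \sum_k y l k * y j k) /\ (\sum_k x l k * y j k = - \sum_k y l k * x j k).
  move=> dl dj.
  have exch (f g : 'I_m -> R) : \sum_k (\sum_i f i * K i k) * g k = - \sum_k f k * (\sum_i g i * K i k).
    under eq_bigr do rewrite mulr_suml.
    rewrite exchange_big -sumrN /=; apply: eq_bigr => i _.
    rewrite mulr_sumr -sumrN; apply: eq_bigr => k _; rewrite (Kij k i); ring.
  have E1 : d l * \sum_k y l k * y j k = d j * \sum_k x l k * x j k.
    rewrite !mulr_sumr; have := exch (x l) (y j).
    under eq_bigr do rewrite xK; under [in RHS]eq_bigr do rewrite yK.
    rewrite -sumrN; under eq_bigr do rewrite -mulrA.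
    by move=> ->; apply: eq_bigr => k _; ring.
  have E2 : d l * \sum_k x l k * x j k = d j * \sum_k y l k * y j k.
    rewrite !mulr_sumr; have := exch (y l) (x j).
    under eq_bigr do rewrite yK; under [in RHS]eq_bigr do rewrite xK.
    rewrite -sumrN => h; apply: oppr_inj; rewrite -!sumrN.
    under eq_bigr do rewrite mulrA -mulNr.
    by rewrite h; apply: eq_bigr => k _; ring.
  have E3 : d l * \sum_k y l k * x j k = - (d j * \sum_k x l k * y j k).
    rewrite !mulr_sumr; have := exch (x l) (x j).
    under eq_bigr do rewrite xK; under [in RHS]eq_bigr do rewrite xK.
    rewrite -!sumrN; under eq_bigr do rewrite -mulrA.
    by move=> ->; apply: eq_bigr => k _; ring.
  have D2 := d2 l j.
  split.
    have : (d l + d j) * (\sum_k x l k * x j k - \sum_k y l k * y j k) = 0.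
      by rewrite mulrDl !mulrBr E1 E2; ring.
    move/eqP; rewrite mulf_eq0 => /orP[/eqP h|/eqP/subr0_eq //]; lra.
  have : (d l + d j) * (\sum_k x l k * y j k + \sum_k y l k * x j k) = 0.
    rewrite D2 in E3 *; lra.
  move/eqP; rewrite mulf_eq0 => /orP[/eqP h|/eqP/eqP]; first lra.
  by rewrite addr_eq0 => /eqP.
(* [g H g^* = 0] because [K] is antisymmetric and [g] real, whereas only the
   nonpositive eigenvalues contribute to it when [g] is orthogonal to the others. *)
have ker (g : 'rV[R]_m) : (forall j, 0 < d j -> \sum_k g 0 k * x j k = 0) ->
    (forall j, 0 < d j -> \sum_k g 0 k * y j k = 0) -> g *m K = 0.
  move=> gx gy; pose gC : 'rV[C]_m := map_mx (real_complex R) g; pose c := gC *m V.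
  have cE l : c 0 l = \sum_k (g 0 k)%:C * (w l k)^*.
    by rewrite mxE; apply: eq_bigr => k _; rewrite mxE /w; congr (_ * _); apply/esym/conjcK.
  have c0 l : 0 < d l -> c 0 l = 0.
    move=> dl; rewrite cE; apply/eqP; rewrite eq_complex /= Re_sum Im_sum.
    apply/andP; split; apply/eqP.
      rewrite -[RHS](gx l dl); apply: eq_bigr => k _; rewrite /x; case: (w l k) => a b /=; ring.
    rewrite -[RHS]oppr0 -[in RHS](gy l dl) -sumrN; apply: eq_bigr => k _.
    rewrite /y; case: (w l k) => a b /=; ring.
  have s0 : \sum_l d l * nsq (c 0 l) = 0.
    have : (gC *m H *m gC^T) 0 0 = 0.
      have -> : (gC *m H *m gC^T) 0 0 = 'i * (\sum_i \sum_j g 0 i * K i j * g 0 j)%:C.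
        rewrite -mulmxA mxE rmorph_sum mulr_sumr; apply: eq_bigr => i _.
        rewrite !mxE rmorph_sum !mulr_sumr; apply: eq_bigr => j _.
        by rewrite !mxE !rmorphM /=; ring.
      suff -> : \sum_i \sum_j g 0 i * K i j * g 0 j = 0 by rewrite mulr0.
      set z := \sum_i _; suff : z = - z by lra.
      rewrite {1}/z exchange_big -sumrN; apply: eq_bigr => i _.
      by rewrite -sumrN; apply: eq_bigr => j _; rewrite (Kij i j); ring.
    rewrite eH !mulmxA -(mulmxA _ _ gC^T) -/c mul_mx_diag mxE => h.
    apply: real_complex_inj; rewrite rmorph0 -[RHS]h rmorph_sum; apply: eq_bigr => l _.
    have cc : (((map_mx (@conjc R) V)^T) *m gC^T) l 0 = (c 0 l)^*.
      rewrite !mxE rmorph_sum; apply: eq_bigr => k _.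
      by rewrite rmorphM /= [gC 0 k]mxE conj_real mulrC [in RHS]mulrC !mxE mulrC.
    rewrite rmorphM /= nsqE cc [X in _ = X * _]mxE [X in _ = _ * X * _]mxE; ring.
  have z0 l : d l * nsq (c 0 l) = 0.
    have : \sum_l - (d l * nsq (c 0 l)) = 0 by rewrite sumrN s0 oppr0.
    move/eqP; rewrite psumr_eq0 => [/allP /(_ l)|j _]; last first.
      have [dj|dj] := ltP 0 (d j); first by rewrite c0 // /nsq /= expr0n addr0 mulr0 oppr0.
      by rewrite oppr_ge0 mulr_le0_ge0 // nsq_ge0.
    by rewrite mem_index_enum => /(_ isT) /=; rewrite oppr_eq0 => /eqP.
  have gH : gC *m H = 0.
    rewrite eH !mulmxA -/c mul_mx_diag (_ : \matrix_(i, j) _ = 0) ?mul0mx //.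
    apply/matrixP => i l; rewrite !ord1 !mxE -/(c 0 l).
    have := z0 l => /eqP; rewrite mulf_eq0 => /orP[/eqP ->|]; first by rewrite rmorph0 mulr0.
    move=> /eqP hc; suff -> : \sum_j gC 0 j * V j l = 0 by rewrite mul0r.
    have : `|c 0 l| ^+ 2 = 0 by rewrite normCK mulrC -nsqE hc rmorph0.
    by move/eqP; rewrite sqrf_eq0 normr_eq0 => /eqP; rewrite mxE.
  apply/rowP => k; rewrite [RHS]mxE.
  have := congr1 (fun Z : 'rV[C]_m => im (Z 0 k)) gH; rewrite !mxE Im_sum /= => h.
  rewrite -[RHS]h; apply: eq_bigr => i _; rewrite !mxE /=; ring.
pose S := [set j | 0 < d j].
pose W0 : 'M[C]_(#|S|, m) := \matrix_(i, k) w (enum_val i) k.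
have Spos (i : 'I_#|S|) : 0 < d (enum_val i) by have := enum_valP i; rewrite inE.
have hW0 : W0 *m (map_mx (@conjc R) W0)^T = 1%:M.
  apply/matrixP => i j; rewrite [RHS]mxE -(inj_eq enum_val_inj) -worth mxE.
  by apply: eq_bigr => k _; rewrite !mxE.
have hB0 : W0 *m W0^T = 0.
  apply/matrixP => i j; rewrite !mxE; apply/eqP.
  have [b1 b2] := bil _ _ (Spos i) (Spos j).
  under eq_bigr do rewrite !mxE.
  rewrite eq_complex /= Re_sum Im_sum; apply/andP; split; apply/eqP.
    rewrite (_ : \sum_i _ = \sum_k x (enum_val i) k * x (enum_val j) k - \sum_k y (enum_val i) k * y (enum_val j) k).
      by rewrite b1 subrr.
    rewrite -sumrB; apply: eq_bigr => k _; rewrite /x /y.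
    by case: (w (enum_val i) k) (w (enum_val j) k) => a b [a' b'] /=.
  rewrite (_ : \sum_i _ = \sum_k x (enum_val i) k * y (enum_val j) k + \sum_k y (enum_val i) k * x (enum_val j) k).
    by rewrite b2 addNr.
  rewrite -big_split; apply: eq_bigr => k _; rewrite /x /y.
  by case: (w (enum_val i) k) (w (enum_val j) k) => a b [a' b'] /=.
have [le2 [G [hG rG]]] := isotropic_frame hW0 hB0.
have GE (t : 'I_#|S|) (p : 'I_m) k : p = (2 * t)%N :> nat -> G p k = Num.sqrt 2 * x (enum_val t) k.
  by move=> e; have [-> //] := rG t p k; rewrite mxE.
have GO (t : 'I_#|S|) (p : 'I_m) k : p = (2 * t).+1 :> nat -> G p k = Num.sqrt 2 * y (enum_val t) k.
  by move=> e; have [_ -> //] := rG t p k; rewrite mxE.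
(* Indices beyond the number of positive eigenvalues get 0, matching the rows of [G] that [K]
   kills. *)
pose mu (k : 'I_n) : R := if insub (k : nat) is Some j then d (enum_val (j : 'I_#|S|)) else 0.
exists G, mu; split=> //.
suff GK : G *m K = lamx mu *m G by rewrite -mulmxA -GK mulmxA (mulmx1C hG) mul1mx.
have rowlam (p q : 'I_m) (a : R) : (forall q', lamx mu p q' = if q' == q then a else 0) ->
    row p (lamx mu *m G) = a *: row q G.
  move=> h; apply/rowP => k; rewrite !mxE (bigD1 q) //= h eqxx big1 ?addr0 // => q' /negbTE hq.
  by rewrite h hq mul0r.
have tailK (p : 'I_m) : (2 * #|S| <= p)%N -> row p G *m K = 0.
  move=> hp; have orth (q : 'I_m) : (q < 2 * #|S|)%N -> \sum_k G p k * G q k = 0.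
    move=> hq; have := congr1 (fun Z : 'M_m => Z p q) hG; rewrite !mxE.
    rewrite (_ : (p == q) = false) => [h|].
      by rewrite -[RHS]h; apply: eq_bigr => k _; rewrite [in RHS]mxE.
    by apply/negP => /eqP pq; move: hp; rewrite pq leqNgt hq.
  have s20 : Num.sqrt (2 : R) != 0 by rewrite sqrtr_eq0 -ltNge.
  have fin (f : 'I_m -> R) : \sum_k G p k * (Num.sqrt 2 * f k) = 0 -> \sum_k (row p G) 0 k * f k = 0.
    under eq_bigr do rewrite mulrCA.
    rewrite -mulr_sumr => /eqP; rewrite mulf_eq0 (negbTE s20) => /eqP h; rewrite -[RHS]h.
    by apply: eq_bigr => k _; rewrite mxE.
  apply: ker => j dj; apply: fin; have jS : j \in S by rewrite inE.
    pose t := enum_rank_in jS j.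
    have hi : (2 * t < 2 * #|S|)%N by rewrite ltn_pmul2l.
    have him := leq_trans hi le2.
    rewrite -[RHS](orth (Ordinal him)) //; apply: eq_bigr => k _.
    by rewrite [G (Ordinal him) k](GE t) // /t enum_rankK_in.
  pose t := enum_rank_in jS j.
  have hi : ((2 * t).+1 < 2 * #|S|)%N by apply: double_S_lt.
  have him := leq_trans hi le2.
  rewrite -[RHS](orth (Ordinal him)) //; apply: eq_bigr => k _.
  by rewrite [G (Ordinal him) k](GO t) // /t enum_rankK_in.
have muge (k : 'I_n) : (#|S| <= k)%N -> mu k = 0 by move=> h; rewrite /mu insubF // ltnNge h.
have hrow (k : 'I_n) : (k < #|S|)%N -> exists j, [/\ mu k = d j,
    forall c, G (pe k) c = Num.sqrt 2 * x j c & forall c, G (po k) c = Num.sqrt 2 * y j c].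
  move=> ks; exists (enum_val (Ordinal ks)); split; first by rewrite /mu insubT.
    by move=> c; apply: GE; rewrite val_pe.
  by move=> c; apply: GO; rewrite val_po.
apply/row_matrixP => p; rewrite row_mul; case: (pairP p) => [k ->|k ->|->].
- rewrite (rowlam _ (po k) (mu k)); last by move=> q; rewrite lamx_pe.
  have [ks|ks] := ltnP k #|S|; last by rewrite muge // scale0r tailK // val_pe leq_mul2l.
  have [j [-> hx hy]] := hrow k ks; apply/rowP => c; rewrite !mxE hy mulrCA -xK mulr_sumr.
  by apply: eq_bigr => i _; rewrite mxE hx mulrA.
- rewrite (rowlam _ (pe k) (- mu k)); last by move=> q; rewrite lamx_po.
  have [ks|ks] := ltnP k #|S|; last by rewrite muge // oppr0 scale0r tailK // val_po; lia.
  have [j [-> hx hy]] := hrow k ks; apply/rowP => c; rewrite !mxE hx mulrCA mulNr -yK mulr_sumr.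
  by apply: eq_bigr => i _; rewrite mxE hy mulrA.
- rewrite (rowlam _ ord_max 0); last by move=> q; rewrite lamx_max if_same.
  by rewrite scale0r; apply: tailK; apply: double_leS.
Qed.

End AntisymNormalForm.

(** * Log-majorization of the output spectrum *)

Section LogMajorization.
Variables (R : realType) (n : nat).
Local Notation C := (R[i]).
Local Notation N := (2 ^ n)%N.
Local Notation Mat := 'M[C]_N.
Local Notation m := (2 * n).+1.
Local Notation "x %:C" := (real_complex R x).
Local Notation gam := (@gam R n).
Implicit Types (p q r : 'I_m) (X Y : Mat) (F G K : 'M[R]_m) (J : {set 'I_n}).

Lemma sum_pairs (V : nmodType) (f : 'I_m -> V) :
  \sum_p f p = f ord_max + \sum_k (f (pe k) + f (po k)).
Proof.
rewrite (bigD1_ord ord_max) //=; congr (_ + _).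
pose h (z : 'I_n * bool) : 'I_(2 * n) := if z.2 then od z.1 else ev z.1.
have hb : bijective h.
  apply: inj_card_bij; last by rewrite card_prod card_bool !card_ord mulnC.
  move=> [k e] [l e'] /(congr1 (@nat_of_ord _)); rewrite /h.
  case: e e' => [] [] /= kl; (have -> : k = l by apply: val_inj => /=; lia) => //; lia.
rewrite (reindex h) /=; last exact: onW_bij.
rewrite -(pair_bigA _ (fun k e => f (wid (h (k, e))))) /=.
by apply: eq_bigr => k _; rewrite big_bool addrC.
Qed.

Lemma card_sum_sign (T : finType) (P : pred T) :
  \sum_t (-1) ^+ P t = #|T|%:R - 2 * #|P|%:R :> C.
Proof.
rewrite -!sum1_card !natr_sum [in X in _ - 2 * X]big_mkcond mulr_sumr -sumrB.
by apply: eq_bigr => t _; rewrite unfold_in; case: (P t); rewrite ?expr0 ?expr1; ring.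
Qed.

(* [deg] is invariant under orthogonal changes of frame and acts on a product of
   [k] distinct generators, [k] even, by the scalar [2n + 1 - 2k]. *)
Definition deg X : Mat := \sum_p gam p * X * gam p.

Lemma deg_frame F X : F *m F^T = 1%:M -> \sum_p frm F p * X * frm F p = deg X.
Proof.
move=> hF; have hF' : F^T *m F = 1%:M by apply: mulmx1C.
have -> : \sum_p frm F p * X * frm F p =
   \sum_p \sum_q \sum_r ((F p q)%:C * (F p r)%:C) *: (gam q * X * gam r).
  apply: eq_bigr => p _; rewrite /frm mulr_suml mulr_suml; apply: eq_bigr => q _.
  by rewrite mulr_sumr; apply: eq_bigr => r _; rewrite !mxZl mxZr scalerA.
rewrite exchange_big /deg /=; apply: eq_bigr => q _; rewrite exchange_big /= (bigD1 q) //=.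
have e r : \sum_p ((F p q)%:C * (F p r)%:C) *: (gam q * X * gam r) = (q == r)%:R *: (gam q * X * gam r).
  rewrite -scaler_suml; congr (_ *: _).
  have := congr1 (fun Z : 'M_m => (Z q r)%:C) hF'; rewrite !mxE rmorph_nat => <-.
  by rewrite rmorph_sum; apply: eq_bigr => p _; rewrite mxE rmorphM.
rewrite e eqxx scale1r big1 ?addr0 // => r rq.
by rewrite e eq_sym (negbTE rq) scale0r.
Qed.

(** The product of the involutions over [J], written with coefficients 0 and 1 so that the rules for
    [fq] apply. *)
Definition ftJ F J : Mat :=
  fq (frm F) (enum 'I_n) (fun j => ((j \notin J)%:R)%:C) (fun j => ((j \in J)%:R)%:C).

Lemma ftJ_herm F J : F *m F^T = 1%:M -> adjmx (ftJ F J) = ftJ F J.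
Proof. by move=> hF; apply: fq_herm. Qed.

Lemma ftJ_sq F J : F *m F^T = 1%:M -> ftJ F J * ftJ F J = 1.
Proof.
move=> hF; rewrite /ftJ (fqM (frm_clif hF)) /fq big1 // => j _.
by case: (j \in J) => /=; rewrite !(mulr0, mulr1, mul0r, addr0, add0r) scale1r scale0r addr0.
Qed.

Lemma ftJ_trace F J lam : F *m F^T = 1%:M -> \tr (frame_state F lam * ftJ F J) = (\prod_(j in J) lam j)%:C.
Proof.
move=> hF; rewrite /frame_state /ftJ mxZl (fqM (frm_clif hF)) mxtraceZ (fq_trace (frm_clif hF)) ?enum_uniq //.
rewrite mulrA inv2X mul1r big_enum /= rmorph_prod [RHS]big_mkcond.
by apply: eq_bigr => j _; case: (j \in J); rewrite /= ?(rmorph0, rmorph1) !mul1r ?mulr1 ?mulr0 ?add0r ?addr0.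
Qed.

Lemma prod_enum_ord (f : 'I_n -> Mat) : \prod_(k <- enum 'I_n) f k = \prod_k f k.
Proof. by rewrite enumT /index_enum; case: index_enum_key. Qed.

Definition pairset J : pred 'I_m := fun p => [exists k in J, (p == pe k) || (p == po k)].

Lemma frm_ftJ F J p : F *m F^T = 1%:M ->
  frm F p * ftJ F J * frm F p = (-1) ^+ pairset J p *: ftJ F J.
Proof.
move=> /frm_clif hF.
suff -> : frm F p * ftJ F J = (-1) ^+ pairset J p *: (ftJ F J * frm F p).
  by rewrite mxZl -mulrA (frame_sq hF) mulr1.
have comm_fac j : frm F p * ft (frm F) j =
    (-1) ^+ ((p == pe j) || (p == po j)) *: (ft (frm F) j * frm F p).
  have [->|h1] := eqVneq p (pe j); first by rewrite expr1 (pe_ft hF) (ft_pe hF) scaleN1r scaleNr.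
  have [->|h2] := eqVneq p (po j); first by rewrite expr1 (po_ft hF) (ft_po hF) scaleN1r scaleNr opprK.
  by rewrite expr0 scale1r (ft_comm hF).
rewrite /ftJ /fq !prod_enum_ord.
rewrite (@sign_prod_comm _ _ _ _ _ (fun j => (j \in J) && ((p == pe j) || (p == po j)))); last first.
  move=> j; case: (j \in J); rewrite /= ?rmorph0 ?rmorph1 ?scale0r ?scale1r ?add0r ?addr0 ?mulr1 ?mul1r ?expr0 ?scale1r //.
congr (_ ^+ (nat_of_bool _) *: _).
rewrite /pairset; apply/idP/existsP => [h|[k /andP[kJ hk]]].
  apply/existsP; apply: contraTT h => /existsPn h.
  by rewrite big1 // => j _; apply/negbTE/h.
rewrite (bigD1 k) //= kJ hk big1 // => j jk.
have -> : (p == pe j) || (p == po j) = false.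
  by apply/negbTE; case/orP: hk => /eqP ->; rewrite !pairE eq_sym (negbTE jk).
by rewrite andbF.
Qed.

Lemma sum_pairset J :
  \sum_p (-1) ^+ pairset J p = m%:R - 2 * (2 * #|J|)%N%:R :> C.
Proof.
rewrite sum_pairs (_ : pairset J ord_max = false); last first.
  by apply/negbTE/existsPn => k; rewrite ![ord_max == _]eq_sym !pairE andbF.
have e1 k : pairset J (pe k) = (k \in J).
  apply/existsP/idP => [[l]|kJ]; last by exists k; rewrite kJ eqxx.
  by rewrite !pairE orbF => /andP[lJ /eqP ->].
have e2 k : pairset J (po k) = (k \in J).
  apply/existsP/idP => [[l]|kJ]; last by exists k; rewrite kJ eqxx orbT.
  by rewrite !pairE /= => /andP[lJ /eqP ->].
under eq_bigr => k _ do rewrite e1 e2.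
have := card_sum_sign (mem J); rewrite card_ord big_split /= => ->.
by rewrite -natr1 !natrM; ring.
Qed.

Lemma deg_ftJ F J : F *m F^T = 1%:M ->
  deg (ftJ F J) = (m%:R - 2 * (2 * #|J|)%N%:R) *: ftJ F J.
Proof.
move=> hF; rewrite -(deg_frame _ hF); under eq_bigr => p _ do rewrite frm_ftJ //.
by rewrite -scaler_suml sum_pairset.
Qed.

Lemma deg_mono x : deg (mono R x) = (m%:R - 2 * #|ext x|%:R) *: mono R x.
Proof.
rewrite /deg; under eq_bigr => p _ do rewrite conj_mono.
by rewrite -scaler_suml card_sum_sign card_ord.
Qed.

(** An eigenvector of [deg] has no component on monomials of another degree. Products in a rotated
    frame are thus handled without expanding them. *)
Lemma degree_ext X k (f g : {linear Mat -> Mat}) :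
  deg X = (m%:R - 2 * k%:R) *: X ->
  (forall x, #|ext x : pred 'I_m| = k -> f (mono R x) = g (mono R x)) -> f X = g X.
Proof.
have [a ->] := mono_span X => hd h; rewrite !linear_sum; apply: eq_bigr => x _; rewrite !linearZ.
have [e|ne] := eqVneq #|ext x : pred 'I_m| k; first by rewrite h.
suff -> : a x = 0 by rewrite /= !scale0r.
have : \sum_x (a x * (2 * (#|ext x : pred 'I_m|%:R - k%:R))) *: mono R x = 0.
  have -> : \sum_x (a x * (2 * (#|ext x : pred 'I_m|%:R - k%:R))) *: mono R x =
     (m%:R - 2 * k%:R) *: (\sum_x a x *: mono R x) - deg (\sum_x a x *: mono R x).
    have -> : deg (\sum_x a x *: mono R x) = \sum_x a x *: deg (mono R x).
      rewrite /deg; under eq_bigr do rewrite mulr_sumr mulr_suml.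
      rewrite exchange_big; apply: eq_bigr => y _; rewrite scaler_sumr.
      by apply: eq_bigr => p _; rewrite mxZr mxZl.
    rewrite scaler_sumr -sumrB; apply: eq_bigr => y _; rewrite deg_mono !scalerA -scalerBl.
    by congr (_ *: _); ring.
  by rewrite hd subrr.
move=> /mono_coef_eq0 /(_ x) /eqP; rewrite !mulf_eq0 pnatr_eq0 /= subr_eq0 eqr_nat (negbTE ne) orbF.
by move/eqP.
Qed.

(** Since [(1 + T)^2 = 2 (1 + T)], the number [1 + tr (rho T)] is half the trace of the positive
    matrix [(1 + T) rho (1 + T)]; likewise for [- T]. Positivity also makes the trace real. *)
Lemma trace_involution (rho T : Mat) : density rho -> adjmx T = T -> T * T = 1 ->
  exists2 x : R, \tr (rho * T) = x%:C & -1 <= x <= 1.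
Proof.
move=> [hp ht] hT TT.
have tr1 (s : bool) : 0 <= 1 + (-1) ^+ s * \tr (rho * T).
  have adjE : adjmx (1 + (-1) ^+ s *: T) = 1 + (-1) ^+ s *: T.
    by rewrite adjmxD adjmx1 adjmxZ hT rmorphXn rmorphN1.
  have := psd_trace_ge0 (psd_conj (1 + (-1) ^+ s *: T) hp).
  rewrite adjE [\tr (_ * rho * _)]mxtraceM mulrA.
  have -> : (1 + (-1) ^+ s *: T) * (1 + (-1) ^+ s *: T) = 2%:R *: (1 + (-1) ^+ s *: T).
    rewrite mulrDr mulr1 mulrDl mul1r mxZl mxZr TT scalerA -expr2 sqrr_sign scale1r.
    by rewrite scaler_nat mulr2n [X in _ + X = _]addrC.
  rewrite mxZl mxtraceZ [(_ + _) * rho]mulrDl mul1r mxZl mxtraceD mxtraceZ ht [\tr (T * _)]mxtraceM.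
  by rewrite pmulr_rge0 // ltr0n.
have im0 : complex.Im (\tr (rho * T)) = 0.
  have := tr1 false; rewrite expr0 mul1r; case: (\tr _) => a b; rewrite lecE /=.
  by move=> /andP[/eqP]; rewrite add0r.
exists (complex.Re (\tr (rho * T))).
  by move: im0; case: (\tr _) => a b /= ->.
have h0 := tr1 false; have h1 := tr1 true.
move: im0 h0 h1; case: (\tr _) => a b /= ->; rewrite expr0 expr1 mul1r mulN1r !lecE /=.
by move=> /andP[_ h0] /andP[_ h1]; lra.
Qed.

Lemma gam_density rho p : density rho -> density (gam p * rho * gam p).
Proof.
case=> hp ht; split; first by have := psd_conj (gam p) hp; rewrite gam_herm.
by rewrite mxtraceM mulrA gam_sq mul1r.
Qed.

(** The conjugations are moved onto [rho], which stays a density matrix; the signs of [u] and [v] do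
    not matter, only the sum of their moduli. *)
Lemma chan_involution s (u v : 'I_m -> R) (rho T : Mat) :
  (forall p, `|u p| + `|v p| <= 1) ->
  density rho -> adjmx T = T -> T * T = 1 ->
  exists2 x : R, \tr (rho * chan s u v T) = x%:C & `|x| <= 1.
Proof.
move=> huv hr hT TT; elim: s rho hr => [|p s IH] rho hr /=.
  by have [x -> hx] := trace_involution hr hT TT; exists x => //; rewrite ler_norml.
have [x hx x1] := IH _ hr; have [y hy y1] := IH _ (gam_density p hr).
exists (u p * x + v p * y).
  rewrite /attenuate mulrDr !mxZr mxtraceD !mxtraceZ hx.
  by rewrite 2!mulrA mxtraceM 2!mulrA hy -!rmorphM -rmorphD.
apply: le_trans (ler_normD _ _) _; rewrite !normrM; apply: le_trans (huv p).
by apply: lerD; rewrite ler_piMr.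
Qed.

End LogMajorization.

(** * Bounds on the channel by degree, and the output entropy *)

Section OutputEntropy.
Variables (R : realType) (n : nat) (b : 'I_(2 * n) -> R).
Hypothesis b01 : forall p, 0 <= b p <= 1.
Local Notation C := (R[i]).
Local Notation N := (2 ^ n)%N.
Local Notation Mat := 'M[C]_N.
Local Notation m := (2 * n).+1.
Local Notation "x %:C" := (real_complex R x).
Local Notation B := (bcoef b).
Implicit Types (p r : 'I_m) (X Y : Mat) (F G K : 'M[R]_m) (J : {set 'I_n}).

(** The entries of [B] in decreasing order. The leading 1 belongs to the parity, so position [j]
    holds the [j]-th largest coefficient counted from 1. *)
Definition bseq : seq R := 1 :: sort (fun x y : R => y <= x) [seq b q | q <- enum 'I_(2 * n)].
Definition border : seq 'I_m :=
  ord_max :: [seq wid q | q <- sort (fun q q' : 'I_(2 * n) => b q' <= b q) (enum 'I_(2 * n))].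

Lemma bcoef01 p : 0 <= B p <= 1.
Proof. by rewrite /bcoef; case: unliftP => [q _|_] //; rewrite ler01 lexx. Qed.

Lemma border_map : [seq B p | p <- border] = bseq.
Proof.
rewrite /border /bseq /= {1}/bcoef unlift_none; congr (_ :: _).
rewrite sort_map -map_comp; apply: eq_map => q /=.
by rewrite /bcoef /wid liftK.
Qed.

Lemma size_border : size border = m.
Proof. by rewrite /= size_map size_sort size_enum_ord. Qed.

Lemma border_uniq : uniq border.
Proof.
rewrite /= map_inj_uniq; last exact: lift_inj.
rewrite sort_uniq enum_uniq andbT; apply/mapP => -[q _] /eqP.
by rewrite (negbTE (neq_lift _ _)).
Qed.

Definition bperm (p : 'I_m) : 'I_m := nth ord_max border p.

Lemma bperm_inj : injective bperm.
Proof.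
move=> p r /eqP; rewrite /bperm nth_uniq ?size_border ?ltn_ord ?border_uniq //.
by move/eqP/val_inj.
Qed.

Lemma bpermE p : B (bperm p) = nth 0 bseq p.
Proof. by rewrite -border_map (nth_map ord_max) ?size_border ?ltn_ord. Qed.

Lemma bseq_sorted (i j : nat) : (i <= j < m)%N -> nth 0 bseq j <= nth 0 bseq i.
Proof.
move=> /andP[ij jm].
have so : sorted (fun x y : R => y <= x) bseq.
  rewrite /bseq /= path_min_sorted; first by apply: sort_sorted => x y; apply: le_total.
  apply/allP => x; rewrite mem_sort => /mapP[q _ ->]; by have /andP[] := b01 q.
have sz : size bseq = m by rewrite -border_map size_map size_border.
have tr : transitive (fun x y : R => y <= x) by move=> x y z h1 h2; apply: le_trans h2 h1.
by apply: (sorted_leq_nth tr (fun x => lexx x) 0 so); rewrite ?inE ?sz //; apply: leq_ltn_trans jm.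
Qed.

Lemma bseq01 p : 0 <= nth 0 bseq p <= 1.
Proof. by rewrite -bpermE bcoef01. Qed.

(** [nuk 0] pairs the parity's 1 with the largest coefficient; afterwards the coefficients of rank
    [2k] and [2k + 1] are paired. *)
Definition nuk (k : 'I_n) : R := nth 0 bseq (2 * k) * nth 0 bseq (2 * k).+1.

Lemma nuk01 k : 0 <= nuk k <= 1.
Proof.
have := bseq01 (pe k); have := bseq01 (po k); rewrite val_pe val_po.
move=> /andP[a0 a1] /andP[c0 c1].
by rewrite /nuk mulr_ge0 //= mulr_ile1.
Qed.

Lemma sum_nuk (f : R -> R) : (0 < n)%N ->
  \sum_k f (nuk k) = f (b_dec b 0) + \sum_(1 <= j < n) f (b_dec b (2 * j).-1 * b_dec b (2 * j)).
Proof.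
move=> n0; rewrite -(big_mkord xpredT (fun k => f (nth 0 bseq (2 * k) * nth 0 bseq (2 * k).+1))).
rewrite big_ltn //; congr (f _ + _); first by rewrite /bseq /= mul1r.
by apply: eq_big_nat => -[//|j] _; rewrite mulnS.
Qed.

(* The channel acts on elements of degree [2k] as a product over the top [2k]
   coefficients times a mixture of signed unitary conjugations. *)
Section Contract.
Variable (k : nat).
Hypothesis kn : (k <= n)%N.
Let I : pred 'I_m := fun p => [exists i : 'I_m, (i < 2 * k)%N && (p == bperm i)].
(** The smallest entry in the top [2k]. For [k = 0] the truncated predecessor selects position 0,
    with value 1, which still bounds all entries. *)
Let t := nth 0 bseq (2 * k).-1.

Let I_bperm i : I (bperm i) = (i < 2 * k)%N.
Proof.
apply/existsP/idP => [[j /andP[jk /eqP/bperm_inj ->]] //|ik].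
by exists i; rewrite ik eqxx.
Qed.

Let bperm_bij : bijective bperm. Proof. exact: injF_bij bperm_inj. Qed.

Let I_ge p : I p -> t <= B p.
Proof.
have [i ->] : exists i, p = bperm i by case: bperm_bij => g _ h; exists (g p); rewrite h.
rewrite I_bperm bpermE => h; apply: bseq_sorted; lia.
Qed.

Let I_le p : ~~ I p -> B p <= t.
Proof.
have [i ->] : exists i, p = bperm i by case: bperm_bij => g _ h; exists (g p); rewrite h.
rewrite I_bperm bpermE -leqNgt => h; apply: bseq_sorted; have := ltn_ord i; lia.
Qed.

Let prodI : \prod_(p | I p) B p = \prod_(i < k) (nth 0 bseq (2 * i) * nth 0 bseq (2 * i).+1).
Proof.
rewrite (reindex bperm) /=; last exact: onW_bij bperm_bij.
under eq_bigl do rewrite I_bperm.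
under eq_bigr do rewrite bpermE.
rewrite -(big_mkord (fun i => (i < 2 * k)%N) (fun i => nth 0 bseq i)).
have km : (2 * k <= m)%N by lia.
rewrite -(big_nat_widen 0 (2 * k) m xpredT (fun i => nth 0 bseq i) km).
elim: (k) => [|l IH]; first by rewrite muln0 big_geq // big_ord0.
by rewrite big_ord_recr /= -IH mulnS !big_nat_recr //= mulrA.
Qed.

Let cardI : #|I| = (2 * k)%N.
Proof.
rewrite -sum1_card (reindex bperm) /=; last exact: onW_bij bperm_bij.
rewrite (eq_bigl (fun i : 'I_m => (i < 2 * k)%N)); last by move=> i; apply: I_bperm.
rewrite -(big_mkord (fun i => (i < 2 * k)%N) (fun _ => 1%N)).
have km : (2 * k <= m)%N by lia.
by rewrite -(big_nat_widen 0 (2 * k) m xpredT (fun _ => 1%N) km) sum_nat_const_nat subn0 muln1.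
Qed.

Let Phi : {linear Mat -> Mat} :=
  chan (enum 'I_m) (fun p => (1 + B p) / 2) (fun p => (1 - B p) / 2).

(** For a set [y] of [2k] indices, the product of [B] over [y] is the product over [I], times
    [t / B] on [I] minus [y], times [B / t] on [y] minus [I]; the powers of [t] cancel because both
    sets have [2k] elements. *)
Lemma degree_contract (rho T : Mat) : density rho -> adjmx T = T -> T * T = 1 ->
  deg T = (m%:R - 2 * (2 * k)%N%:R) *: T ->
  exists2 x : R, \tr (rho * Phi T) = x%:C &
    `|x| <= \prod_(i < k) (nth 0 bseq (2 * i) * nth 0 bseq (2 * i).+1).
Proof.
move=> hr hT TT hd; rewrite -prodI.
have PhiE x : Phi (mono R x) = (\prod_p (if ext x p then B p else 1))%:C *: mono R x.
  rewrite /Phi /= chan_mono big_enum /=; congr (_%:C *: _); apply: eq_bigr => p _.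
  by case: ifP => _; lra.
have B0 p : 0 <= B p by have /andP[] := bcoef01 p.
have t_ge0 : 0 <= t.
  by rewrite /t; have h : ((2 * k).-1 < m)%N by [lia]; have /andP[] := bseq01 (Ordinal h).
(* When [t = 0] every monomial of degree [2k] meets a zero of [B]: it either leaves [I], where
   [B <= t], or equals [I], which contains the index attaining [t]. Hence [Phi T = 0]. *)
move: t_ge0; rewrite le_eqVlt => /orP[/eqP t0|t0].
  have k0 : (0 < k)%N.
    by rewrite lt0n; apply/eqP => k0; move: t0; rewrite /t k0 /= => /eqP; rewrite eq_sym oner_eq0.
  have hI : exists p, I p /\ B p = 0.
    have h : ((2 * k).-1 < m)%N by lia.
    by exists (bperm (Ordinal h)); rewrite I_bperm bpermE -/t -t0; split=> //=; lia.
  have [p0 [Ip0 Bp0]] := hI.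
  exists 0; last by rewrite normr0; apply: prodr_ge0.
  rewrite (degree_ext (g := \0%R) hd) /= ?mulr0 ?raddf0 // => x cx.
  suff [p xp Bp] : exists2 p, ext x p & B p = 0.
    by rewrite PhiE (bigD1 p) //= xp Bp mul0r scale0r.
  have [/existsP[p /andP[xp Ip]]|/existsPn h] := boolP [exists p, ext x p && ~~ I p].
    by exists p => //; apply/eqP; rewrite eq_le B0 andbT t0 I_le.
  have sub : ext x \subset I.
    by apply/fintype.subsetP => p xp; have := h p; rewrite negb_and negbK => /orP[/negP|]. 
  have /subset_cardP/(_ sub) e : #|ext x| = #|I| by rewrite cx cardI.
  by exists p0 => //; rewrite -[ext x p0]/(p0 \in ext x) e; apply: Ip0.
pose al p := if I p then t / B p else B p / t.
have Bpos p : I p -> 0 < B p by move=> /I_ge; apply: lt_le_trans.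
have al01 p : 0 <= al p <= 1.
  rewrite /al; case: ifPn => Ip.
    by rewrite divr_ge0 ?(ltW t0) //= ler_pdivrMr ?Bpos // mul1r I_ge.
  by rewrite divr_ge0 ?(ltW t0) //= ler_pdivrMr // mul1r I_le.
pose u p := (1 + al p) / 2.
(* The reversed sign inside [I] puts the damping on the monomials that miss [p]: there
   [u + v = t / B] and [u - v = 1]. *)
pose v p := if I p then - ((1 - al p) / 2) else (1 - al p) / 2.
have huv p : `|u p| + `|v p| <= 1.
  have /andP[a0 a1] := al01 p.
  have -> : `|v p| = (1 - al p) / 2 by rewrite /v; case: ifP => _; rewrite ?normrN ger0_norm //; lra.
  rewrite ger0_norm /u; lra.
have [x hx x1] := chan_involution (enum 'I_m) huv hr hT TT.
exists ((\prod_(p | I p) B p) * x); last first.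
  rewrite normrM ger0_norm; last by apply: prodr_ge0.
  by rewrite ler_piMr // prodr_ge0.
pose Psi : {linear Mat -> Mat} := chan (enum 'I_m) u v.
pose Psi' : {linear Mat -> Mat} := (\prod_(p | I p) B p)%:C \*: Psi.
rewrite (degree_ext (g := Psi') hd) /= => [|y cy]; first by rewrite mxZr mxtraceZ hx rmorphM.
rewrite [LHS]PhiE chan_mono scalerA -rmorphM big_enum /=; congr (_%:C *: _).
rewrite [X in _ = X * _]big_mkcond -big_split /=.
rewrite [RHS](eq_bigr (fun p => (if ext y p then B p else 1) *
     ((if I p then t else 1) * (if ext y p then t^-1 else 1)))) => [|p _]; last first.
  rewrite /u /v /al; have [Ip|Ip] := boolP (I p); case: ifP => _.
  - by rewrite mulfV ?lt0r_neq0 ?mulr1 // (_ : _ - _ = 1) ?mulr1 //; field; apply/lt0r_neq0/Bpos.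
  - by field; apply/lt0r_neq0/Bpos.
  - by field; apply/lt0r_neq0.
  - by field; apply/lt0r_neq0.
rewrite big_split [X in _ = _ * X]big_split /= -!big_mkcond /= !prodr_const.
have tc (a c : nat) : a = c -> t ^+ a * t^-1 ^+ c = 1.
  by move=> ->; rewrite exprVn mulfV // expf_neq0 // lt0r_neq0.
by rewrite tc ?mulr1 //; apply: etrans cardI (esym cy).
Qed.

End Contract.

Variable Phi : {linear Mat -> Mat}.
Hypothesis hPhi : fermionic_product_channel b Phi.

Lemma channel_selfadj X Y : \tr (Phi X * Y) = \tr (X * chan (rev (enum 'I_m))
  (fun p => (1 + B p) / 2) (fun p => (1 - B p) / 2) Y).
Proof. by rewrite (channelE hPhi) chan_trace revK. Qed.

Lemma chan_rev u v X : chan (rev (enum 'I_m)) u v X = chan (enum 'I_m) u v X.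
Proof.
pose f : {linear Mat -> Mat} := chan (rev (enum 'I_m)) u v.
pose g : {linear Mat -> Mat} := chan (enum 'I_m) u v.
apply: (mono_lin_ext (f := f) (g := g)) => x; rewrite /f /g /= !chan_mono.
by rewrite (perm_big (enum 'I_m)) // perm_rev.
Qed.

Lemma frame_state_output_entropy F lam : F *m F^T = 1%:M -> (forall j, -1 <= lam j <= 1) ->
  \sum_k biasH (nuk k) <= vN_entropy (Phi (frame_state F lam)).
Proof.
move=> hF hl.
have hK : (bcoef_mx b *m (F^T *m lamx lam *m F) *m bcoef_mx b)^T = - (bcoef_mx b *m (F^T *m lamx lam *m F) *m bcoef_mx b).
  have lt : (lamx lam)^T = - lamx lam.
    rewrite /lamx raddf_sum -sumrN; apply: eq_bigr => k _ /=.
    by rewrite linearZ /= raddfB /= !trmx_delta -scalerN opprB.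
  by rewrite !trmx_mul trmxK lt /bcoef_mx tr_diag_mx mulNmx mulmxN mulNmx mulmxN !mulmxA.
have [G [mu [hG hKG]]] := antisym_normal hK.
rewrite (channel_frame_state hPhi hF hG hKG).
have hJ (J : {set 'I_n}) : `|\prod_(j in J) mu j| <= \prod_(i < n | (i < #|J|)%N) nuk i.
  have Jn : (#|J| <= n)%N by rewrite -[leqRHS]card_ord max_card.
  have [x hx x1] := degree_contract Jn (frame_state_density hF hl) (ftJ_herm J hG) (ftJ_sq J hG) (deg_ftJ J hG).
  have e : (\prod_(j in J) mu j)%:C = x%:C.
    rewrite -(ftJ_trace J mu hG) -(channel_frame_state hPhi hF hG hKG) channel_selfadj chan_rev.
    exact: hx.
  rewrite (real_complex_inj e) (le_trans x1) // le_eqVlt; apply/orP; left; apply/eqP.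
  by rewrite (big_ord_narrow Jn).
(* The normal form gives no bound on [mu]; it comes from [hJ] on singletons. *)
have mu01 j : -1 <= mu j <= 1.
  rewrite -ler_norml; have := hJ [set j]; rewrite big_set1 cards1 => /le_trans; apply.
  apply: prodr_ile1 => i _; exact: nuk01.
rewrite frame_state_entropy //; apply: weak_log_majorization => //; exact: nuk01.
Qed.

End OutputEntropy.

(** * Gaussian unitaries *)

Section GaussianStates.
Variables (R : realType) (n : nat).
Local Notation C := (R[i]).
Local Notation N := (2 ^ n)%N.
Local Notation Mat := 'M[C]_N.
Local Notation m := (2 * n).+1.
Local Notation "x %:C" := (real_complex R x).
Local Notation gam := (@gam R n).
Implicit Types (p r : 'I_m) (X Y U V H : Mat) (F G K : 'M[R]_m).

Lemma rho_lambdaE (lam : 'I_n -> R) : rho_lambda lam = frame_state 1%:M lam.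
Proof.
rewrite /rho_lambda /frame_state; congr (_ *: _); rewrite /mxprod /fq prod_enum_ord.
apply: eq_bigr => k _; rewrite scale1r ftE !frm1 gam_wid2 majorana_pair scalerA.
by rewrite scalerA -mulrA mulNr mulCii opprK mulr1.
Qed.

Lemma conj_prod U (I : Type) (s : seq I) (f : I -> Mat) : adjmx U * U = 1 -> U * adjmx U = 1 ->
  U * (\prod_(i <- s) f i) * adjmx U = \prod_(i <- s) (U * f i * adjmx U).
Proof.
move=> h1 h2; elim: s => [|i s IH]; first by rewrite !big_nil mulr1.
by rewrite !big_cons -IH !mulrA -[U * f i * adjmx U * U]mulrA h1 mulr1.
Qed.

Lemma conj_frame_state U F lam : unitary U -> (forall p, U * gam p * adjmx U = frm F p) ->
  U *m rho_lambda lam *m adjmx U = frame_state F lam.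
Proof.
move=> hU h; have h1 : U * adjmx U = 1 by []; have h2 := unitaryE hU.
rewrite rho_lambdaE !mulmxE /frame_state mxZr mxZl; congr (_ *: _).
rewrite /fq conj_prod //; apply: eq_bigr => k _.
rewrite mulrDr mulrDl !mxZr !mxZl mulr1 h1; congr (_ + _ *: _).
rewrite !ftE mxZr mxZl !frm1; congr (_ *: _).
by rewrite -!h !mulrA -[U * gam (pe k) * adjmx U * U]mulrA h2 mulr1.
Qed.

Lemma gam_trace p r : \tr (gam p * gam r) = if p == r then N%:R else 0.
Proof.
have [->|pr] := eqVneq p r; first by rewrite gam_sq mxtrace1.
apply: mxtrace_eqN0; rewrite {1}mxtraceM (gam_anti R) 1?eq_sym //.
by rewrite raddfN /=.
Qed.

Lemma gam_free (a : 'I_m -> C) : \sum_p a p *: gam p = 0 -> forall p, a p = 0.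
Proof.
move=> h r; have /eqP := congr1 (fun X => \tr (X * gam r)) h.
rewrite mul0r raddf0 mulr_suml mxtrace_sum (bigD1 r) //= big1 ?addr0 => [|p pr].
  by rewrite mxZl mxtraceZ gam_trace eqxx mulf_eq0 (negbTE (N_neq0 _ _)) orbF => /eqP.
by rewrite mxZl mxtraceZ gam_trace (negbTE pr) mulr0.
Qed.

Definition gspan X := exists a : 'I_m -> C, X = \sum_p a p *: gam p.

Lemma gspan0 : gspan 0.
Proof. by exists (fun=> 0); rewrite big1 // => p _; rewrite scale0r. Qed.

Lemma gspanD X Y : gspan X -> gspan Y -> gspan (X + Y).
Proof.
move=> [a ->] [b ->]; exists (fun p => a p + b p); rewrite -big_split.
by apply: eq_bigr => p _; rewrite scalerDl.
Qed.

Lemma gspanZ (c : C) X : gspan X -> gspan (c *: X).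
Proof.
move=> [a ->]; exists (fun p => c * a p); rewrite scaler_sumr.
by apply: eq_bigr => p _; rewrite scalerA.
Qed.

Lemma gspan_sum (I : Type) (s : seq I) (Q : pred I) (f : I -> Mat) :
  (forall i, gspan (f i)) -> gspan (\sum_(i <- s | Q i) f i).
Proof. by move=> h; elim/big_ind: _ => //; [apply: gspan0|apply: gspanD]. Qed.

Lemma gspan_gam p : gspan (gam p).
Proof.
exists (fun r => (r == p)%:R); rewrite (bigD1 p) //= eqxx scale1r big1 ?addr0 // => r /negbTE ->.
by rewrite scale0r.
Qed.

Lemma comm_gam2 p q r : comm (gam p * gam q) (gam r) =
  (2 * (q == r)%:R) *: gam p - (2 * (p == r)%:R) *: gam q.
Proof.
rewrite /comm.
have e1 : gam p * gam q * gam r = (2 * (q == r)%:R) *: gam p - gam p * gam r * gam q.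
  rewrite -mulrA -[gam q * gam r](addrK (gam r * gam q)) gam_clifford mulrBr.
  by rewrite -mulmxE mul_mx_scalar mulmxE mulrA.
have e2 : gam r * (gam p * gam q) = (2 * (p == r)%:R) *: gam q - gam p * gam r * gam q.
  rewrite mulrA -[gam r * gam p](addKr (gam p * gam r)) gam_clifford mulrDl mulNr.
  by rewrite -mulmxE mul_scalar_mx mulmxE addrC.
by rewrite e1 e2 opprB addrA subrK.
Qed.

Lemma gspan_comm2 p q X : gspan X -> gspan (comm (gam p * gam q) X).
Proof.
move=> [a ->].
have -> : comm (gam p * gam q) (\sum_r a r *: gam r) = \sum_r a r *: comm (gam p * gam q) (gam r).
  rewrite /comm mulr_sumr mulr_suml -sumrB; apply: eq_bigr => r _.
  by rewrite mxZr mxZl scalerBr.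
apply: gspan_sum => r; apply: gspanZ; rewrite comm_gam2 -scaleNr.
by apply: gspanD; apply: gspanZ; apply: gspan_gam.
Qed.

Definition quadham (h2 : 'I_(2 * n) -> 'I_(2 * n) -> C) : Mat :=
  \sum_(p < 2 * n) \sum_(q < 2 * n) h2 p q *: (majorana R p *m majorana R q).
Definition linham (h1 : 'I_(2 * n) -> C) : Mat := \sum_(p < 2 * n) h1 p *: majorana R p.

Lemma majorana_gam (q : 'I_(2 * n)) : majorana R q = (- 'i) *: (gam ord_max * gam (wid q)).
Proof. by rewrite gam_max_wid scalerA mulNr mulCii opprK scale1r. Qed.

Lemma gspan_ham h2 h1 X : gspan X -> gspan (comm (quadham h2 + linham h1) X).
Proof.
move=> hX.
have -> : comm (quadham h2 + linham h1) X = comm (quadham h2) X + comm (linham h1) X.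
  by rewrite /comm mulrDl mulrDr opprD addrACA.
apply: gspanD.
  rewrite /quadham.
  have -> : \sum_(p < 2 * n) \sum_(q < 2 * n) h2 p q *: (majorana R p *m majorana R q) =
     \sum_(z : 'I_(2 * n) * 'I_(2 * n)) h2 z.1 z.2 *: (majorana R z.1 * majorana R z.2).
    by rewrite pair_bigA.
  rewrite commE_sum; apply: gspan_sum => z; apply: gspanZ.
  by rewrite -gam_wid2; apply: gspan_comm2.
rewrite commE_sum; apply: gspan_sum => q; apply: gspanZ.
rewrite majorana_gam.
have -> : comm ((- 'i) *: (gam ord_max * gam (wid q))) X = (- 'i) *: comm (gam ord_max * gam (wid q)) X.
  by rewrite /comm mxZl mxZr scalerBr.
by apply/gspanZ/gspan_comm2.
Qed.

Definition cis (x : R) : C := Complex (cos x) (sin x).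

Lemma cisB x y : cis (x - y) = cis x * (cis y)^*.
Proof.
rewrite /cis cosB sinB; apply/eqP; rewrite eq_complex /=.
by apply/andP; split; apply/eqP; ring.
Qed.

Lemma cis_sq x : cis x * (cis x)^* = 1.
Proof. by rewrite -cisB subrr /cis cos0 sin0. Qed.

Section Expi.
Variables (V : Mat) (d : 'I_N -> R).
Hypothesis hV : unitary V.
Let H := V *m rdiag d *m adjmx V.
Let U := V *m diag_mx (\row_i (cis (d i))) *m adjmx V.

Let VV : adjmx V * V = 1. Proof. exact: unitaryE. Qed.
Let VV' : V * adjmx V = 1. Proof. exact: hV. Qed.

Lemma expi_unitary : unitary U.
Proof.
rewrite /unitary /U; set D := diag_mx _.
have DD : D * adjmx D = 1.
  rewrite -mulmxE mul_diag_mx.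
  apply/matrixP => i j; rewrite -[(1 : Mat)]/(1%:M : Mat) !mxE eq_sym.
  case: eqP => [->|_]; last by rewrite mulr0n conjc0 mulr0.
  by rewrite !mulr1n [LHS]cis_sq.
rewrite !mulmxE !adjmxM adjmxK -!mulrA [adjmx V * (V * _)]mulrA VV mul1r.
by rewrite [D * (adjmx D * _)]mulrA DD mul1r.
Qed.

Lemma adjV_inj X Y : adjmx V * X * V = adjmx V * Y * V -> X = Y.
Proof.
move=> /(congr1 (fun Z => V * Z * adjmx V)).
by rewrite !mulrA VV' !mul1r -!mulrA VV' !mulr1.
Qed.

(** In the eigenbasis of [H] the commutator multiplies entry [(i, j)] by [d i - d j]; conjugation by
    [U] will multiply it by [cis (d i - d j)]. *)
Lemma adH_entry X i j :
  (adjmx V * comm H X * V) i j = (d i - d j)%:C * (adjmx V * X * V) i j.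
Proof.
have -> : adjmx V * comm H X * V = rdiag d * (adjmx V * X * V) - (adjmx V * X * V) * rdiag d.
  rewrite /comm /H !mulmxE mulrBr mulrBl; congr (_ - _).
    by rewrite !mulrA VV mul1r.
  by rewrite !mulrA -!(mulrA _ (adjmx V) V) VV !mulr1.
rewrite -!mulmxE mul_diag_mx mul_mx_diag !mxE -/(mulmx _ _ _ _) rmorphB mulrBl.
by rewrite [X in _ - X]mulrC.
Qed.

Lemma iter_adH_entry k X i j :
  (adjmx V * iter k (comm H) X * V) i j = ((d i - d j) ^+ k)%:C * (adjmx V * X * V) i j.
Proof.
elim: k => [|k IH] /=; first by rewrite expr0 rmorph1 mul1r.
by rewrite adH_entry IH exprS rmorphM mulrA.
Qed.

Lemma AdU_entry X i j :
  (adjmx V * (U * X * adjmx U) * V) i j = cis (d i - d j) * (adjmx V * X * V) i j.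
Proof.
pose D : Mat := diag_mx (\row_i (cis (d i))).
have -> : adjmx V * (U * X * adjmx U) * V = D * (adjmx V * X * V) * adjmx D.
  rewrite /U -/D !mulmxE !adjmxM adjmxK !mulrA VV mul1r.
  by rewrite -!(mulrA _ (adjmx V) V) VV !mulr1.
have -> : adjmx D = diag_mx (\row_i (cis (d i))^*).
  apply/matrixP => a c; rewrite !mxE eq_sym; case: eqP => [->|_]; rewrite ?mulr1n ?mulr0n //.
  exact: conjc0.
by rewrite -!mulmxE mul_diag_mx mul_mx_diag !mxE cisB mulrAC.
Qed.

(** Interpolating [cis] on the finitely many differences [d i - d j]. Every subspace stable under
    the commutator with [H] is therefore stable under conjugation by [U]. *)
Lemma AdU_poly : exists q : {poly C}, forall X,
  U * X * adjmx U = \sum_(k < size q) q`_k *: iter k (comm H) X.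
Proof.
pose s := [seq (d z.1 - d z.2)%:C | z <- enum {: 'I_N * 'I_N}].
have [q hq] := poly_interp s (fun z => cis (complex.Re z)).
exists q => X; apply: adjV_inj; apply/matrixP => i j.
rewrite AdU_entry.
have -> : cis (d i - d j) = q.[(d i - d j)%:C].
  by rewrite hq //; apply/mapP; exists (i, j); rewrite ?mem_enum.
rewrite horner_coef mulr_suml mulr_sumr mulr_suml summxE; apply: eq_bigr => k _.
by rewrite mxZr mxZl [RHS]mxE iter_adH_entry rmorphXn mulrA.
Qed.

End Expi.

Lemma is_expi_unitary H U : is_expi H U -> unitary U.
Proof. by move=> [V [d [hV [_ ->]]]]; apply: expi_unitary. Qed.

Lemma expi_gspan h2 h1 U X : is_expi (quadham h2 + linham h1) U -> gspan X ->
  gspan (U * X * adjmx U).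
Proof.
move=> [V [d [hV [biasH hU]]]] hX.
have [q hq] := AdU_poly d hV.
rewrite hU [_ * X * _]hq -biasH; apply: gspan_sum => k; apply: gspanZ.
by elim: (nat_of_ord k) => [|j IH] //=; apply: gspan_ham.
Qed.

Lemma gspan_herm X : gspan X -> adjmx X = X ->
  exists a : 'I_m -> R, X = \sum_p (a p)%:C *: gam p.
Proof.
move=> [a hX] hh; exists (fun p => complex.Re (a p)); rewrite hX; apply: eq_bigr => p _.
congr (_ *: _).
have : \sum_p (a p - (a p)^*) *: gam p = 0.
  under eq_bigr do rewrite scalerBl.
  rewrite sumrB -hX -[X in X - _]hh hX adjmx_sum; apply/eqP; rewrite subr_eq0; apply/eqP.
  by apply: eq_bigr => r _; rewrite adjmxZ gam_herm.
move=> /gam_free /(_ p) /subr0_eq; case: (a p) => x y /eqP; rewrite eq_complex /= => /andP[_ /eqP h].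
by congr (Complex _ _); lra.
Qed.

(** The conjugated generators stay in the span of the generators; Hermiticity makes their
    coefficients real, and traces of the conjugated Clifford relations give [F F^T = 1]. *)
Lemma gaussian_frame rho : gaussian rho -> exists (F : 'M[R]_m) (lam : 'I_n -> R),
  [/\ F *m F^T = 1%:M, forall j, -1 <= lam j <= 1 & rho = frame_state F lam].
Proof.
move=> [lam [h2 [h1 [U [hl [_ [_ [hU ->]]]]]]]].
have uU := is_expi_unitary hU.
have h p : exists a : 'I_m -> R, U * gam p * adjmx U = \sum_q (a q)%:C *: gam q.
  apply: gspan_herm; first exact: expi_gspan hU (gspan_gam p).
  by rewrite !adjmxM adjmxK gam_herm mulrA.
have [a ha] := choice h; pose F : 'M[R]_m := \matrix_(p, q) a p q.
have hF p : U * gam p * adjmx U = frm F p.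
  by rewrite ha; apply: eq_bigr => q _; rewrite mxE.
exists F, lam; split=> //; last exact: conj_frame_state.
apply/matrixP => p q; apply: real_complex_inj.
have := frm_acomm F p q; rewrite -!hF.
have e X Y : U * X * adjmx U * (U * Y * adjmx U) = U * (X * Y) * adjmx U.
  by rewrite !mulrA -[U * X * adjmx U * U]mulrA (unitaryE uU) mulr1.
rewrite !e -mulrDl -mulrDr gam_clifford => /(congr1 (fun Z : Mat => \tr Z)).
rewrite -(scalemx1 _ (2 * (p == q)%:R)) mxZr mxZl mxtraceZ mulr1 [U * adjmx U]uU mxtrace1 mxtrace_scalar.
have t2 : (2%:R : C) != 0 by rewrite pnatr_eq0.
rewrite -[(_ * _) *+ N]mulr_natr -!mulrA => /(mulfI t2) /(mulIf (N_neq0 R n)) <-.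
by rewrite mxE rmorph_nat.
Qed.

End GaussianStates.

(** * Orthogonal matrices: row signs, Cayley transform, logarithm *)

Section SignCayley.
Variables (R : realType) (k0 : nat).
Local Notation m := k0.+1.
Local Notation C := (R[i]).
Local Notation "x %:C" := (real_complex R x).
Implicit Types (M S A : 'M[R]_m).

(** Rows from [k] on have coefficient 0 instead of a sign, so that signs can be chosen one row at a
    time. *)
Definition sgnrow (s : 'I_m -> bool) (k : nat) (i : 'I_m) : R :=
  if (i < k)%N then (-1) ^+ s i else 0.

(* [det] is affine in each sign, so its average over all signs is [det 1 = 1]. *)
Lemma det_signs M : exists s : 'I_m -> bool,
  \det (1%:M + diag_mx (\row_i (-1) ^+ s i) *m M) != 0.
Proof.
suff h k : (k <= m)%N -> exists s : 'I_m -> bool,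
    \det (\matrix_(i, j) ((i == j)%:R + sgnrow s k i * M i j)) != 0.
  have [s hs] := h m (leqnn m); exists s; move: hs; congr (\det _ != 0).
  by apply/matrixP => i j; rewrite mul_diag_mx !mxE /sgnrow ltn_ord.
elim: k => [_|k IH km].
  exists xpredT; rewrite (_ : \matrix_(i, j) _ = 1%:M) ?det1 ?oner_eq0 //.
  by apply/matrixP => i j; rewrite !mxE /sgnrow ltn0 mul0r addr0.
have [s hs] := IH (ltnW km); pose ik := Ordinal km.
pose se (e : bool) i := if i == ik then e else s i.
pose D e : 'M[R]_m := \matrix_(i, j) ((i == j)%:R + sgnrow (se e) k.+1 i * M i j).
have row'D e : row' ik (D e) = row' ik (\matrix_(i, j) ((i == j)%:R + sgnrow s k i * M i j)).
  apply/matrixP => i j; rewrite !mxE; congr (_ + _ * _).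
  rewrite /sgnrow /se [_ == ik]eq_sym (negbTE (neq_lift _ _)) ltnS leq_eqVlt.
  have /negbTE : lift ik i != ik by rewrite eq_sym neq_lift.
  by rewrite -val_eqE /= => ->.
have := @determinant_multilinear _ _ (\matrix_(i, j) ((i == j)%:R + sgnrow s k i * M i j))
   (D true) (D false) ik 2^-1 2^-1.
rewrite !row'D => /(_ _ erefl erefl) hd.
have {}hd := hd _.
have E : \det (\matrix_(i, j) ((i == j)%:R + sgnrow s k i * M i j)) =
    2^-1 * \det (D true) + 2^-1 * \det (D false).
  apply: hd; apply/rowP => j; rewrite !mxE /sgnrow /se eqxx /= ltnn ltnSn expr1 expr0.
  by field.
have [h1|h1] := eqVneq (\det (D true)) 0; last by exists (se true).
by exists (se false); apply: contraNneq hs => h2; rewrite E h1 -/(D false) h2 !mulr0 addr0.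
Qed.

(** An eigenvalue [exp (i th)] of [S] becomes [i tan (th / 2)]. *)
Definition cayley S : 'M[R]_m := invmx (1%:M + S) *m (S - 1%:M).

Section Cayley.
Variable S : 'M[R]_m.
Hypothesis hS : S *m S^T = 1%:M.
Hypothesis hdet : \det (1%:M + S) != 0.

Let un : (1%:M + S) \in unitmx. Proof. by rewrite unitmxE unitfE. Qed.

Lemma cayley_mul : cayley S *m (1%:M + S) = S - 1%:M.
Proof.
rewrite /cayley -mulmxA (_ : (S - 1%:M) *m (1%:M + S) = (1%:M + S) *m (S - 1%:M)); last first.
  by rewrite mulmxBl mulmxBr mulmxDr mulmxDl !mulmx1 !mul1mx.
by rewrite mulKmx.
Qed.

Lemma cayley_antisym : (cayley S)^T = - cayley S.
Proof.
have hS' : S^T *m S = 1%:M by apply: mulmx1C.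
have un' : (1%:M + S)^T \in unitmx by rewrite unitmx_tr.
apply: (can_inj (mulKmx un)).
have e1 : (1%:M + S) *m cayley S = S - 1%:M by rewrite /cayley mulKVmx.
rewrite mulmxN e1.
have e2 := congr1 trmx cayley_mul; rewrite trmx_mul in e2.
have e3 : (1%:M + S)^T = S^T *m (1%:M + S).
  by rewrite mulmxDr mulmx1 hS' raddfD /= trmx1 addrC.
have : S *m ((1%:M + S)^T *m (cayley S)^T) = S *m (S - 1%:M)^T by rewrite e2.
rewrite e3 !mulmxA hS mul1mx => ->.
by rewrite raddfB /= trmx1 mulmxBr hS mulmx1 opprB.
Qed.

Local Notation toC := (map_mx (real_complex R)).

(** The inverse Cayley transform on the unit circle, cleared of its denominator. *)
Lemma cis2atan (x : R) : cis (2 * atan x) * (1 - 'i * x%:C) = 1 + 'i * x%:C.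
Proof.
have c0 : 0 < 1 + x ^+ 2 by rewrite ltr_pwDl // sqr_ge0.
have cc : cos (atan x) ^+ 2 * (1 + x ^+ 2) = 1.
  rewrite cos_atan exprVn sqr_sqrtr ?ltW // mulVf // lt0r_neq0 //.
have cn0 : cos (atan x) != 0.
  by apply: contraPneq cc => ->; rewrite expr0n mul0r => /eqP; rewrite eq_sym oner_eq0.
have ss : sin (atan x) = x * cos (atan x).
  by rewrite -{2}[x]atanK /tan divfK.
rewrite /cis mulr_natl mulr2n cosD sinD ss.
set c := cos _ in cc *.
apply/eqP; rewrite eq_complex /=; apply/andP; split; apply/eqP.
  by transitivity (c ^+ 2 * (1 + x ^+ 2)); [ring|rewrite cc; ring].
by transitivity (x * (c ^+ 2 * (1 + x ^+ 2))); [ring|rewrite cc; ring].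
Qed.

(** A real antisymmetric logarithm of [S], expressed by common left eigenvectors instead of an
    exponential. *)
Lemma orth_log : exists (L : 'M[R]_m) (V : 'M[C]_m) (th : 'I_m -> R),
  let W := (map_mx (@conjc R) V)^T in
  [/\ L^T = - L, V *m W = 1%:M,
      forall l, row l (W *m toC L) = ('i * (th l)%:C) *: row l W &
      forall l, row l (W *m toC S) = cis (th l) *: row l W].
Proof.
move: (cayley S) cayley_antisym cayley_mul => A aA eA.
pose Kh : 'M[C]_m := (- 'i) *: toC A.
have hK : (map_mx (@conjc R) Kh)^T = Kh.
  apply/matrixP => i j; rewrite !mxE.
  have -> : A j i = - A i j by have := congr1 (fun Z : 'M_m => Z i j) aA; rewrite !mxE.
  by apply/eqP; rewrite eq_complex /=; apply/andP; split; apply/eqP; ring.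
have [V [d [hV eK]]] := herm_spectral hK.
set W := (map_mx (@conjc R) V)^T in hV eK.
have WV : W *m V = 1%:M by apply: mulmx1C.
pose th l := 2 * atan (d l).
have WA k l : row l (W *m toC (A ^+ k)) = ('i * (d l)%:C) ^+ k *: row l W.
  elim: k => [|k IH]; first by rewrite expr0 map_mx1 mulmx1 expr0 scale1r.
  have W1 : row l (W *m toC A) = ('i * (d l)%:C) *: row l W.
    have -> : toC A = 'i *: Kh by rewrite scalerA mulrN mulCii opprK scale1r.
    rewrite eK -scalemxAr !mulmxA WV mul1mx -scalerA; apply/rowP => j.
    by rewrite mul_diag_mx !mxE.
  rewrite exprSr -mulmxE map_mxM mulmxA row_mul IH -scalemxAl -row_mul W1 scalerA.
  by rewrite exprSr.
(* [2 atan d / d] is even in [d], hence a function of [d ^ 2]; its value at 0 is irrelevant, being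
   multiplied by [d]. *)
pose f x : R := 2 * atan (Num.sqrt x) / Num.sqrt x.
have [g hg] := poly_interp [seq d l ^+ 2 | l : 'I_m] f.
have gd l : d l * g.[d l ^+ 2] = th l.
  rewrite hg; last by apply/mapP; exists l; rewrite ?mem_enum.
  rewrite /f sqrtr_sqr /th.
  have [->|d0] := eqVneq (d l) 0; first by rewrite atan0 mul0r mulr0.
  case: ger0P => h; first by field.
  by rewrite atanN; field.
(* An odd real polynomial of the antisymmetric Cayley transform, with eigenvalue
   [2 i atan d] where the Cayley transform has [i d]. *)
pose L := \sum_(j < size g) (g`_j * (-1) ^+ j) *: A ^+ (2 * j).+1.
exists L, V, th; split=> //.
- rewrite /L raddf_sum -sumrN; apply: eq_bigr => j _ /=; rewrite linearZ /= -scalerN.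
  congr (_ *: _).
  have tX k : (A ^+ k)^T = (-1) ^+ k *: A ^+ k.
    elim: k => [|k IH]; first by rewrite !expr0 trmx1 scale1r.
    rewrite exprSr -mulmxE trmx_mul IH aA mulNmx -scalemxAr mulmxE -exprS -scaleNr.
    by rewrite [(-1) ^+ _.+1]exprS mulN1r exprSr.
  by rewrite tX exprS exprM sqrrN expr1n expr1n mulr1 scaleN1r.
- move=> l; rewrite /L map_mx_sum mulmx_sumr.
  rewrite raddf_sum /= -gd rmorphM horner_coef rmorph_sum mulr_sumr mulr_sumr scaler_suml.
  apply: eq_bigr => j _; rewrite map_mxZ -scalemxAr linearZ /= WA scalerA; congr (_ *: _).
  have e2 : ('i * (d l)%:C) ^+ 2 = - ((d l)%:C ^+ 2) by rewrite exprMn sqrCi mulN1r.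
  rewrite exprS exprM e2 [X in _ * (_ * X)]exprNn !rmorphM !rmorphXn rmorphN1 /=.
  have : (-1) ^+ j * (-1) ^+ j = 1 :> C by rewrite -expr2 sqrr_sign.
  by set s := (-1) ^+ j => ss; ring: ss.
- move=> l; have e := congr1 toC eA.
  rewrite map_mxM map_mxD map_mxB map_mx1 in e.
  have := congr1 (fun Z => row l (W *m Z)) e.
  have := WA 1%N l; rewrite !expr1 => W1.
  rewrite mulmxA row_mul W1 -scalemxAl mulmxDr mulmx1 mulmxBr mulmx1 -row_mul => h.
  have {}h : ('i * (d l)%:C) *: (row l W + row l (W *m toC S)) = row l (W *m toC S) - row l W.
    by apply: (etrans h); rewrite raddfB.
  have h2 : (1 - 'i * (d l)%:C) *: row l (W *m toC S) = (1 + 'i * (d l)%:C) *: row l W.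
    rewrite scalerBl scale1r scalerDl scale1r; move: h; rewrite scalerDr => h.
    by rewrite -[X in X + _ = _](subrK (row l W)) -h; rewrite addrAC addrK addrC.
  have n0 : 1 - 'i * (d l)%:C != 0.
    by rewrite eq_complex /= negb_and !(mul0r, mulr0, subr0, addr0) oner_eq0.
  have /(congr1 (fun Z => (1 - 'i * (d l)%:C)^-1 *: Z)) := h2.
  rewrite !scalerA mulVf // scale1r => ->; congr (_ *: _).
  by rewrite -cis2atan mulrC mulfK.
Qed.

End Cayley.

End SignCayley.

(** * Frames realised by Gaussian unitaries *)

Section GaussianFrames.
Variables (R : realType) (n : nat).
Local Notation C := (R[i]).
Local Notation N := (2 ^ n)%N.
Local Notation Mat := 'M[C]_N.
Local Notation m := (2 * n).+1.
Local Notation "x %:C" := (real_complex R x).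
Local Notation gam := (@gam R n).
Local Notation toC := (map_mx (real_complex R)).
Implicit Types (p r : 'I_m) (X Y U V H : Mat) (F G K L S : 'M[R]_m) (v : 'rV[C]_m).

Lemma clcZ (a : C) v : clc (a *: v) = a *: clc v.
Proof. by rewrite /clc scaler_sumr; apply: eq_bigr => p _; rewrite mxE scalerA. Qed.

Lemma clc_mul (v : 'rV[C]_m) (M : 'M[C]_m) : clc (v *m M) = \sum_p v 0 p *: clc (row p M).
Proof.
rewrite /clc; under [RHS]eq_bigr do rewrite scaler_sumr.
rewrite exchange_big; apply: eq_bigr => q _; rewrite mxE scaler_suml.
by apply: eq_bigr => p _; rewrite mxE scalerA.
Qed.

Lemma comm_sumr X (a : 'I_m -> C) (A : 'I_m -> Mat) :
  comm X (\sum_p a p *: A p) = \sum_p a p *: comm X (A p).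
Proof.
rewrite /comm mulr_sumr mulr_suml -sumrB; apply: eq_bigr => p _.
by rewrite mxZr mxZl scalerBr.
Qed.

(** Quadratic Hamiltonian generating the rotation with logarithm [L]; the factor [i / 4] makes its
    commutator act on the generators as [- i L]. *)
Definition ham L : Mat := ('i / 4%:R) *: \sum_p \sum_q (L p q)%:C *: (gam p * gam q).

Lemma ham_gam L r : L^T = - L -> comm (ham L) (gam r) = (- 'i) *: frm L r.
Proof.
move=> hL; have Lij i j : L i j = - L j i by have := congr1 (fun Z : 'M_m => Z j i) hL; rewrite !mxE.
have -> : comm (ham L) (gam r) =
    ('i / 4%:R) *: \sum_p \sum_q (L p q)%:C *: comm (gam p * gam q) (gam r).
  rewrite /ham /comm mxZl mxZr -scalerBr; congr (_ *: _).
  rewrite mulr_suml mulr_sumr -sumrB; apply: eq_bigr => p _.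
  rewrite mulr_suml mulr_sumr -sumrB; apply: eq_bigr => q _.
  by rewrite mxZl mxZr scalerBr.
have -> : \sum_p \sum_q (L p q)%:C *: comm (gam p * gam q) (gam r) =
    \sum_p (2 * (L p r)%:C) *: gam p - \sum_q (2 * (L r q)%:C) *: gam q.
  under eq_bigr => p _ do under eq_bigr => q _ do rewrite comm_gam2 scalerBr !scalerA.
  under eq_bigr => p _ do rewrite sumrB.
  rewrite sumrB; congr (_ - _).
    apply: eq_bigr => p _; rewrite (bigD1 r) //= eqxx mulr1 mulrC big1 ?addr0 // => q /negbTE ->.
    by rewrite !mulr0 scale0r.
  rewrite exchange_big; apply: eq_bigr => q _ /=.
  rewrite (bigD1 r) //= eqxx mulr1 mulrC big1 ?addr0 // => p /negbTE ->.
  by rewrite !mulr0 scale0r.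
rewrite -sumrB /frm !scaler_sumr; apply: eq_bigr => q _.
rewrite (Lij q r) -scalerBl !scalerA; congr (_ *: _); rewrite rmorphN /=; by field.
Qed.

Lemma ham_clc L v : L^T = - L -> comm (ham L) (clc v) = (- 'i) *: clc (v *m toC L).
Proof.
move=> hL; rewrite clc_mul {1}/clc comm_sumr scaler_sumr; apply: eq_bigr => p _.
rewrite (ham_gam p hL) (clc_row L p).
move: (frm L p) (v 0 p) => X a.
by rewrite !scalerA mulrC.
Qed.

(** Pairs containing the parity generator form the linear part. The two orders add up, since [L] and
    the product both change sign. *)
Lemma ham_split L : L^T = - L -> ham L =
  quadham (fun p q : 'I_(2 * n) => 'i / 4%:R * (L (wid p) (wid q))%:C) +
  linham (fun q => - (L ord_max (wid q) / 2)%:C).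
Proof.
move=> hL; have Lij i j : L i j = - L j i by have := congr1 (fun Z : 'M_m => Z j i) hL; rewrite !mxE.
have L0 i : L i i = 0 by have := Lij i i; lra.
rewrite /ham (bigD1_ord ord_max) //= (bigD1_ord ord_max) //= L0 rmorph0 scale0r add0r.
under [X in _ *: (_ + X)]eq_bigr => p _ do rewrite (bigD1_ord ord_max) //=.
rewrite big_split /= addrA -big_split /= scalerDr addrC; congr (_ + _).
  rewrite /quadham scaler_sumr; apply: eq_bigr => p _; rewrite scaler_sumr.
  by apply: eq_bigr => q _; rewrite -!/(wid _) gam_wid2 scalerA mulmxE.
rewrite /linham scaler_sumr; apply: eq_bigr => q _.
rewrite -!/(wid _) gam_wid_max gam_max_wid (Lij (wid q)) !scalerA -scalerDl scalerA.
congr (_ *: _); rewrite rmorphN /= rmorphM /= fmorphV /= rmorph_nat.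
have := mulCii R; set j := 'i => hj; by field: hj.
Qed.

Lemma quadham_herm L : L^T = - L ->
  adjmx (quadham (fun p q : 'I_(2 * n) => 'i / 4%:R * (L (wid p) (wid q))%:C)) =
  quadham (fun p q : 'I_(2 * n) => 'i / 4%:R * (L (wid p) (wid q))%:C) :> Mat.
Proof.
move=> hL; have Lij i j : L i j = - L j i by have := congr1 (fun Z : 'M_m => Z j i) hL; rewrite !mxE.
rewrite /quadham adjmx_sum; under eq_bigr do rewrite adjmx_sum.
rewrite exchange_big; apply: eq_bigr => q _; apply: eq_bigr => p _.
rewrite adjmxZ !mulmxE adjmxM !majorana_herm Lij; congr (_ *: _).
have h4 : (4%:R^-1 : C)^* = 4%:R^-1 by rewrite fmorphV rmorph_nat.
by rewrite !rmorphM /= h4 conjCi (conj_real (- _)) rmorphN /= mulNr mulrNN.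
Qed.

Lemma linham_herm (h : 'I_(2 * n) -> R) : adjmx (linham (fun q : 'I_(2 * n) => - (h q)%:C)) = linham (fun q => - (h q)%:C) :> Mat.
Proof.
rewrite /linham adjmx_sum; apply: eq_bigr => q _.
by rewrite adjmxZ majorana_herm rmorphN /= conj_real.
Qed.

(** Rows of [W] give eigenvectors of the commutator with [ham L], so conjugation by its exponential
    multiplies them by [cis (th l)], exactly as [S] does. They form a basis, so the two actions
    agree on every generator. *)
Lemma frame_gaussian S lam : S *m S^T = 1%:M -> \det (1%:M + S) != 0 ->
  (forall j, -1 <= lam j <= 1) -> gaussian (frame_state S lam).
Proof.
move=> hS hdet hl; have [L [V [th [hL hV hWL hWS]]]] := orth_log hS hdet.
set W := (map_mx (@conjc R) V)^T in hV hWL hWS.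
have hsum := ham_split hL.
have biasH : hermitian (ham L).
  by rewrite hsum /hermitian adjmxD quadham_herm // linham_herm.
have [Vd [uV dV]] := hermitian_spec biasH.
pose d i := Vd.2 0 i.
pose U : Mat := Vd.1 *m diag_mx (\row_i (cis (d i))) *m adjmx Vd.1.
have hexp : is_expi (ham L) U by exists Vd.1, d.
have conjU l : U * clc (row l W) * adjmx U = cis (th l) *: clc (row l W).
  have hc : comm (ham L) (clc (row l W)) = (th l)%:C *: clc (row l W).
    by rewrite ham_clc // -row_mul hWL clcZ scalerA mulrA mulNr mulCii opprK mul1r.
  apply: (adjV_inj uV); apply/matrixP => i j; rewrite (AdU_entry d uV).
  have := adH_entry d uV (clc (row l W)) i j; rewrite -dV hc mxZr mxZl [LHS]mxE => e.
  rewrite mxZr mxZl [RHS]mxE.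
  (* A nonzero entry of a commutator eigenvector can only sit where [d i - d j] equals its
     eigenvalue [th l]. *)
  have [->|x0] := eqVneq ((adjmx Vd.1 * clc (row l W) * Vd.1) i j) 0; first by rewrite !mulr0.
  by have /real_complex_inj <- := mulIf x0 e.
have hU p : U * gam p * adjmx U = frm S p.
  have e1 : gam p = clc (row p (1%:M : 'M[C]_m)).
    rewrite /clc (bigD1 p) //= !mxE eqxx scale1r big1 ?addr0 // => q qp.
    by rewrite !mxE eq_sym (negbTE qp) scale0r.
  rewrite -clc_row -[toC S]mul1mx -hV -mulmxA row_mul [RHS]clc_mul.
  rewrite e1 -hV row_mul clc_mul mulr_sumr mulr_suml; apply: eq_bigr => l _.
  by rewrite mxZr mxZl conjU hWS clcZ.
exists lam, (fun p q : 'I_(2 * n) => 'i / 4%:R * (L (wid p) (wid q))%:C), (fun q => - (L ord_max (wid q) / 2)%:C), U.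
split=> //; split; first exact: quadham_herm.
split; first exact: linham_herm.
split; first by have := hexp; rewrite hsum.
by rewrite (conj_frame_state lam _ hU) //; apply: is_expi_unitary hexp.
Qed.

End GaussianFrames.

(** * Capacities *)

Section Capacity.
Variables (R : realType) (n : nat) (b : 'I_(2 * n) -> R).
Hypothesis b01 : forall q, 0 <= b q <= 1.
Local Notation C := (R[i]).
Local Notation N := (2 ^ n)%N.
Local Notation Mat := 'M[C]_N.
Local Notation m := (2 * n).+1.
Local Notation "x %:C" := (real_complex R x).
Local Notation B := (bcoef b).
Local Notation nuk := (nuk b).
Variable Phi : {linear Mat -> Mat}.
Hypothesis hPhi : fermionic_product_channel b Phi.
Implicit Types (p r : 'I_m) (X Y : Mat) (F G K : 'M[R]_m).

Lemma channel_psd X : psd X -> psd (Phi X).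
Proof.
rewrite (channelE hPhi) => hX; elim: (enum 'I_m) => [//|p s IH] /=.
have /andP[b0 b1] := bcoef01 b01 p.
apply: psdD; first by apply: psdZ => //; lra.
by apply: psdZ; [lra|have := psd_conj (gam R p) IH; rewrite gam_herm].
Qed.

Lemma channel_density X : density X -> density (Phi X).
Proof.
by move=> [hX tX]; split; [apply: channel_psd|rewrite (channelE hPhi) chan_tr].
Qed.

Lemma gaussian_density X : gaussian X -> density X.
Proof. by move=> /gaussian_frame [F [lam [hF hl ->]]]; apply: frame_state_density. Qed.

Lemma mix_density k (p : 'I_k -> R) (A : 'I_k -> Mat) :
  prob_dist p -> (forall a, density (A a)) -> density (\sum_a (p a)%:C *: A a).
Proof.
move=> [p0 p1] hA; split; first by apply: psd_sum => // a; case: (hA a).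
rewrite mxtrace_sum -[RHS](rmorph1 (real_complex R)) -p1 rmorph_sum.
by apply: eq_bigr => a _; rewrite mxtraceZ (hA a).2 mulr1.
Qed.

Lemma holevo_le (h : R) k (p : 'I_k -> R) (sigma : 'I_k -> Mat) :
  prob_dist p -> (forall a, density (sigma a)) ->
  (forall a, h <= vN_entropy (Phi (sigma a))) ->
  holevo p (fun a => Phi (sigma a)) <= n%:R - h.
Proof.
move=> hp hs hh; rewrite /holevo; apply: lerB.
  by apply/entropy_le/mix_density => // a; apply: channel_density.
have [p0 p1] := hp; rewrite -[h]mul1r -p1 mulr_suml.
by apply: ler_sum => a _; apply: ler_wpM2l.
Qed.

(** A signed permutation that sorts [B], so that each block of [lamx] meets two consecutive entries.
    The signs serve only to make [1 + F] invertible. *)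
Lemma optimal_frame : exists F, [/\ F *m F^T = 1%:M, \det (1%:M + F) != 0 &
  forall lam, Phi (frame_state F lam) = frame_state F (fun k => lam k * nuk k)].
Proof.
pose P : 'M[R]_m := \matrix_(i, j) (j == bperm b i)%:R.
have [s hs] := det_signs P; set F := diag_mx _ *m P in hs.
have FE i j : F i j = (-1) ^+ s i * (j == bperm b i)%:R by rewrite /F mul_diag_mx !mxE.
clearbody F.
have hF : F *m F^T = 1%:M.
  apply/matrixP => i j; rewrite !mxE (bigD1 (bperm b i)) //= big1 ?addr0 => [|k ki].
    rewrite !mxE !FE eqxx mulr1 (inj_eq (@bperm_inj _ _ b)) mulrA.
    by have [->|_] := eqVneq i j; rewrite ?mulr0 // -expr2 sqrr_sign mulr1.
  by rewrite !mxE FE (negbTE ki) mulr0 mul0r.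
exists F; split=> // lam; apply: (channel_frame_state hPhi hF hF).
have FB : F *m bcoef_mx b = diag_mx (\row_i B (bperm b i)) *m F.
  apply/matrixP => i j; rewrite mul_mx_diag mul_diag_mx !mxE FE.
  by have [->|_] := eqVneq j (bperm b i); rewrite ?mulr0 ?mul0r // mulrC.
have BF : bcoef_mx b *m F^T = F^T *m diag_mx (\row_i B (bperm b i)).
  have := congr1 trmx FB; rewrite !trmx_mul tr_diag_mx /bcoef_mx tr_diag_mx; exact.
rewrite !mulmxA BF -!mulmxA FB !mulmxA; congr (_ *m _); rewrite -!mulmxA; congr (_ *m _).
rewrite mulmxA; apply/matrixP => i j; rewrite mul_mx_diag mul_diag_mx !mxE !bpermE.
case: (pairP i) => [k ->|k ->|->].
- rewrite !lamx_pe; case: eqP => [->|_]; last by rewrite mulr0 mul0r.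
  by rewrite val_pe val_po /nuk mulrAC mulrC.
- rewrite !lamx_po; case: eqP => [->|_]; last by rewrite mulr0 mul0r.
  by rewrite val_pe val_po /nuk; ring.
- by rewrite !lamx_max mulr0 mul0r.
Qed.

Definition signs (s : {ffun 'I_n -> bool}) (k : 'I_n) : R := (-1) ^+ s k.

Lemma sum_frame_state_signs F : \sum_(s : {ffun 'I_n -> bool}) frame_state F (signs s) = 1.
Proof.
rewrite /frame_state -scaler_sumr /fq.
under eq_bigr do rewrite prod_enum_ord.
rewrite -(bigA_distr_bigA (fun k (e : bool) => 1 *: (1 : Mat) + ((-1) ^+ e : R)%:C *: ft (frm F) k)) /=.
have -> : \prod_(k < n) \sum_(e : bool) (1 *: (1 : Mat) + ((-1) ^+ e : R)%:C *: ft (frm F) k) =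
    \prod_(k < n) (2%:R *: (1 : Mat)).
  apply: eq_bigr => k _; rewrite big_bool expr0 expr1 rmorphN rmorph1 !scale1r scaleN1r.
  by rewrite /= addrACA addNr addr0 scaler_nat mulr2n.
have pow2 (k : nat) : \prod_(j < k) (2%:R *: (1 : Mat)) = (2 ^ k)%:R *: (1 : Mat).
  elim: k => [|k IH]; first by rewrite big_ord0 scale1r.
  by rewrite big_ord_recr /= IH mxZl mul1r scalerA -natrM -expnSr.
by rewrite pow2 scalerA inv2X scale1r.
Qed.

Lemma card_bits : (#|{: {ffun 'I_n -> bool}}|%:R : R) = 2%:R ^+ n.
Proof. by rewrite card_ffun card_bool card_ord natrX. Qed.

(** The mean output is maximally mixed and, [biasH] being even, all outputs have the same entropy:
    both estimates in [holevo_le] become equalities. *)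
Lemma optimal_ensemble : exists k (p : 'I_k -> R) (sigma : 'I_k -> Mat),
  [/\ prob_dist p, forall a, gaussian (sigma a) &
      holevo p (fun a => Phi (sigma a)) = n%:R - \sum_k biasH (nuk k)].
Proof.
have [F [hF hdet hPF]] := optimal_frame.
pose k := #|{: {ffun 'I_n -> bool}}|.
pose sg (a : 'I_k) := signs (enum_val a).
have hpm (a : 'I_k) j : -1 <= sg a j <= 1.
  by rewrite /sg /signs; case: (enum_val a j); rewrite ?expr0 ?expr1; lra.
have pos : 0 <= (2%:R ^- n : R) by rewrite invr_ge0 exprn_ge0 // ler0n.
have psum : \sum_(a < k) (2%:R ^- n : R) = 1.
  rewrite sumr_const card_ord -[_ *+ _]mulr_natl card_bits mulfV //.
  by rewrite expf_neq0 // pnatr_eq0.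
exists k, (fun=> 2%:R ^- n), (fun a => frame_state F (sg a)); split=> //.
  by move=> a; apply: frame_gaussian.
rewrite /holevo; congr (_ - _).
  have -> : \sum_(a < k) (2%:R ^- n)%:C *: Phi (frame_state F (sg a)) = (2%:R ^- n)%:C *: (1 : Mat).
    rewrite -scaler_sumr -linear_sum; congr (_ *: _).
    rewrite -[RHS](hPhi.1); congr (Phi _); rewrite -[RHS](sum_frame_state_signs F).
    by rewrite [RHS](reindex _ (onW_bij _ (@enum_val_bij _))).
  exact: entropy_mixed.
have nu01 := nuk01 b01.
have hS a : vN_entropy (Phi (frame_state F (sg a))) = \sum_k biasH (nuk k).
  rewrite hPF frame_state_entropy //; last first.
    move=> j; have /andP[h0 h1] := nu01 j; rewrite /sg /signs.
    by case: (enum_val a j); rewrite ?expr0 ?expr1; lra.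
  apply: eq_bigr => j _; rewrite /sg /signs; case: (enum_val a j); last by rewrite expr0 mul1r.
  by rewrite expr1 mulN1r -/(biasH _) biasHN.
under eq_bigr do rewrite hS.
by rewrite -mulr_suml psum mul1r.
Qed.

Lemma sup_max (A : set R) x : A x -> (forall y, A y -> y <= x) -> sup A = x.
Proof.
move=> Ax hA; apply/eqP; rewrite eq_le; apply/andP; split.
  by apply: ge_sup; [exists x|].
by apply: ub_le_sup => //; exists x.
Qed.

Lemma C1gE : C1g Phi = n%:R - \sum_k biasH (nuk k).
Proof.
apply: sup_max.
  have [k [p [sigma [hp hs <-]]]] := optimal_ensemble.
  by exists k, p, sigma.
move=> y [k [p [sigma [hp [hs ->]]]]]; apply: holevo_le => // a.
  exact: gaussian_density.
have [F [lam [hF hl ->]]] := gaussian_frame (hs a).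
exact: frame_state_output_entropy.
Qed.

Lemma C1E : (forall rho, density rho -> \sum_k biasH (nuk k) <= vN_entropy (Phi rho)) ->
  C1 Phi = n%:R - \sum_k biasH (nuk k).
Proof.
move=> hmin; apply: sup_max.
  have [k [p [sigma [hp hs <-]]]] := optimal_ensemble.
  by exists k, p, sigma; split=> //; split=> // a; apply: gaussian_density.
by move=> y [k [p [sigma [hp [hs ->]]]]]; apply: holevo_le => // a; apply: hmin.
Qed.

Lemma min_output_pure : (forall psi : 'cV[C]_N, \tr (psi *m (map_mx (@conjc R) psi)^T) = 1 ->
    exists F lam, [/\ F *m F^T = 1%:M, forall j, -1 <= lam j <= 1 &
       psi *m (map_mx (@conjc R) psi)^T = frame_state F lam :> Mat]) ->
  forall rho, density rho -> \sum_k biasH (nuk k) <= vN_entropy (Phi rho).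
Proof.
move=> hpure rho [hp ht]; have [Vd hV] := hermitian_spec hp.1.
pose P i : Mat := col i Vd.1 *m (map_mx (@conjc R) (col i Vd.1))^T.
have d0 := spec_ge0 hV hp.
have d1 : \sum_i Vd.2 0 i = 1 by apply: real_complex_inj; rewrite -(spec_trace hV) ht.
have rhoE : rho = \sum_i (Vd.2 0 i)%:C *: P i.
  case: hV => _ ->; apply/matrixP => a c; rewrite summxE mxE; apply: eq_bigr => i _.
  rewrite mul_mx_diag !mxE big_ord1 !mxE mulrAC mulrC mulrA //.
have PE i : exists F lam, [/\ F *m F^T = 1%:M, forall j, -1 <= lam j <= 1 & P i = frame_state F lam].
  apply: hpure; rewrite mxtrace_mulC /mxtrace big_ord1.
  have [uV _] := hV; have := congr1 (fun Z : Mat => Z i i) (unitaryE uV).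
  rewrite -mulmxE -[(1 : Mat)]/(1%:M : Mat) [LHS]mxE [RHS]mxE eqxx => h.
  apply: etrans _ h; rewrite mxE.
  by apply: eq_bigr => k _; rewrite !mxE.
have hPi i : psd (Phi (P i)).
  by have [F [lam [hF hl ->]]] := PE i; apply/channel_psd/frame_state_psd.
have conc : \sum_i Vd.2 0 i * vN_entropy (Phi (P i)) <= vN_entropy (Phi rho).
  rewrite [X in Phi X]rhoE linear_sum /=.
  under [X in _ <= vN_entropy X]eq_bigr do rewrite linearZ /=.
  exact: entropy_concave (fun i => Vd.2 0 i) _ (conj d0 d1) hPi.
apply: le_trans conc; rewrite -[leLHS]mul1r -d1 mulr_suml.
apply: ler_sum => i _; apply: ler_wpM2l => //.
have [F [lam [hF hl ->]]] := PE i; exact: frame_state_output_entropy.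
Qed.

End Capacity.

(** * Pure states on at most two qubits *)

Section PureStates.
Variables (R : realType) (n : nat).
Local Notation C := (R[i]).
Local Notation N := (2 ^ n)%N.
Local Notation Mat := 'M[C]_N.
Local Notation m := (2 * n).+1.
Local Notation "x %:C" := (real_complex R x).
Local Notation gam := (@gam R n).
Local Notation toC := (map_mx (real_complex R)).
Implicit Types (p r : 'I_m) (X Y : Mat) (F G : 'M[R]_m) (psi : 'cV[C]_N).

Lemma tr_pauli_string (P : 'I_n -> bool -> bool -> C) :
  (pauli_string P)^T = pauli_string (fun k a b => P k b a).
Proof. by apply/matrixP => i j; rewrite !mxE. Qed.

(** [X] and [Z] are symmetric and [Y] is antisymmetric; [Y] occurs once exactly when [q] is odd. *)
Lemma majorana_tr (q : 'I_(2 * n)) : (majorana R q)^T = (-1) ^+ odd q *: majorana R q.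
Proof.
have -> : (-1) ^+ odd q = \prod_(k < n) (if (k == q./2 :> nat) && odd q then -1 else 1) :> C.
  case: (odd q); last by rewrite big1 // => k _; rewrite andbF.
  by under eq_bigr do rewrite andbT; rewrite (prod_sign_at R (ord_half q)).
rewrite majoranaE tr_pauli_string; apply: pauli_stringZ => k x y.
rewrite /jwloc; case: ltngtP => _ /=.
- by case: x y => [] []; rewrite /pZ /=; ring.
- by case: x y => [] []; rewrite /pI /=; ring.
- by case: (odd q); case: x y => [] []; rewrite /pX ?pYE /=; ring.
Qed.

Lemma parity_tr : (parity R n)^T = parity R n.
Proof.
rewrite tr_pauli_string; apply: eq_pauli_string => k x y.
by case: x y => [] [].
Qed.

Lemma trM X Y : (X * Y)^T = Y^T * X^T.
Proof. by rewrite -!mulmxE trmx_mul. Qed.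

Lemma gam_wid_tr (q : 'I_(2 * n)) : (gam (wid q))^T = (- (-1) ^+ odd q) *: gam (wid q).
Proof.
rewrite gam_wid linearZ /= trM parity_tr majorana_tr mxZl majorana_parity.
by rewrite !scalerN scaleNr !scalerA mulrC.
Qed.

(** Row [p] is the vector [gam p] applied to [psi], so the left kernel consists of the vectors whose
    Clifford element annihilates [psi]. *)
Definition actmx psi : 'M[C]_(m, N) := \matrix_(p, j) (gam p *m psi) j 0.

Lemma clc_act (v : 'rV[C]_m) psi : clc v *m psi = (v *m actmx psi)^T.
Proof.
apply/matrixP => i j; rewrite !ord1 /clc mulmx_suml summxE !mxE; apply: eq_bigr => p _.
by rewrite -scalemxAl !mxE.
Qed.

(** The anticommutator of two annihilators is a scalar that kills the nonzero vector [psi]. *)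
Lemma act_isotropic (u v : 'rV[C]_m) psi : psi != 0 ->
  u *m actmx psi = 0 -> v *m actmx psi = 0 -> u *m v^T = 0.
Proof.
move=> h hu hv; have cu : clc u *m psi = 0 by rewrite clc_act hu trmx0.
have cv : clc v *m psi = 0 by rewrite clc_act hv trmx0.
have /(congr1 (fun Z : Mat => Z *m psi)) := clc_acomm u v.
rewrite mulmxDl -!mulmxE -!mulmxA cu cv !mulmx0 addr0 mul_scalar_mx => /esym/eqP.
rewrite scaler_eq0 (negbTE h) orbF mulf_eq0 pnatr_eq0 /= => /eqP e.
by apply/matrixP => i j; rewrite !ord1 e mxE.
Qed.

Lemma hs_eq0 X : \tr (X * adjmx X) = 0 -> X = 0.
Proof.
move=> h; apply/matrixP => i j; rewrite [RHS]mxE.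
have : \sum_i \sum_j `|X i j| ^+ 2 = 0.
  rewrite -[RHS]h; apply: eq_bigr => a _; rewrite -mulmxE mxE.
  by apply: eq_bigr => c _; rewrite !mxE normCK.
move/eqP; rewrite psumr_eq0 => [/allP /(_ i)|a _]; last by apply: sumr_ge0 => c _; apply: exprn_ge0.
rewrite mem_index_enum => /(_ isT) /=; rewrite psumr_eq0 => [/allP /(_ j)|c _]; last exact: exprn_ge0.
by rewrite mem_index_enum => /(_ isT) /=; rewrite sqrf_eq0 normr_eq0 => /eqP.
Qed.

Lemma fq_scale F s (c : C) (a b : 'I_n -> C) :
  fq (frm F) s (fun k => c * a k) (fun k => c * b k) = c ^+ size s *: fq (frm F) s a b.
Proof.
elim: s => [|k s IH]; first by rewrite /fq !big_nil scale1r.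
by rewrite !fq_cons IH -!scalerA -scalerDr mxZl mxZr scalerA -exprS.
Qed.

Lemma frame_state1_idem F : F *m F^T = 1%:M -> frame_state F (fun=> 1) * frame_state F (fun=> 1) = frame_state F (fun=> 1).
Proof.
move=> hF; rewrite /frame_state mxZl mxZr (fqM (frm_clif hF)) rmorph1.
rewrite (_ : (fun k : 'I_n => 1 * 1 + 1 * 1) = fun=> 2%:R * 1); last by apply: funext => k; ring.
rewrite fq_scale size_enum_ord !scalerA; congr (_ *: _).
by have e := inv2X R n; rewrite natrX in e; rewrite -mulrA e mulr1.
Qed.

(** An orthonormal family of [n] annihilators yields a frame whose involutions all fix [psi]. Then
    the frame state with all [lam] equal to 1 and the projector on [psi] are projections of trace 1,
    the first absorbing the second, so their difference has zero Hilbert-Schmidt norm. *)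
Lemma pure_frame psi : psi != 0 -> \tr (psi *m (map_mx (@conjc R) psi)^T) = 1 ->
  (\rank (actmx psi) <= m - n)%N ->
  exists F lam, [/\ F *m F^T = 1%:M, forall j, -1 <= lam j <= 1 &
       psi *m (map_mx (@conjc R) psi)^T = frame_state F lam :> Mat].
Proof.
move=> psi0 tr1 hr; pose K := kermx (actmx psi).
have rk : (n <= \rank K)%N by rewrite mxrank_ker; lia.
have rkm : (\rank K <= m)%N := rank_leq_row _.
pose W0 := schmidt (row_base K).
have W0u : W0 *m (map_mx (@conjc R) W0)^T = 1%:M.
  by have /unitarymxP := schmidt_unitarymx (row_base K) rkm; rewrite -map_trmx.
have W0k : W0 *m actmx psi = 0.
  apply/sub_kermxP; rewrite (eqmx_schmidt_free (row_base_free K)) eq_row_base //.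
pose W : 'M[C]_(n, m) := \matrix_(i, j) W0 (widen_ord rk i) j.
have rW i : row i W = row (widen_ord rk i) W0 by apply/rowP => j; rewrite !mxE.
have Wk i : row i W *m actmx psi = 0 by rewrite rW -row_mul W0k row0.
have Wu : W *m (map_mx (@conjc R) W)^T = 1%:M.
  apply/matrixP => i j; have := congr1 (fun Z : 'M_(\rank K) => Z (widen_ord rk i) (widen_ord rk j)) W0u.
  move=> /= h; have e : (1%:M : 'M[C]_n) i j = (1%:M : 'M[C]_(\rank K)) (widen_ord rk i) (widen_ord rk j).
    by rewrite !mxE.
  rewrite e -h [LHS]mxE [RHS]mxE.
  by apply: eq_bigr => k _; rewrite !mxE.
have WB : W *m W^T = 0.
  apply/matrixP => i j; have := act_isotropic psi0 (Wk i) (Wk j).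
  move/(congr1 (fun Z : 'M_1 => Z 0 0)); rewrite /= [RHS]mxE => h; rewrite [RHS]mxE -[RHS]h !mxE.
  by apply: eq_bigr => k _; rewrite !mxE.
have [_ [F [hF FW]]] := isotropic_frame Wu WB.
have ftpsi j : ft (frm F) j *m psi = psi.
  (* This combination is a multiple of the annihilator [row j W]; multiplying it by [frm F (pe j)]
     gives [1 - ft]. *)
  have e : (frm F (pe j) + 'i *: frm F (po j)) *m psi = 0.
    have -> : frm F (pe j) + 'i *: frm F (po j) = (Num.sqrt 2)%:C *: clc (row j W).
      rewrite /frm /clc !scaler_sumr -big_split; apply: eq_bigr => k _ /=.
      rewrite !scalerA -scalerDl; congr (_ *: _); rewrite [row _ _ _ _]mxE.
      have [e1 _] := FW j (pe j) k; have [_ e2] := FW j (po j) k.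
      rewrite e1 ?val_pe // e2 ?val_po //.
      by case: (W j k) => a c; apply/eqP; rewrite eq_complex /=; apply/andP; split; apply/eqP; ring.
    by rewrite -scalemxAl clc_act Wk trmx0 scaler0.
  have := congr1 (fun z => frm F (pe j) *m z) e; rewrite mulmx0 mulmxA mulmxE.
  rewrite mulrDr (frame_sq (frm_clif hF)) mxZr.
  have -> : 'i *: (frm F (pe j) * frm F (po j)) = - ft (frm F) j by rewrite ftE -scaleNr opprK.
  by rewrite mulmxBl mul1mx => /subr0_eq.
have rpsi : frame_state F (fun=> 1) *m psi = psi.
  have h s : fq (frm F) s (fun=> 1) (fun=> 1%:C) *m psi = (2%:R ^+ size s) *: psi.
    elim: s => [|k s IH]; first by rewrite /fq big_nil mul1mx scale1r.
    rewrite fq_cons -mulmxE -mulmxA IH -scalemxAr mulmxDl -!scalemxAl mul1mx ftpsi.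
    by rewrite -scalerDl scalerA exprSr rmorph1 -[1 + 1]/(2%:R).
  have e := inv2X R n; rewrite natrX in e.
  by rewrite /frame_state -scalemxAl h size_enum_ord scalerA e scale1r.
exists F, (fun=> 1); split=> //; first by move=> j; rewrite lexx andbT; lra.
set rho := frame_state _ _ in rpsi *; pose P : Mat := psi *m (map_mx (@conjc R) psi)^T.
have rr : rho * rho = rho := frame_state1_idem hF.
have rh : adjmx rho = rho := frame_state_herm hF _.
have Ph : adjmx P = P.
  rewrite /adjmx /P map_mxM trmx_mul; congr (_ *m _).
  by apply/matrixP => i j; rewrite !mxE; apply: conjcK.
have PP : P * P = P.
  rewrite -mulmxE /P -mulmxA [_ *m (psi *m _)]mulmxA.
  have -> : (map_mx (@conjc R) psi)^T *m psi = 1%:M.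
    by apply/matrixP => i j; rewrite !ord1 [RHS]mxE -[RHS]tr1 mxtrace_mulC /mxtrace big_ord1.
  by rewrite mul1mx.
have rP : rho * P = P by rewrite -mulmxE mulmxA rpsi.
have Pr : P * rho = P by rewrite -[P in LHS]Ph -[rho in LHS]rh -adjmxM rP.
apply/esym/subr0_eq; apply: hs_eq0.
have -> : adjmx (rho - P) = rho - P by rewrite -scaleN1r adjmxD rh adjmxZ Ph rmorphN1.
rewrite mulrBr !mulrBl rr rP Pr PP subrr subr0 raddfB /= [\tr P]tr1 frame_state_trace // subrr //.
Qed.

End PureStates.

(** * One and two qubits *)

Section SmallSystems.
Variables (R : realType).
Local Notation C := (R[i]).

Lemma antisym_form N (A : 'M[C]_N) (x : 'cV[C]_N) : A^T = - A -> x^T *m A *m x = 0.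
Proof.
move=> hA; set z := x^T *m A *m x.
have : z^T = - z by rewrite /z !trmx_mul trmxK hA mulNmx mulmxN mulmxA.
clearbody z => /(congr1 (fun Z : 'M_1 => Z 0 0)); rewrite /= [LHS]mxE [RHS]mxE => e.
by apply/matrixP => i j; rewrite !ord1 [RHS]mxE; apply/eqP; rewrite -eqNr -e.
Qed.

(** Three generators act on a two-dimensional space, so there are only two columns. *)
Lemma rank_actmx1 (psi : 'cV[C]_(2 ^ 1)) : (\rank (actmx psi) <= (2 * 1).+1 - 1)%N.
Proof. exact: rank_leq_col. Qed.

(* [a c] is the charge conjugation: [a c gamma] is antisymmetric for each of the five
   generators, hence every [gamma psi] is orthogonal to the conjugate of [a c psi]. *)
Lemma rank_actmx2 (psi : 'cV[C]_(2 ^ 2)) : psi != 0 ->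
  (\rank (actmx psi) <= (2 * 2).+1 - 2)%N.
Proof.
move=> psi0; pose a := gam R (@pe 2 0); pose c := gam R (@pe 2 1).
have peT k : (gam R (@pe 2 k))^T = - gam R (pe k).
  by rewrite gam_wid_tr /= oddM /= scaleN1r.
have poT k : (gam R (@po 2 k))^T = gam R (po k).
  by rewrite gam_wid_tr /= oddM /= expr1 opprK scale1r.
have maT : (gam R (@ord_max (2 * 2)))^T = gam R ord_max by rewrite gam_max parity_tr.
have symT p : (gam R p)^T = gam R p -> p != pe 0 -> p != pe 1 -> (a * c * gam R p)^T = - (a * c * gam R p).
  move=> hp p0 p1; rewrite !trM !peT hp mulrNN.
  rewrite [gam R (pe 1) * _](gam_anti R) ?pairE // mulrN; congr (- _).
  by rewrite mulrA (gam_anti R p0) mulNr -[in LHS]mulrA (gam_anti R p1) mulrN opprK mulrA.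
have ac p : (a * c * gam R p)^T = - (a * c * gam R p).
  case: (pairP p) => [k ->|k ->|->].
  - have [->|->] : k = 0 \/ k = 1.
      by case: k => [[|[|//]] h]; [left|right]; apply: val_inj.
    + by rewrite !trM !peT mulrNN mulNr mulrA.
    + by rewrite -mulrA gam_sq mulr1 peT.
  - by apply: symT; rewrite ?poT ?pairE.
  - by apply: symT; rewrite ?maT // eq_sym pairE.
pose B := a * c.
have BT : B^T = - B by rewrite trM !peT mulrNN gam_anti ?pairE.
have phi0 : B *m psi != 0.
  apply: contraNneq psi0 => h; have : (c * a) *m (B *m psi) = 0 by rewrite h mulmx0.
  rewrite mulmxA mulmxE /B -mulrA [a * (a * c)]mulrA gam_sq mul1r gam_sq.
  by rewrite mul1mx => ->.
have ker : actmx psi *m (B *m psi) = 0.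
  apply/matrixP => p j; rewrite !ord1 [RHS]mxE.
  have -> : (actmx psi *m (B *m psi)) p 0 = (psi^T *m ((gam R p)^T * B) *m psi) 0 0.
    have -> : psi^T *m ((gam R p)^T * B) *m psi = (gam R p *m psi)^T *m (B *m psi).
      by rewrite trmx_mul -mulmxE !mulmxA.
    by rewrite [LHS]mxE [RHS]mxE; apply: eq_bigr => k _; rewrite [actmx _ _ _]mxE [_^T _ _]mxE.
  rewrite antisym_form ?mxE //.
  have -> : (gam R p)^T * B = B * gam R p.
    by rewrite -[B in LHS]trmxK BT -[(- B)^T]/(- B)^T raddfN /= mulrN -trM ac opprK.
  exact: ac.
have : (0 < \rank (kermx (actmx psi)^T))%N.
  have /submxP[D hD] : ((B *m psi)^T <= kermx (actmx psi)^T)%MS.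
    by apply/sub_kermxP; rewrite -trmx_mul ker trmx0.
  rewrite lt0n mxrank_eq0; apply: contraNneq phi0 => h.
  by rewrite -[B *m psi]trmxK hD h mulmx0 trmx0.
by rewrite mxrank_ker mxrank_tr subn_gt0.
Qed.

Lemma pure_small n (psi : 'cV[C]_(2 ^ n)) : (0 < n)%N -> (n <= 2)%N ->
  \tr (psi *m (map_mx (@conjc R) psi)^T) = 1 ->
  exists (F : 'M[R]_((2 * n).+1)) lam, [/\ F *m F^T = 1%:M, forall j, -1 <= lam j <= 1 &
       psi *m (map_mx (@conjc R) psi)^T = frame_state F lam :> 'M[C]_(2 ^ n)].
Proof.
move=> n0 n2 htr; have psi0 : psi != 0.
  apply: contra_eqN htr => /eqP ->; by rewrite mul0mx mxtrace0 eq_sym oner_eq0.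
apply: (pure_frame psi0 htr).
case: n n0 n2 psi htr psi0 => [|[|[|]]] // _ _ psi _ psi0; first exact: rank_actmx1.
exact: rank_actmx2.
Qed.

End SmallSystems.

Theorem theorem1 (R : realType) (n : nat) (b : 'I_(2 * n) -> R)
  (Phi : {linear 'M[R[i]]_(2 ^ n) -> 'M[R[i]]_(2 ^ n)}) :
  (1 <= n)%N ->
  (forall p, 0 <= b p <= 1) ->
  fermionic_product_channel b Phi ->
  C1g Phi = n%:R - binH ((1 + b_dec b 0) / 2)
            - \sum_(1 <= j < n) binH ((1 + b_dec b (2 * j).-1 * b_dec b (2 * j)) / 2)
  /\ ((n <= 2)%N -> C1 Phi = C1g Phi).
Proof.
move=> n0 b01 hPhi; rewrite (C1gE b01 hPhi); split.
  by rewrite (sum_nuk b _ n0) opprD addrA.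
move=> n2; apply: (C1E b01 hPhi); apply: (min_output_pure b01 hPhi) => psi.
exact: pure_small.
Qed.
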